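(* Let $[n]=S_1\sqcup\cdots\sqcup S_c$ be a noncrossing component partition (the partition of $[n]$ into ground sets of the connected components of a loopless positroid $\mathcal M_\pi$). For each $j$, let $\Sigma_j$ and $\Sigma'_j$ be homogeneous positroid seed patterns on $S_j$. Denote their respective homogeneous amalgamations by $\Sigma$ and $\Sigma'$. If $\Sigma_j$ and $\Sigma'_j$ are quasi-coincident for every $j$, then $\Sigma$ and $\Sigma'$ are quasi-coincident.
   Context: **Rings.** Over $\mathbb C$. $\mathcal M_\pi=\bigoplus_j\mathcal M_j$ is the decomposition of the loopless positroid into connected components, $\mathcal M_j=\mathcal M_\pi|_{S_j}$; the partition is noncrossing (no two blocks contain cyclically alternating pairs). $R_\pi=\mathbb C[\widehat\Pi_\pi^\circ]$ is the Plücker algebra modulo the $\Delta_J$ with $J$ not a basis, localized at the Plücker coordinates of the forward Grassmann necklace; $R_j$ is the analogous ring of the component positroid on $S_j$ (for a singleton, $R_j=\mathbb C[p_j^{\pm1}]$). All are $\mathbb Z$-graded with Plücker coordinates of degree $1$. There is a graded isomorphism $\partial:R_\pi\xrightarrow{\sim}R_1\#\cdots\#R_c:=\bigoplus_{d\in\mathbb Z}(R_1)_d\otimes\cdots\otimes(R_c)_d$ with $\partial(\Delta_J)=\bigotimes_j\Delta_{J\cap S_j}$ for $J\in\mathcal M_\pi$ (after fixed column sign normalizations). **Homogeneous positroid seed patterns.** Seed patterns (all seeds obtained by mutation) on $R_j$ whose initial seed is associated with a component (plabic/Postnikov) diagram $D_j$ on $S_j$: face coordinates are Plücker coordinates (degree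 $1$), boundary faces are frozen, internal faces mutable, exchange data given by the dual ice quiver $Q(D_j)$; the exchange relations are homogeneous for the grading of $R_j$. Their coefficient group $\mathbb P_j\subseteq R_j^\times$ is the group of Laurent monomials in the forward necklace coordinates of the component. **Homogeneous amalgamation.** The diagrams $D_j$ are assumed embedded in a common disc compatibly with the noncrossing partition; $D=\bigcup_jD_j$, and $Q(D)$ is obtained from $\bigsqcup_jQ(D_j)$ by identifying frozen vertices corresponding to the same boundary region of $D$. For a face $F$ of $D$, let $F_j$ be the face of $D_j$ containing $F$ and $x_{j,F_j}\in R_j$ its coordinate. The homogeneous amalgamation is the seed (pattern) with initial seed $\big((X_F)_{F},Q(D)\big)$, $X_F=\partial^{-1}(x_{1,F_1}\otimes\cdots\otimes x_{c,F_c})$. Its coefficient group is that of $R_\pi$, i.e. the group $\mathbb P_\pi$ of Laurent monomials in the forward necklace coordinates of $\pi$. **Quasi-coincidence.** Two seed patterns in the same field are quasi-coincident if there are seeds, one in each pattern, which are quasi-equivalent: after matching mutable indices, their coefficient groups (Laurent monomials in frozen variables) coincide, corresponding mutable variables differ by elements of this group, and $\widehat y_k=X^{\widetilde Be_k}$ agree for all mutable $k$, where $\widetilde B=(b_{ij})$, $b_{ij}=\#\{j\to i\}-\#\{i\to j\}$. *)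

(* Defs.v *)
From mathcomp Require Export all_boot all_order all_algebra all_fingroup.
From mathcomp Require Export reals complex mpoly.

Set Implicit Arguments.
Unset Strict Implicit.
Unset Printing Implicit Defensive.

Import GRing.Theory.
Local Open Scope ring_scope.

(* The maximal minor of X on the columns in J, taken in increasing order; it
   is 0 by convention unless #|J| = k. *)
Definition minor (A : comNzRingType) (k n : nat) (X : 'M[A]_(k, n))
    (J : {set 'I_n}) : A :=
  if #|J| == k then
    \det (\matrix_(i < k, l < k)
            (if onth (enum J) l is Some s then X i s else 0))
  else 0.

Section Matroids.
Variable n : nat.
Implicit Types (M : {set {set 'I_n}}) (S I J B C : {set 'I_n}).

(* Matroids are given by their sets of bases. *)
Definition positroid (R : realType) M : Prop :=
  exists (k : nat) (X : 'M[R]_(k, n)),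
    [/\ forall J, 0 <= minor X J, M = [set J | minor X J != 0] & M != set0].

Definition loopless M := [forall i, [exists J in M, i \in J]].

Definition mrank M : nat := (\max_(J in M) #|J|)%N.

Definition restriction M S : {set {set 'I_n}} :=
  [set J :&: S | J in M & [forall J' in M, #|J' :&: S| <= #|J :&: S|]%N].

Definition indep M I := [exists B in M, I \subset B].

Definition circuit M S C :=
  minset [pred I : {set 'I_n} | (I \subset S) && ~~ indep M I] C.

Definition connected_matroid M S : Prop :=
  forall a b, a \in S -> b \in S -> a != b ->
    exists C, [/\ circuit M S C, a \in C & b \in C].

Record component_partition M := ComponentPartition {
  blocks : nat;
  block :> 'I_blocks -> {set 'I_n};
  block_neq0 : forall j, block j != set0;
  block_cover : forall a, exists j, a \in block j;
  block_disj : forall i j a, a \in block i -> a \in block j -> i = j;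
  block_noncrossing : forall i j a b a' b', i != j ->
    a \in block i -> b \in block j -> a' \in block i -> b' \in block j ->
    ~~ [&& a < b, b < a' & a' < b']%N;
  block_sum :
    M = [set J : {set 'I_n} | [forall j, J :&: block j \in restriction M (block j)]];
  block_connected :
    forall j, connected_matroid (restriction M (block j)) (block j) }.

Definition block_elt M (P : component_partition M) (j : 'I_(blocks P)) : 'I_n :=
  xchoose (elimT (set0Pn _) (block_neq0 j)).

(* Position of i in the order a < a+1 < ... < a-1. *)
Definition cyc_pos (a i : 'I_n) : nat := ((i + (n - a)) %% n)%N.

Definition gale_le (a : 'I_n) J B : bool :=
  all2 leq (sort leq [seq cyc_pos a i | i <- enum J])
           (sort leq [seq cyc_pos a i | i <- enum B]).

(* Entry at a of the forward Grassmann necklace: the Gale-minimal basis. *)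
Definition necklace M (a : 'I_n) : {set 'I_n} :=
  odflt set0 [pick J in M | [forall B in M, gale_le a J B]].

(* First element of S strictly after a, cyclically. *)
Definition cyc_next S (a : 'I_n) : 'I_n :=
  head a [seq s <- traject (@ordS n) (ordS a) n | s \in S].

(* Last element of S weakly before a, cyclically. *)
Definition cyc_floor S (a : 'I_n) : 'I_n :=
  head a [seq s <- traject (@ord_pred n) a n | s \in S].

End Matroids.

Section PositroidRings.
Variables (F : fieldType) (n : nat).
Implicit Types (M : {set {set 'I_n}}) (S J : {set 'I_n}).

(* Polynomials in one variable p_J for each subset J of [n]; the variables
   with J not a basis are sent to 0 wherever these polynomials are evaluated
   in a positroid ring. *)
Definition plucker_poly := {mpoly F[#|{set 'I_n}|]}.

Definition pvar J : plucker_poly := 'X_(enum_rank J).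

Definition plucker_eval (A : comAlgType F) (D : {set 'I_n} -> A)
    (P : plucker_poly) : A :=
  mmap (in_alg A) (fun i => D (enum_val i)) P.

Definition generic_mx (k : nat) : 'M[{mpoly F[k * n]}]_(k, n) :=
  \matrix_(i, j) 'X_(mxvec_index i j).

(* The image of plucker_eval (generic_minor k S) is the Pluecker algebra of
   Gr(k, S). *)
Definition generic_minor (k : nat) S J : {mpoly F[k * n]} :=
  if J \subset S then minor (generic_mx k) J else 0.

Definition neck_mono M S (e : 'I_n -> nat) : plucker_poly :=
  \prod_(a in S) pvar (necklace M a) ^+ e a.

(* The ring of a positroid M on the ground set S: the Pluecker algebra modulo
   the Delta_J with J not in M, localized at the Delta_J with J in the
   necklace, together with its field of fractions.  The localization is
   given by its characterization: pr_gen and pr_unit express generators and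
   units, and pr_kernel says that the kernel of the map from the Pluecker
   algebra is the necklace-saturation of the ideal of the nonbases. *)
Record positroid_ring M S := PositroidRing {
  pr_ring :> comAlgType F;
  Delta : {set 'I_n} -> pr_ring;
  pr_unit : forall a, a \in S -> exists r, Delta (necklace M a) * r = 1;
  pr_gen : forall r : pr_ring, exists (e : 'I_n -> nat) (P : plucker_poly),
    r * plucker_eval Delta (neck_mono M S e) = plucker_eval Delta P;
  pr_kernel : forall P : plucker_poly, plucker_eval Delta P = 0 <->
    exists (e : 'I_n -> nat) (Q : {set 'I_n} -> plucker_poly),
      plucker_eval (generic_minor (mrank M) S)
        (neck_mono M S e * P - \sum_(J | J \notin M) Q J * pvar J) = 0;
  pr_field : fieldType;
  pr_frac : {rmorphism pr_ring -> pr_field};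
  pr_frac_inj : injective pr_frac;
  pr_fracP : forall z : pr_field, exists r s : pr_ring,
    s != 0 /\ z = pr_frac r / pr_frac s }.

(* r = P(Delta) / neck_mono, with P homogeneous of degree m in the p_J. *)
Definition has_degree M S (A : positroid_ring M S) (d : int) (r : A) : Prop :=
  exists (e : 'I_n -> nat) (m : nat) (P : plucker_poly),
    [/\ P \is m.-homog,
        m%:Z = (\sum_(a in S) e a)%N%:Z + d
      & r * plucker_eval (@Delta M S A) (neck_mono M S e)
        = plucker_eval (@Delta M S A) P].

Definition necklace_group M S (A : positroid_ring M S) (z : pr_field A) : Prop :=
  exists e : 'I_n -> int, z = \prod_(a in S) pr_frac A (Delta A (necklace M a)) ^ e a.

Section Segre.
Variables (c : nat).

Record is_tensor_product (A : 'I_c -> comAlgType F) (T : comAlgType F)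
    (tens : (forall j, A j) -> T) : Prop := {
  tens_linear : forall (r : forall j, A j) i (a : F) (x y : A i),
    tens (dfwith r (a *: x + y)) = a *: tens (dfwith r x) + tens (dfwith r y);
  tens_univ : forall (V : lmodType F) (phi : (forall j, A j) -> V),
    (forall (r : forall j, A j) i (a : F) (x y : A i),
       phi (dfwith r (a *: x + y)) = a *: phi (dfwith r x) + phi (dfwith r y)) ->
    exists! f : T -> V,
      linear f /\ forall r, f (tens r) = phi r;
  tens_one : tens (fun=> 1) = 1;
  tens_mul : forall r r' : forall j, A j,
    tens (fun j => r j * r' j) = tens r * tens r' }.

Variables (M_ : 'I_c -> {set {set 'I_n}}) (S_ : 'I_c -> {set 'I_n}).
Variable A_ : forall j, positroid_ring (M_ j) (S_ j).

(* The degree d part of A_1 # ... # A_c inside the full tensor product. *)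
Definition segre_part (T : comAlgType F) (tens : (forall j, A_ j) -> T)
    (d : int) (t : T) : Prop :=
  exists (m : nat) (r : 'I_m -> forall j, A_ j),
    (forall i j, has_degree d (r i j)) /\ t = \sum_i tens (r i).

End Segre.

(* The graded isomorphism del : R_pi -> R_1 # ... # R_c, with inverse
   delinv.  Both sides being the direct sums of their graded parts, it is an
   injective algebra morphism into the tensor product that maps each graded
   part onto the corresponding one.  The column signs are recorded in
   del_sign: column a of the Pluecker coordinates of R_pi is normalized by
   (-1)^(del_sign a). *)
Record segre_iso M (P : component_partition M) (A : positroid_ring M setT)
    (A_ : forall j, positroid_ring (restriction M (P j)) (P j)) := SegreIso {
  segre_tensor : comAlgType F;
  tens : (forall j, A_ j) -> segre_tensor;
  tensP : @is_tensor_product _ (fun j => pr_ring (A_ j)) segre_tensor tens;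
  del_sign : 'I_n -> bool;
  del : {lrmorphism A -> segre_tensor};
  delinv : segre_tensor -> A;
  delK : cancel del delinv;
  del_graded : forall d t,
    segre_part tens d t <-> exists r : A, has_degree d r /\ del r = t;
  del_plucker : forall J, J \in M ->
    del ((\prod_(a in J) (-1) ^+ del_sign a) * Delta A J)
    = tens (fun j => Delta (A_ j) (J :&: P j)) }.

End PositroidRings.

Arguments tens {F n M P A A_} s r.
Arguments del {F n M P A A_} s.
Arguments delinv {F n M P A A_} s t.

Section Seeds.
Variable K : fieldType.

(* xmat i k = b_ik = #{k -> i} - #{i -> k}, for k mutable. *)
Record seed := Seed {
  mut : finType;
  froz : finType;
  mvar : mut -> K;
  fvar : froz -> K;
  xmat : mut + froz -> mut -> int }.

Definition xvar (s : seed) (i : mut s + froz s) : K :=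
  match i with inl k => mvar k | inr f => fvar f end.

Definition pos_part (z : int) : nat := if 0 <= z then `|z|%N else 0%N.

Definition mutate (s : seed) (k : mut s) : seed :=
  @Seed (mut s) (froz s)
    (fun i => if i == k then
        (\prod_(v : mut s + froz s) xvar v ^+ pos_part (xmat v k)
         + \prod_(v : mut s + froz s) xvar v ^+ pos_part (- xmat v k)) / mvar k
      else mvar i)
    (@fvar s)
    (fun v i => if (v == inl k) || (i == k) then - xmat v i
      else xmat v i + (pos_part (xmat v k) * pos_part (xmat (inl k) i))%N%:Z
                    - (pos_part (- xmat v k) * pos_part (- xmat (inl k) i))%N%:Z).

(* reachable s s': s' belongs to the seed pattern of s. *)
Inductive reachable (s : seed) : seed -> Prop :=
| reachable_refl : reachable s s
| reachable_step s' (k : mut s') : reachable s s' -> reachable s (mutate k).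

Definition coef_group (s : seed) (z : K) : Prop :=
  exists e : froz s -> int, z = \prod_f fvar f ^ e f.

Definition yhat (s : seed) (k : mut s) : K :=
  \prod_(v : mut s + froz s) xvar v ^ xmat v k.

Definition quasi_equivalent (s s' : seed) : Prop :=
  (forall z, coef_group s z <-> coef_group s' z) /\
  exists sigma : mut s -> mut s', bijective sigma /\ forall k : mut s,
    coef_group s (mvar k / mvar (sigma k)) /\ yhat k = yhat (sigma k).

(* The patterns of s0 and s0' are quasi-coincident. *)
Definition quasi_coincident (s0 s0' : seed) : Prop :=
  exists s s', [/\ reachable s0 s, reachable s0' s' & quasi_equivalent s s'].

(* The extended cluster of s freely generates K over the subfield kappa(F). *)
Definition freely_generating (F : fieldType) (kappa : F -> K) (s : seed) : Prop :=
  let ev (P : {mpoly F[#|{: mut s + froz s}|]}) : K :=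
    mmap kappa (fun i => xvar (enum_val i)) P in
  (forall P, ev P = 0 -> P = 0) /\
  (forall z, exists P Q, ev Q != 0 /\ z = ev P / ev Q).

End Seeds.

Section Diagrams.
Variable n : nat.

(* A plabic graph in a disc with boundary vertices S, numbered clockwise,
   encoded as a planar combinatorial map: the boundary circle is contracted to
   one extra vertex "infinity" of the sphere, whose outgoing darts are
   pb_bd s, s in S.  pb_opp reverses a dart, pb_rot gives the next dart
   counterclockwise around its origin; counterclockwise around infinity is
   clockwise along the boundary circle.  pb_black d is the color of the origin
   of d, irrelevant at infinity, and pb_bd is irrelevant outside S. *)
Record plabic (S : {set 'I_n}) := Plabic {
  pb_dart : finType;
  pb_opp : {perm pb_dart};
  pb_rot : {perm pb_dart};
  pb_black : pb_dart -> bool;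
  pb_bd : 'I_n -> pb_dart;
  pb_oppK : involutive pb_opp;
  pb_opp_neq : forall d, pb_opp d != d;
  pb_black_rot : forall d, pb_black (pb_rot d) = pb_black d;
  pb_bd_inj : {in S &, injective pb_bd};
  pb_bd_rot : {in S, forall s, pb_rot (pb_bd s) = pb_bd (cyc_next S s)};
  pb_connected :
    forall d d', connect [rel x y | (y == pb_opp x) || (y == pb_rot x)] d d';
  pb_euler : (#|porbits pb_rot| + #|porbits (pb_opp * (pb_rot^-1))%g|
              = #|porbits pb_opp| + 2)%N }.

Variables (S : {set 'I_n}) (D : plabic S).

(* Next dart along the boundary of the face to the left of a dart (first
   pb_opp, then the inverse of pb_rot). *)
Definition face_perm : {perm pb_dart D} := (pb_opp D * (pb_rot D)^-1)%g.

Definition face : finType := {f : {set pb_dart D} | f \in porbits face_perm}.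

Lemma porbit_face (d : pb_dart D) : porbit face_perm d \in porbits face_perm.
Proof. exact: imset_f. Qed.

(* The face to the left of d. *)
Definition face_of (d : pb_dart D) : face :=
  exist _ (porbit face_perm d) (porbit_face d).

(* The face of D containing the part of the boundary circle of the
   n-marked disc between a and a+1. *)
Definition gap_face (a : 'I_n) : face := face_of (pb_bd D (cyc_floor S a)).

Definition bdry_face (f : face) : bool := [exists s in S, gap_face s == f].

Definition iface : finType := {f : face | ~~ bdry_face f}.
Definition bface : finType := {f : face | bdry_face f}.

Definition fsum (v : iface + bface) : face :=
  match v with inl f => val f | inr f => val f end.

Definition at_bd (d : pb_dart D) : bool := [exists s in S, pb_bd D s == d].

(* Dual quiver: one arrow across each edge joining a black and a white
   internal vertex, crossing it with the white vertex on its left; so for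
   the dart d from black to white it goes from the left to the right of d.
   2-cycles are cancelled and arrows between frozen vertices dropped only
   when passing to the exchange matrix. *)
Definition arrows (u v : iface + bface) : nat :=
  #|[set d | [&& ~~ at_bd d, ~~ at_bd (pb_opp D d),
                 pb_black d, ~~ pb_black (pb_opp D d),
                 face_of d == fsum u & face_of (pb_opp D d) == fsum v]]|.

Definition diagram_xmat (v : iface + bface) (k : iface) : int :=
  (arrows (inl k) v)%:Z - (arrows v (inl k))%:Z.

End Diagrams.

Section HomogeneousSeeds.
Variables (F : fieldType) (n : nat).

Definition diagram_seed (M : {set {set 'I_n}}) (S : {set 'I_n})
    (A : positroid_ring F M S) (D : plabic S) (lab : face D -> {set 'I_n}) :
    seed (pr_field A) :=
  @Seed _ (iface D) (bface D)
    (fun f => pr_frac A (Delta A (lab (val f))))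
    (fun f => pr_frac A (Delta A (lab (val f))))
    (@diagram_xmat n S D).

(* Initial data of a homogeneous positroid seed pattern.  hp_homog: the two
   terms of each initial exchange relation are homogeneous of the same
   degree. *)
Record hpos_seed (M : {set {set 'I_n}}) (S : {set 'I_n})
    (A : positroid_ring F M S) := HposSeed {
  hp_diag : plabic S;
  hp_lab : face hp_diag -> {set 'I_n};
  hp_basis : forall f, hp_lab f \in M;
  hp_free : freely_generating (fun a => pr_frac A a%:A) (diagram_seed A hp_lab);
  hp_coef : forall z, coef_group (diagram_seed A hp_lab) z <-> necklace_group z;
  hp_homog : forall k : iface hp_diag, exists d : int,
    has_degree d (\prod_v Delta A (hp_lab (fsum v)) ^+ pos_part (diagram_xmat v k)) /\
    has_degree d (\prod_v Delta A (hp_lab (fsum v)) ^+ pos_part (- diagram_xmat v k)) }.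

Definition hp_seed M S (A : positroid_ring F M S) (s : hpos_seed A) :
    seed (pr_field A) :=
  diagram_seed A (@hp_lab _ _ _ s).

Section Amalgamation.
Variables (M : {set {set 'I_n}}) (P : component_partition M).
Variable D_ : forall j : 'I_(blocks P), plabic (P j).

(* A face F of the union D of the D_j, placed in the disc with n marked
   points, is determined by the tuple (F_j)_j of the faces of the D_j
   containing it.  It is either an internal face of exactly one D_j (and then
   F_i, for i <> j, is the face of D_i containing D_j), or a boundary region,
   that is, the region containing one of the n boundary arcs. *)
Definition arc_region (a : 'I_n) : {dffun forall j, face (D_ j)} :=
  [ffun j => gap_face (D_ j) a].

Definition am_mut : finType := {j : 'I_(blocks P) & iface (D_ j)}.

Definition am_froz : finType :=
  {t : {dffun forall j, face (D_ j)} | [exists a, t == arc_region a]}.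

Definition am_faces (u : am_mut + am_froz) (i : 'I_(blocks P)) : face (D_ i) :=
  match u with
  | inl (existT j f) =>
      dfwith (fun i => gap_face (D_ i) (block_elt j)) (val f) i
  | inr t => (val t : {dffun forall j, face (D_ j)}) i
  end.

(* The vertex v of Q(D_j) becomes the vertex u of Q(D).  The boundary face of
   D_j following s corresponds to the region of D containing the arc from s
   to s+1: this is the region in that face adjacent to D_j. *)
Definition glued (j : 'I_(blocks P)) (v : iface (D_ j) + bface (D_ j))
    (u : am_mut + am_froz) : bool :=
  match v, u with
  | inl f, inl w => w == Tagged (fun j => iface (D_ j)) f
  | inr f, inr t => [exists s in P j, (gap_face (D_ j) s == val f)
                                      && (arc_region s == val t)]
  | _, _ => false
  end.

Definition am_arrows (u w : am_mut + am_froz) : nat :=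
  (\sum_j \sum_(v | glued (j := j) v u) \sum_(v' | glued (j := j) v' w)
     arrows v v')%N.

Definition am_xmat (u : am_mut + am_froz) (k : am_mut) : int :=
  (am_arrows (inl k) u)%:Z - (am_arrows u (inl k))%:Z.

End Amalgamation.

(* X_F = del^-1 (x_{1,F_1} (x) ... (x) x_{c,F_c}). *)
Definition amalgamation (M : {set {set 'I_n}}) (P : component_partition M)
    (A : positroid_ring F M setT)
    (A_ : forall j, positroid_ring F (restriction M (P j)) (P j))
    (dl : segre_iso A A_) (s_ : forall j, hpos_seed (A_ j)) :
    seed (pr_field A) :=
  let D_ j := hp_diag (s_ j) in
  let X (u : am_mut D_ + am_froz D_) : pr_field A :=
    pr_frac A (delinv dl (tens dl (fun j => Delta (A_ j) (hp_lab (am_faces u j))))) in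
  @Seed _ (am_mut D_) (am_froz D_)
    (fun k => X (inl k)) (fun f => X (inr f)) (@am_xmat M P D_).

End HomogeneousSeeds.

(* Main.v *)
(* An element x of degree d of R_j has the image
   del^-1 (w_1^d (x) .. (x) x (x) .. (x) w_c^d) in R_pi, where w_i is the coordinate
   of the face of D_i that contains S_j.  This map is multiplicative, and additive
   in each degree, so it carries the exchange relations of block j, which are
   homogeneous, to exchange relations of the amalgamation.  Hence mutations inside
   block j are mutations of the amalgamation, they leave the other blocks alone,
   and quasi-equivalence can be checked block by block; the frozen group of the
   amalgamation consists of the families of elements of the groups P_j having all
   the same degree.

   The gluing is faithful only if distinct s in S_j give distinct boundary faces
   of D_j.  Otherwise P_j would have rank less than #|S_j|, whereas the necklace
   coordinates of a connected positroid are multiplicatively independent.  Indeed,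
   a monomial relation of exponents e holds on every totally nonnegative matrix
   with these bases; by homogeneity its exponents add up to 0, and the level sets
   of the partial sums of e are then separators of the matroid: by induction on
   the number of bases, subtract from a column the largest multiple of a
   neighbouring one that keeps the matrix totally nonnegative. *)
Require Import Defs.
From mathcomp Require Import zify ring lra boolp.
From mathcomp Require classical_sets.
Set Implicit Arguments.
Unset Strict Implicit.
Unset Printing Implicit Defensive.
Import Order.TTheory GRing.Theory Num.Theory.
Local Open Scope ring_scope.

(** * Maximal minors *)

Section Minors.
Variables (n : nat).
Implicit Types (J R : {set 'I_n}).

(** Mutated variables are only known to lie in the fraction fields, so degrees and the inverse of
    [del] are extended to homogeneous fractions; no Laurent property enters. The extension [lift] is
    a relation, single-valued because a pure tensor of nonzero elements is nonzero. The elements w_i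
    depend on the diagrams, so matched block seeds enter the two amalgamations with different
    paddings. This does no harm: each y-hat has degree 0, where the padding is trivial, and
    elsewhere the paddings are themselves coefficients. Every family of a common degree is a
    coefficient because moving a boundary arc across one marked point changes the face of a single
    block: a quotient of neighbouring frozen variables lives in one block. Independence uses
    positivity twice. It yields the noncrossing statement from which two neighbouring movable
    columns i, j fit for the subtraction are found. Then, adding back s times column i, only the
    necklace entries on the arc from i to j see s, all in the same way; comparing two values of s,
    where equal powers of distinct positive reals force exponent 0, kills the sum of e over that
    arc. *)

Definition rank_in R (x : 'I_n) : nat := #|[set r in R | (r < x)%N]|.

Lemma enum_pairwise (A : {set 'I_n}) : pairwise (fun a b : 'I_n => (a < b)%N) (enum A).
Proof.
have ltT : transitive (fun a b : 'I_n => (a < b)%N) by move=> b a c; exact: ltn_trans.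
rewrite -(sorted_pairwise ltT) /enum_mem; apply: sorted_filter => //.
by have := iota_ltn_sorted 0 n; rewrite -val_enum_ord sorted_map enumT.
Qed.

Lemma enum_setU1 R x : x \notin R -> exists s1 s2,
  [/\ enum R = s1 ++ s2, enum (x |: R) = s1 ++ x :: s2 & size s1 = rank_in R x].
Proof.
move=> xR.
pose lt := fun a b : 'I_n => (a < b)%N.
have ltT : transitive lt by move=> b a c; exact: ltn_trans.
have ltI : irreflexive lt by move=> a; exact: ltnn.
have pE := enum_pairwise.
have mF (p : pred 'I_n) (A : {set 'I_n}) y :
    (y \in filter p (enum A)) = p y && (y \in A).
  by rewrite (mem_filter p y (enum A)) mem_enum.
pose s1 := [seq y : 'I_n <- enum R | (y < x)%N]; pose s2 := [seq y : 'I_n <- enum R | (x < y)%N].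
have p1 : pairwise lt s1 by exact: pairwise_filter.
have p2 : pairwise lt s2 by exact: pairwise_filter.
have a12 : allrel lt s1 s2.
  apply/allrelP => a b; rewrite !mem_filter => /andP[ax _] /andP[xb _].
  exact: ltn_trans xb.
exists s1, s2; split.
- apply: (irr_sorted_eq ltT ltI); rewrite ?(sorted_pairwise ltT) // ?pairwise_cat ?a12 ?p1 //.
  move=> y; rewrite mem_cat !mF -andb_orl mem_enum.
  by case: ltngtP => //= /val_inj ->; rewrite (negbTE xR).
- apply: (irr_sorted_eq ltT ltI); rewrite ?(sorted_pairwise ltT) //.
    rewrite pairwise_cat p1 /= p2 andbT allrel_consr a12 andbT.
    by apply/andP; split; apply/allP => y; rewrite mF => /andP[].
  move=> y; rewrite mem_cat inE !mF !mem_enum !inE -(inj_eq val_inj).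
  by case: ltngtP => //=; rewrite orbF.
- rewrite /rank_in cardE.
  apply: perm_size; apply: uniq_perm; rewrite ?(filter_uniq _ (enum_uniq _)) ?enum_uniq //.
  by move=> y; rewrite mF mem_enum inE andbC.
Qed.

Variables (A : comNzRingType) (k : nat).
Implicit Types X Y : 'M[A]_(k, n).

(* The linear functional x |-> det (x, R) of the columns, up to sign. *)
Definition hyper X R : 'rV[A]_k :=
  \row_i ((-1) ^+ i * \det (\matrix_(a < k.-1, l < k.-1)
     (if onth (enum R) l is Some b then X (lift i a) b else 0))).

Lemma eq_hyper X Y R : (forall i b, b \in R -> X i b = Y i b) ->
  hyper X R = hyper Y R.
Proof.
move=> eXY; apply/rowP => i; rewrite !mxE; congr (_ * \det _).
apply/matrixP => a l; rewrite !mxE; case E: onth => [b|//].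
by apply: eXY; rewrite -mem_enum; apply/onthP; exists l.
Qed.

(** Laplace expansion along the column of [x], which stands at position [rank_in R x]. The cofactors
    do not involve [x], so they form a functional depending on [R] alone. *)
Lemma minor_setU1 X R x : #|R|.+1 = k -> x \notin R ->
  minor X (x |: R) = (-1) ^+ rank_in R x * (hyper X R *m X) 0 x.
Proof.
move=> cR xR; rewrite /minor cardsU1 xR add1n cR eqxx.
have [s1 [s2 [eR exR sz]]] := enum_setU1 xR.
have pk : (rank_in R x < k)%N.
  by rewrite -cR ltnS -sz cardE eR size_cat leq_addr.
rewrite (expand_det_col _ (Ordinal pk)) mxE big_distrr /=; apply: eq_bigr => i _.
rewrite !mxE exR onth_cat sz ltnn subnn /= /cofactor exprD /=.
rewrite [RHS]mulrA [RHS]mulrC mulrCA mulrA [X in X * _]mulrC -mulrA mulrA -!mulrA.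
congr (_ * _); rewrite mulrCA; congr (_ * (_ * \det _)).
apply/matrixP => a l; rewrite !mxE eR !onth_cat sz /= /bump.
case: (ltnP l) => lp /=; first by rewrite add0n lp.
by rewrite add1n ltnNge leqW //= subSn.
Qed.

End Minors.

(** Up to sign the value is a determinant whose column [x] occurs twice. *)
Lemma hyper_eq0 n (A : comNzRingType) k (X : 'M[A]_(k, n)) (R : {set 'I_n}) x :
  #|R|.+1 = k -> x \in R -> (hyper X R *m X) 0 x = 0.
Proof.
move=> cR xR.
case: k X cR => // k' X [cR].
pose B : 'M[A]_k'.+1 := \matrix_(i, l) (if l == 0 then X i x else
   if onth (enum R) l.-1 is Some b then X i b else 0).
have dB : \det B = 0.
  have [m em] : exists m, onth (enum R) m = Some x by apply/onthP; rewrite mem_enum.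
  have mk : (m.+1 < k'.+1)%N.
    by rewrite ltnS -cR cardE -onthTE em.
  rewrite -det_tr; apply: (determinant_alternate (i1 := 0) (i2 := Ordinal mk)) => //.
  by move=> i; rewrite !mxE /= em.
rewrite -dB (expand_det_col _ 0) mxE; apply: eq_bigr => i _.
rewrite !mxE /= mulrC /cofactor addn0; congr (_ * (_ * \det _)).
by apply/matrixP => a l; rewrite !mxE.
Qed.

Lemma minor_neq0_card n (A : comNzRingType) k (X : 'M[A]_(k, n)) (J : {set 'I_n}) :
  minor X J != 0 -> #|J| = k.
Proof. by rewrite /minor; case: (#|J| =P k) => // _; rewrite eqxx. Qed.

(** The functional of [J :\ j] does not see the column operation, so the minor is linear in column
    [j]. The sign carries column [i] from the place of [j] to its own place in increasing order. *)
Lemma minor_add_col n (A : comNzRingType) k (X Y : 'M[A]_(k, n)) (c : A) (i j : 'I_n) :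
  i != j -> (forall a b, Y a b = X a b + (if b == j then c * X a i else 0)) ->
  forall J, minor Y J = minor X J +
    (if (j \in J) && (i \notin J) then
       c * (-1) ^+ (rank_in (J :\ j) i + rank_in (J :\ j) j) * minor X (i |: J :\ j)
     else 0).
Proof.
move=> ij eY J.
have [cJ|cJ] := eqVneq #|J| k; last first.
  rewrite {1 2}/minor (negbTE cJ) add0r; case: ifP => // /andP[jJ iJ].
  have c' : #|i |: J :\ j| = #|J|.
    by rewrite cardsU1 !inE negb_and ij iJ orbT (cardsD1 j J) jJ.
  by rewrite /minor c' (negbTE cJ) mulr0.
have [jJ|jJ] /= := boolP (j \in J); last first.
  rewrite addr0 /minor; congr (if _ then \det _ else _).
  apply/matrixP => a l; rewrite !mxE; case E: onth => [b|//].
  have bJ : b \in J by rewrite -mem_enum; apply/onthP; exists l.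
  by rewrite eY; case: eqP => [bj|]; rewrite ?addr0 // -bj bJ in jJ *.
have cR : #|J :\ j|.+1 = k by rewrite -cJ (cardsD1 j J) jJ.
have eJ : J = j |: J :\ j by rewrite setD1K.
have jR : j \notin J :\ j by rewrite !inE eqxx.
have hXY : hyper Y (J :\ j) = hyper X (J :\ j).
  by apply: eq_hyper => a b; rewrite !inE => /andP[/negbTE bj _]; rewrite eY bj addr0.
rewrite {1 2}eJ (minor_setU1 Y cR jR) (minor_setU1 X cR jR) hXY.
have -> : (hyper X (J :\ j) *m Y) 0 j =
  (hyper X (J :\ j) *m X) 0 j + c * (hyper X (J :\ j) *m X) 0 i.
  rewrite !mxE big_distrr -big_split /=; apply: eq_bigr => a _.
  by rewrite eY eqxx mulrDr mulrCA.
rewrite mulrDr; congr (_ + _).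
have [iJ|iJ] /= := boolP (i \in J).
  by rewrite hyper_eq0 ?mulr0 // !inE ij.
rewrite minor_setU1 // ?inE ?negb_and ?ij ?iJ ?orbT //.
rewrite exprD; set u := _ ^+ rank_in _ i; set v := _ ^+ rank_in _ j; set h := _ 0 i.
have uu : u * u = 1 by rewrite -expr2 sqrr_sign.
by rewrite -[LHS]mul1r -uu; ring.
Qed.

Section MinorExchange.
Variables (n k : nat) (K : fieldType) (X : 'M[K]_(k, n)).
Implicit Types (J R : {set 'I_n}).

Lemma minor_neq0_hyper R x : #|R|.+1 = k ->
  (x \notin R) && (minor X (x |: R) != 0) = ((hyper X R *m X) 0 x != 0).
Proof.
move=> cR; case: (boolP (x \in R)) => [xR|xR] /=.
  by rewrite hyper_eq0 ?eqxx.
by rewrite minor_setU1 // mulf_eq0 signr_eq0.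
Qed.

Lemma minor_inj J (u : 'rV[K]_k) : minor X J != 0 ->
  (forall b, b \in J -> (u *m X) 0 b = 0) -> u = 0.
Proof.
move=> nz uJ; have cJ := minor_neq0_card nz.
move: nz; rewrite /minor cJ eqxx; set M := \matrix_(_, _) _ => nz.
have uM : M \in unitmx by rewrite unitmxE unitfE.
suff uM0 : u *m M = 0 by rewrite -[u](mulmxK uM) uM0 mul0mx.
apply/rowP => l; rewrite mxE [RHS]mxE.
have ls : (l < size (enum J))%N by rewrite -cardE cJ.
have [b eb] : exists b, onth (enum J) l = Some b.
  by move: ls; rewrite -onthTE; case: onth => // b _; exists b.
rewrite -[RHS](uJ b).
  by rewrite [RHS]mxE; apply: eq_bigr => i _; rewrite !mxE eb.
by rewrite -mem_enum; apply/onthP; exists l.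
Qed.

(** Expand column [x] in the basis [J]. The functional of [R] is nonzero at [x], so it is nonzero at
    some [y] of [J] that occurs with a nonzero coefficient; the first fact gives one basis, the
    second the other. *)
Lemma minor_exchange J R x : minor X J != 0 -> minor X (x |: R) != 0 -> x \notin R ->
  exists2 y, y \in J & minor X (y |: R) != 0 /\ minor X (x |: J :\ y) != 0.
Proof.
move=> nz nzx xR; have cJ := minor_neq0_card nz.
have cR : #|R|.+1 = k by have := minor_neq0_card nzx; rewrite cardsU1 xR.
move: (nz); rewrite /minor cJ eqxx; set M := \matrix_(_, _) _ => nzM.
have uM : M \in unitmx by rewrite unitmxE unitfE.
pose c := invmx M *m col x X.
have ec : col x X = M *m c by rewrite mulKVmx.
have eu (u : 'rV_k) (l : 'I_k) b : onth (enum J) l = Some b ->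
    (u *m M) 0 l = (u *m X) 0 b.
  by move=> eb; rewrite !mxE; apply: eq_bigr => i _; rewrite !mxE eb.
have ev (u : 'rV_k) : (u *m X) 0 x = \sum_l (u *m M) 0 l * c l 0.
  have -> : (u *m X) 0 x = (u *m col x X) 0 0.
    by rewrite !mxE; apply: eq_bigr => i _; rewrite !mxE.
  by rewrite ec mulmxA mxE.
have oJ (l : 'I_k) : exists2 b, onth (enum J) l = Some b & b \in J.
  have : onth (enum J) l by rewrite onthTE -cardE cJ.
  case e: onth => [b|//] _; exists b => //.
  by rewrite -mem_enum; apply/onthP; exists l.
have : (hyper X R *m X) 0 x != 0 by rewrite -minor_neq0_hyper // xR nzx.
rewrite ev => /eqP sn0.
have [l hl] : exists l, (hyper X R *m M) 0 l * c l 0 != 0.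
  apply/existsP; apply: contra_notT sn0 => /existsPn h.
  by apply: big1 => l _; apply/eqP; have := h l; rewrite negbK.
move: hl; rewrite mulf_eq0 negb_or => /andP[hl cl].
have [b eb bJ] := oJ l; exists b => //.
have cb : #|J :\ b|.+1 = k by rewrite -cJ (cardsD1 b J) bJ.
split.
  by rewrite (eu _ _ _ eb) -minor_neq0_hyper // in hl; case/andP: hl.
have : (hyper X (J :\ b) *m X) 0 x != 0.
  rewrite ev (bigD1 l) //= big1 ?addr0 => [|m ml]; last first.
    have [d ed dJ] := oJ m; rewrite (eu _ _ _ ed) hyper_eq0 ?mul0r // !inE dJ andbT.
    apply: contra ml => /eqP db; apply/eqP/val_inj/eqP.
    rewrite /= -(nth_uniq b (s := enum J)) ?enum_uniq -?cardE ?cJ //.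
    by rewrite (@onth_nth _ b _ _ _ ed) (@onth_nth _ b _ _ _ eb) db.
  by rewrite mulf_neq0 // (eu _ _ _ eb) -minor_neq0_hyper // !inE eqxx /= setD1K.
by rewrite -minor_neq0_hyper // => /andP[].
Qed.

End MinorExchange.

(** * Total nonnegativity and cyclic intervals *)

Definition bases (K : fieldType) n k (X : 'M[K]_(k, n)) : {set {set 'I_n}} :=
  [set J | minor X J != 0].

Definition tnn (K : realFieldType) n k (X : 'M[K]_(k, n)) : Prop :=
  forall J, 0 <= minor X J.

Lemma rank_inU1 n (R : {set 'I_n}) b x : b \notin R ->
  rank_in (b |: R) x = ((b < x) + rank_in R x)%N.
Proof.
move=> bR; rewrite /rank_in; case: (ltnP b x) => bx.
  have -> : [set r in b |: R | (r < x)%N] = b |: [set r in R | (r < x)%N].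
    by apply/setP => y; rewrite !inE; case: eqP => [->|//]; rewrite bx.
  by rewrite cardsU1 inE negb_and bR.
rewrite add0n; apply: eq_card => y; rewrite !inE; case: eqP => [->|//].
by rewrite (ltnNge b) bx !andbF.
Qed.

(* Two elements spanning the same hyperplane over R0 cannot be separated by
   two elements off that hyperplane (three-term Pluecker relation). *)
Lemma tnn_noncrossing (K : realFieldType) n k (X : 'M[K]_(k, n)) (R0 : {set 'I_n})
    i b p q : tnn X -> (#|R0|.+2)%N = k -> i \notin R0 -> b \notin R0 ->
  i |: (b |: R0) \notin bases X -> p |: (b |: R0) \in bases X ->
  p |: (i |: R0) \in bases X -> q |: (b |: R0) \in bases X ->
  ((i < p)%N (+) (i < q)%N) = ((b < p)%N (+) (b < q)%N).
Proof.
move=> tX cR iR bR; rewrite !inE negbK => ib pb pi qb.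
pose B := b |: R0; pose I := i |: R0.
have cB : #|B|.+1 = k by rewrite cardsU1 bR.
have cI : #|I|.+1 = k by rewrite cardsU1 iR.
have notin x (C : {set 'I_n}) : #|C|.+1 = k -> minor X (x |: C) != 0 -> x \notin C.
  move=> cC /minor_neq0_card; rewrite cardsU1; case: (x \in C) => //= e.
  by move: cC; rewrite -e => /esym/n_Sn.
have pB := notin _ _ cB pb; have pI := notin _ _ cI pi; have qB := notin _ _ cB qb.
have qi : q != i by apply: contra qb => /eqP ->.
have qI : q \notin I by move: qB; rewrite !inE !negb_or qi => /andP[].
pose h := hyper X B; pose h' := hyper X I.
have hi : (h *m X) 0 i = 0.
  apply/eqP; have := minor_neq0_hyper X i cB; rewrite ib andbF => /esym/negbFE.
  exact.
have lin a c y : ((a *: h - c *: h') *m X) 0 y = a * (h *m X) 0 y - c * (h' *m X) 0 y.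
  by rewrite mulmxBl -!scalemxAl; move: (h *m X) (h' *m X) => U V; rewrite !mxE.
(* Both functionals vanish on [i] and on [R0], and the coefficients cancel the values at [p]; so the
   combination kills the basis [p |: I]. *)
have u0 : (h' *m X) 0 p *: h - (h *m X) 0 p *: h' = 0.
  apply: (minor_inj pi) => y; rewrite !inE => yI.
  rewrite lin.
  case/or3P: yI => [/eqP->|/eqP->|yR].
  - by rewrite mulrC subrr.
  - by rewrite hi (hyper_eq0 X cI (setU11 _ _)) !mulr0 subrr.
  - by rewrite (hyper_eq0 X cI (setU1r _ yR)) (hyper_eq0 X cB (setU1r _ yR)) !mulr0 subrr.
have e : (h' *m X) 0 p * (h *m X) 0 q = (h *m X) 0 p * (h' *m X) 0 q.
  apply/eqP; rewrite -subr_eq0; apply/eqP.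
  have := congr1 (fun u => (u *m X) 0 q) u0.
  by rewrite lin mul0mx => ->; rewrite mxE.
have hE (C : {set 'I_n}) x : #|C|.+1 = k -> x \notin C ->
    (hyper X C *m X) 0 x = (-1) ^+ rank_in C x * minor X (x |: C).
  by move=> cC xC; rewrite minor_setU1 // signrMK.
move: e; rewrite !hE // !rank_inU1 // => e.
have gt0 J : minor X J != 0 -> 0 < minor X J by move=> J0; rewrite lt_neqAle eq_sym J0 tX.
(* Up to sign, [e] equates two products of nonnegative minors, one of them positive. Hence the signs
   agree, and the contributions of [R0] to them cancel. *)
have P1 := mulr_gt0 (gt0 _ pi) (gt0 _ qb).
have P2 := mulr_ge0 (tX (p |: B)) (tX (q |: I)).
move: e; rewrite -/B -/I.
rewrite mulrACA [RHS]mulrACA -!exprD -signr_odd -[in RHS]signr_odd.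
rewrite !oddD !oddb.
case: (i < p)%N; case: (i < q)%N; case: (b < p)%N; case: (b < q)%N => //=;
  case: (odd _); case: (odd _) => //=; rewrite ?expr0 ?expr1; lra.
Qed.

Lemma cyc_posE n (a x : 'I_n) :
  cyc_pos a x = if (a <= x)%N then (x - a)%N else (x + n - a)%N.
Proof.
rewrite /cyc_pos; have an := ltn_ord a; have xn := ltn_ord x.
case: (leqP a x) => ax; last by rewrite modn_small; lia.
have -> : (x + (n - a) = (x - a) + n)%N by lia.
by rewrite modnDr modn_small; lia.
Qed.

Lemma cyc_pos_inj n (a : 'I_n) : injective (cyc_pos a).
Proof.
move=> x y; rewrite !cyc_posE => e; apply: val_inj => /=.
have an := ltn_ord a; have xn := ltn_ord x; have yn := ltn_ord y.
by move: e; do 2 case: ifP; lia.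
Qed.

Lemma cyc_pos_xx n (a : 'I_n) : cyc_pos a a = 0%N.
Proof. by rewrite cyc_posE leqnn subnn. Qed.

Lemma cyc_pos_shift n (i j x : 'I_n) :
  cyc_pos j x = if (cyc_pos i j <= cyc_pos i x)%N then (cyc_pos i x - cyc_pos i j)%N
                else (cyc_pos i x + n - cyc_pos i j)%N.
Proof.
rewrite !cyc_posE.
have := ltn_ord i; have := ltn_ord j; have := ltn_ord x => h1 h2 h3.
by do ?case: ifP; lia.
Qed.

Lemma cyc_pos_lt n (a x : 'I_n) : (cyc_pos a x < n)%N.
Proof.
by have := ltn_ord a; have := ltn_ord x => h1 h2; rewrite cyc_posE; case: ifP; lia.
Qed.

(** The pairs [i], [b] and [j], [d] alternate around the circle; this is what contradicts
    [tnn_noncrossing]. *)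
Lemma cyc_crossing n (i j b d : 'I_n) : (0 < cyc_pos i j)%N ->
  (cyc_pos i j < cyc_pos i b)%N -> (cyc_pos i b < cyc_pos i d)%N ->
  ((i < j)%N (+) (i < d)%N) != ((b < j)%N (+) (b < d)%N).
Proof.
rewrite !cyc_posE.
have := ltn_ord i; have := ltn_ord j; have := ltn_ord b; have := ltn_ord d => h1 h2 h3 h4.
by case: (ltngtP i j); case: (ltngtP i b); case: (ltngtP i d); case: (ltngtP b j);
  case: (ltngtP b d) => //=; lia.
Qed.

(** * Exchange, greedy bases and the existence of a bridge *)

Section Matroid.
Variables (n k : nat) (N : {set {set 'I_n}}).

(* By the exchange property, local optimality for a < a+1 < ... < a-1
   characterizes the Gale-minimal basis. *)
Definition greedy (a : 'I_n) (I : {set 'I_n}) : Prop :=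
  I \in N /\ forall x y, x \in I -> y \notin I -> (cyc_pos a y < cyc_pos a x)%N ->
             y |: I :\ x \notin N.

(** In matroid terms, the elements that are neither loops nor coloops. *)
Definition movable : {set 'I_n} :=
  [set x | [exists J in N, x \in J] && [exists J in N, x \notin J]].

Lemma movableP x J J' : J \in N -> J' \in N -> x \in J -> x \notin J' -> x \in movable.
Proof.
by move=> JN JN' xJ xJ'; rewrite inE; apply/andP; split; apply/exists_inP;
  [exists J|exists J'].
Qed.

Hypothesis cardN : forall J, J \in N -> #|J| = k.
Hypothesis exch : forall J R x, J \in N -> x |: R \in N -> x \notin R ->
  exists2 y, y \in J & y |: R \in N /\ x |: J :\ y \in N.

Lemma base_neq (J R : {set 'I_n}) y : J \in N -> #|R|.+1 = #|J| -> y |: R \in N -> y \notin R.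
Proof.
move=> JN cR yR; apply: contraTN isT => yiR.
have : y |: R = R by apply/setUidPr; rewrite sub1set.
by move=> e; have := cardN yR; rewrite e -(cardN JN) -cR => /n_Sn.
Qed.

Lemma cardD1S (J : {set 'I_n}) x : x \in J -> #|J :\ x|.+1 = #|J|.
Proof. by move=> xJ; rewrite (cardsD1 x J) xJ. Qed.

(** The second clause allows the trivial exchange [y = x], possible only when [x \in J']; otherwise
    [y] is new to [J]. *)
Lemma exchD (J J' : {set 'I_n}) x : J \in N -> J' \in N -> x \in J ->
  exists y, [/\ y \in J', (y \in J) -> y = x, y |: J :\ x \in N & x |: J' :\ y \in N].
Proof.
move=> JN J'N xJ.
have [||y yJ' [y1 y2]] := @exch J' (J :\ x) x J'N; rewrite ?setD1K ?inE ?eqxx //.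
exists y; split=> // yJ.
have := base_neq JN (cardD1S xJ) y1; rewrite !inE yJ andbT negbK.
by move/eqP.
Qed.

(** Look at the first element of the symmetric difference: exchanging it into the basis that lacks
    it removes a later element, so that basis was not greedy. *)
Lemma greedy_uniq a I I' : greedy a I -> greedy a I' -> I = I'.
Proof.
move=> [IN Ig] [IN' Ig'].
have sub J J' : J \in N -> J' \in N -> (forall x, x \in J -> x \in J') -> J = J'.
  move=> JN JN' s; apply/eqP; rewrite eqEcard (cardN JN) (cardN JN') leqnn andbT.
  exact/subsetP.
pose D := (I :\: I') :|: (I' :\: I).
case: (set_0Vmem D) => [D0|[x0 x0D]].
  apply: sub => // x xI; apply: contraPT D0 => xI' D0.
  by have := in_set0 x; rewrite -D0 !inE xI xI'.
have [x xD xmin] := @arg_minnP _ x0 (fun y => y \in D) (cyc_pos a) x0D.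
have aux J J' : greedy a J -> greedy a J' -> x \in J -> x \notin J' ->
    (forall y, y \in J' -> y \notin J -> (cyc_pos a x <= cyc_pos a y)%N) -> False.
  move=> [JN Jg] [JN' Jg'] xJ xJ' m.
  have [y [yJ' yx _ h]] := exchD JN JN' xJ.
  have yxn : y != x by apply: contraNneq xJ' => <-.
  have yJ : y \notin J by apply: contra yxn => /yx ->.
  have := m y yJ' yJ; rewrite leq_eqVlt => /orP[/eqP/cyc_pos_inj e|lt].
    by rewrite e eqxx in yxn.
  by move: (Jg' y x yJ' xJ' lt); rewrite h.
exfalso; move: xD; rewrite /D !inE => /orP[/andP[h1 h2]|/andP[h1 h2]].
  by apply: (aux I I') => // y y1 y2; apply: xmin; rewrite /D !inE y1 y2 orbT.
by apply: (aux I' I) => // y y1 y2; apply: xmin; rewrite /D !inE y1 y2.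
Qed.

(** A basis of least total position admits no improving exchange. *)
Lemma greedy_exists a : N != set0 -> exists I, greedy a I.
Proof.
case/set0Pn => J0 J0N.
have [I IN Imin] := @arg_minnP _ J0 (fun J => J \in N) (fun J => \sum_(x in J) cyc_pos a x)%N J0N.
exists I; split=> // x y xI yI lt; apply/negP => /Imin.
rewrite (big_setU1 y) ?inE ?negb_and ?yI ?orbT //= (big_setD1 x xI) /=.
by rewrite leq_add2r leqNgt lt.
Qed.

(** The only trace of total nonnegativity in this section; [tnn_noncrossing] supplies it. *)
Hypothesis noncross : forall (R0 : {set 'I_n}) i b p q,
  (#|R0|.+2)%N = k -> i \notin R0 -> b \notin R0 ->
  i |: (b |: R0) \notin N -> p |: (b |: R0) \in N ->
  p |: (i |: R0) \in N -> q |: (b |: R0) \in N ->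
  ((i < p)%N (+) (i < q)%N) = ((b < p)%N (+) (b < q)%N).

Lemma setU1C (x y : 'I_n) (S : {set 'I_n}) : x |: (y |: S) = y |: (x |: S).
Proof. exact: setUCA. Qed.

Lemma indepS (A B : {set 'I_n}) : B \subset A -> indep N A -> indep N B.
Proof.
move=> BA /exists_inP[J JN AJ]; apply/exists_inP; exists J => //.
exact: subset_trans AJ.
Qed.

(* Take for i the start of a shortest dependent cyclic interval of movable
   elements, and for j its successor. *)
Lemma bridge_exists : movable != set0 -> exists i j,
  [/\ i \in movable, j \in movable, i != j &
   [/\ forall x, x \in movable -> x != i -> (cyc_pos i j <= cyc_pos i x)%N,
      forall J, J \in N -> i \in J -> j \notin J -> j |: J :\ i \in N &
      forall I, greedy j I -> [/\ j \in I, i \notin I & i |: I :\ j \in N]]].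
Proof.
case/set0Pn => t0; move eT: movable => T t0T.
have mT x J J' : J \in N -> J' \in N -> x \in J -> x \notin J' -> x \in T.
  by rewrite -eT; exact: movableP.
pose A i l := [set x in T | (cyc_pos i x <= l)%N].
have TJ1 x : x \in T -> exists2 J, J \in N & x \in J.
  by rewrite -eT inE => /andP[/exists_inP].
have TJ0 x : x \in T -> exists2 J, J \in N & x \notin J.
  by rewrite -eT inE => /andP[_ /exists_inP].
(* The full circle is dependent: a basis holding every movable element would contain [t0], and
   exchanging [t0] against a basis without it would bring in a movable element outside. *)
have ex : exists l, [exists i in T, ~~ indep N (A i l)].
  exists n; apply/exists_inP; exists t0 => //; apply/negP => /exists_inP[J JN AJ].
  have [J0 J0N tJ0] := TJ0 _ t0T.
  have tJ : t0 \in J by apply: (subsetP AJ); rewrite inE t0T cyc_pos_xx.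
  have [y [yJ0 yt _ h]] := exchD JN J0N tJ.
  have yt0 : y != t0 by apply: contraNneq tJ0 => <-.
  have yJ : y \notin J by apply: contra yt0 => /yt ->.
  have : y \in A t0 n.
    by rewrite inE (mT _ _ _ J0N JN yJ0 yJ) /= ltnW // cyc_pos_lt.
  by move/(subsetP AJ); rewrite (negbTE yJ).
have [l /exists_inP[i iT dep] lmin] := ex_minnP ex.
have ind i' l' : i' \in T -> (l' < l)%N -> indep N (A i' l').
  move=> i'T; apply: contraTT => d; rewrite -leqNgt; apply: lmin.
  by apply/exists_inP; exists i'.
(* By minimality of [l] the interval ends at a movable element [b]; otherwise it could be
   shortened. *)
have [/exists_inP[b bT /eqP bl]|] := boolP [exists b in T, cyc_pos i b == l]; last first.
  move/exists_inPn => nb; exfalso; move/negP: dep; apply.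
  case: (posnP l) => [l0|l0].
    have [J JN iJ] := TJ1 _ iT; apply/exists_inP; exists J => //; apply/subsetP => x.
    rewrite inE l0 leqn0 => /andP[xT /eqP x0].
    by have := nb _ xT; rewrite x0 l0 eqxx.
  apply: indepS (ind i l.-1 iT _); last by rewrite prednK.
  apply/subsetP => x; rewrite !inE => /andP[xT xl]; rewrite xT /=.
  by have := nb _ xT; move: xl; clear; lia.
have bi : b != i.
  apply: contraTneq dep => bi; have [J JN iJ] := TJ1 _ iT; rewrite negbK.
  apply/exists_inP; exists J => //; apply/subsetP => x.
  rewrite inE -bl bi cyc_pos_xx leqn0 => /andP[_].
  by rewrite -(cyc_pos_xx i) => /eqP/cyc_pos_inj ->.
have [j /andP[jT ji] jmin] := @arg_minnP _ b (fun x => (x \in T) && (x != i)) (cyc_pos i)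
   (introT andP (conj bT bi)).
have jfirst x : x \in T -> x != i -> (cyc_pos i j <= cyc_pos i x)%N.
  by move=> xT xi; apply: jmin; rewrite xT.
have pos x : x != i -> (0 < cyc_pos i x)%N.
  by rewrite lt0n -(cyc_pos_xx i); apply: contraNneq => /cyc_pos_inj ->.
have [Ab eAb] : {Ab | Ab = A i l} by exists (A i l).
rewrite -eAb in dep.
have AbE x : (x \in Ab) = (x \in T) && (cyc_pos i x <= cyc_pos i b)%N by rewrite eAb inE bl.
have iA : i \in Ab by rewrite AbE iT cyc_pos_xx.
have bA : b \in Ab by rewrite AbE bT leqnn.
have jA : j \in Ab by rewrite AbE jT jfirst.
have indb : indep N (Ab :\ b).
  apply: indepS (ind i l.-1 iT _); last by rewrite prednK // -bl pos.
  apply/subsetP => x; rewrite in_setD1 AbE inE => /andP[xb /andP[xT xl]]; rewrite xT /=.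
  have : cyc_pos i x != l by apply: contra xb; rewrite -bl => /eqP/cyc_pos_inj ->.
  by move: xl; rewrite bl; clear; lia.
have indi : indep N (Ab :\ i).
  apply: indepS (ind j (l - cyc_pos i j)%N jT _); last first.
    by have := pos _ ji; have := jfirst _ bT bi; rewrite bl; clear; lia.
  apply/subsetP => x; rewrite in_setD1 AbE inE => /andP[xi /andP[xT xl]]; rewrite xT /=.
  by rewrite (cyc_pos_shift i) jfirst // -bl leq_sub2r.
have noA J : J \in N -> ~~ (Ab \subset J).
  by move=> JN; apply: contra dep => AJ; apply/exists_inP; exists J.
have [J1 J1N AJ1] := exists_inP indi.
have in1 x : x \in Ab -> x != i -> x \in J1.
   by move=> xA xi; apply: (subsetP AJ1); rewrite !inE xi.
have iJ1 : i \notin J1.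
  apply: contra (noA _ J1N) => iJ1; apply/subsetP => x xA.
  by case: (x =P i) => [->//|/eqP xi]; exact: in1.
have inA (J : {set 'I_n}) y : Ab :\ i \subset J -> i |: J :\ y \in N -> y \in Ab.
  move=> AJ h; apply: contraTT (noA _ h) => yA; rewrite negbK; apply/subsetP => x xA.
  rewrite !inE; case: (x =P i) => //= /eqP xi.
  rewrite (subsetP AJ) ?inE ?xi // andbT.
  by apply: contra yA => /eqP <-.
(* In a basis containing the interval minus [i], the element [c] can be traded for [i]: every
   exchange that brings in [i] must remove an element of the dependent set [Ab], and against [Jc]
   only [c] is available. *)
have circ c (J : {set 'I_n}) : c != i -> indep N (Ab :\ c) -> J \in N -> Ab :\ i \subset J ->
    i |: J :\ c \in N.
  move=> ci /exists_inP[Jc JcN AJc] JN AJ.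
  have iJc : i \in Jc by apply: (subsetP AJc); rewrite !inE eq_sym ci.
  have [y [yJ yi y1 y2]] := exchD JcN JN iJc.
  have yA := inA _ _ AJ y2.
  have yni : y != i.
    apply: contraNneq (noA _ JN) => e; apply/subsetP => x xA.
    by case: (x =P i) => [->|/eqP xi]; rewrite -?e // (subsetP AJ) // !inE xi.
  have yc : y = c.
    apply/eqP; apply: contraNT yni => yc; apply/eqP/yi.
    by apply: (subsetP AJc); rewrite !inE yc.
  by rewrite -yc.
have jJ1 : j \in J1 by exact: in1.
have bJ1 : b \in J1 by exact: in1.
(* If this failed, [i] could not replace [j] in [J1], while some [d] beyond [b] can; then [i], [j],
   [b], [d] would violate [noncross]. *)
have indj : indep N (Ab :\ j).
  apply: contraT => dj; exfalso.
  have jb : j != b by apply: contra dj => /eqP ->.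
  have [J2 J2N jJ2] := TJ0 _ jT.
  have [d [dJ2 dj' d1 _]] := exchD J1N J2N jJ1.
  have dnj : d != j by apply: contraNneq jJ2 => <-.
  have dJ1 : d \notin J1 by apply: contra dnj => /dj' ->.
  have dT : d \in T := mT _ _ _ J2N J1N dJ2 dJ1.
  have hij : i |: J1 :\ j \notin N.
    apply: contra dj => h; apply/exists_inP; exists (i |: J1 :\ j) => //.
    apply/subsetP => x; rewrite in_setD1 => /andP[xj xA]; rewrite !inE xj.
    by case: (x =P i) => //= /eqP xi; exact: in1.
  have di : d != i by apply: contraNneq hij => <-.
  have dA : (cyc_pos i b < cyc_pos i d)%N.
    rewrite ltnNge; apply: contra dJ1 => h; apply: in1 => //.
    by rewrite AbE dT.
  have bj : b \in J1 :\ j by rewrite !inE eq_sym jb.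
  have := @cyc_crossing _ i j b d (pos _ ji).
  rewrite ltn_neqAle jfirst // (inj_eq (@cyc_pos_inj _ i)) jb => /(_ isT dA).
  apply/negP; rewrite negbK; apply/eqP.
  apply: (@noncross ((J1 :\ j) :\ b)); rewrite ?(setD1K bj) ?(setD1K jJ1) //.
  - by rewrite (cardD1S bj) (cardD1S jJ1) cardN.
  - by rewrite !inE (negbTE iJ1) !andbF.
  - by rewrite !inE eqxx.
  - have -> : j |: (i |: (J1 :\ j) :\ b) = i |: J1 :\ b.
      rewrite setU1C; congr (_ |: _); apply/setP => x; rewrite !inE.
      by case: (x =P j) => [->|//]; rewrite jb jJ1.
    exact: circ.
exists i, j; split; rewrite // 1?eq_sym //; split=> //.
(* Otherwise [i] can be replaced in [J] by some [b1] of the interval other than [j], and [j] can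
   enter [J] for some [d] beyond [b]; again [i], [j], [b1], [d] alternate. *)
- move=> J JN iJ jJ; apply/negPn/negP => hJ.
  have [c [cJ1 ci c1 c2]] := exchD JN J1N iJ.
  have cA := inA _ _ AJ1 c2.
  have ci' : c != i by apply: contraNneq iJ1 => <-.
  have cP : [&& c \in Ab, c != i & c |: J :\ i \in N] by rewrite cA ci'.
  have [b1 /and3P[b1A b1i b1N] b1min] := @arg_minnP _ c
     (fun c => [&& c \in Ab, c != i & c |: J :\ i \in N]) (cyc_pos i) cP.
  have b1j : j != b1 by apply: contraNneq hJ => ->.
  have [d [dJ dj d1 d2]] := exchD J1N JN jJ1.
  have dnj : d != j by apply: contraNneq jJ => <-.
  have dJ1 : d \notin J1 by apply: contra dnj => /dj ->.
  have di : d != i by apply: contraNneq hJ => <-.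
  have dT : d \in T.
    by apply: (mT _ _ _ JN J1N).
  have dA : (cyc_pos i b < cyc_pos i d)%N.
    rewrite ltnNge; apply: contra dJ1 => h; apply: in1 => //.
    by rewrite AbE dT.
  have b1b : (cyc_pos i b1 <= cyc_pos i b)%N by move: b1A; rewrite AbE => /andP[].
  have := @cyc_crossing _ i j b1 d (pos _ ji).
  rewrite ltn_neqAle jfirst ?(inj_eq (@cyc_pos_inj _ i)) ?b1j //; last first.
    by move: b1A; rewrite AbE => /andP[].
  move=> /(_ isT (leq_ltn_trans b1b dA)).
  have dK : d \in J :\ i by rewrite !inE di.
  have := @noncross ((J :\ i) :\ d) j d i b1.
  rewrite (setD1K dK) (setD1K iJ) (cardD1S dK) (cardD1S iJ) => h.
  have {h} : (j < i)%N (+) (j < b1)%N = (d < i)%N (+) (d < b1)%N.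
    apply: h => //.
    + by rewrite cardN.
    + by rewrite !inE (negbTE jJ) !andbF.
    + by rewrite !inE eqxx.
    + have -> : i |: (j |: (J :\ i) :\ d) = j |: J :\ d.
        rewrite setU1C; congr (_ |: _); apply/setP => x; rewrite !inE.
        by case: (x =P i) => [->|//]; rewrite eq_sym di iJ.
      exact: d2.
  have flip (x y : 'I_n) : x != y -> (x < y)%N = ~~ (y < x)%N.
    by rewrite -leqNgt ltn_neqAle => ->.
  have db1 : d != b1 by apply: contraTneq dA => ->; rewrite -leqNgt.
  rewrite (flip j i ji) (flip j b1 b1j) (flip d i di) (flip d b1 db1).
  by do 4 case: (_ < _)%N.
(* Seen from [j], the element [i] is the last movable one, so a greedy basis avoids it; the rest of
   the interval comes first and is independent, so the basis contains it and [circ] applies with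
   [c = j]. *)
- move=> I gI; have [IN Ig] := gI.
  have iI : i \notin I.
    apply/negP => iI; have [J JN iJ] := TJ0 _ iT.
    have [y [yJ yi y1 y2]] := exchD IN JN iI.
    have yni : y != i by apply: contraNneq iJ => <-.
    have yI : y \notin I by apply: contra yni => /yi ->.
    have yT : y \in T := mT _ _ _ JN IN yJ yI.
    have : (cyc_pos j y < cyc_pos j i)%N.
      rewrite !(cyc_pos_shift i j) jfirst // cyc_pos_xx (leqNgt (cyc_pos i j)) pos //=.
      by have := cyc_pos_lt i y; have := pos _ ji; have := jfirst _ yT yni; clear; lia.
    by move/(Ig _ _ iI yI); rewrite y1.
  have AI : Ab :\ i \subset I.
    apply/subsetP => c; rewrite in_setD1 => /andP[ci cA]; apply/negPn/negP => cI.
    have [y [yI yc y1 y2]] := exchD J1N IN (in1 _ cA ci).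
    have ync : y != c by apply: contraNneq cI => <-.
    have yJ1 : y \notin J1 by apply: contra ync => /yc ->.
    have yT : y \in T := mT _ _ _ IN J1N yI yJ1.
    have yi : y != i by apply: contraNneq iI => <-.
    have yA : y \notin Ab by apply: contra yJ1 => yA; exact: in1.
    have cT : c \in T by move: cA; rewrite AbE => /andP[].
    have : (cyc_pos j c < cyc_pos j y)%N.
      rewrite !(cyc_pos_shift i j) !jfirst //.
      move: yA cA; rewrite !AbE yT cT /= => h1 h2.
      by have := jfirst _ yT yi; have := jfirst _ cT ci; move: h1 h2; clear; lia.
    by move/(Ig _ _ yI cI); rewrite y2.
  split=> //; first by apply: (subsetP AI); rewrite !inE ji.
  exact: circ.
Qed.

End Matroid.

(** * Separators and bridge moves *)

Lemma prodr_exprz_sum (K : fieldType) (I : finType) (P : pred I) (x : K) (e : I -> int) :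
  x != 0 -> \prod_(i | P i) x ^ e i = x ^ \sum_(i | P i) e i.
Proof.
move=> x0; elim/big_rec2: _ => [|i a b _ ->]; first by rewrite expr0z.
by rewrite expfzDr.
Qed.

Definition separates n (U : {set 'I_n}) (N : {set {set 'I_n}}) : Prop :=
  forall J1 J2, J1 \in N -> J2 \in N -> (J1 :&: U) :|: (J2 :\: U) \in N.

Lemma separatesC n (U : {set 'I_n}) N : separates (~: U) N -> separates U N.
Proof.
move=> sU J1 J2 N1 N2; have := sU _ _ N2 N1.
by rewrite setUC -setDE [_ :\: ~: U]setDE setCK.
Qed.

(** The bases gained by the bridge are those where [j] stands in for [i]. With both elements on one
    side of [U], this substitution commutes with mixing; passing to the complement puts them inside
    [U]. *)
Lemma separates_bridge n (U : {set 'I_n}) (N N' : {set {set 'I_n}}) i j :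
  i != j -> (forall J, (J \in N) =
    (J \in N') || [&& j \in J, i \notin J & i |: J :\ j \in N']) ->
  (i \in U) = (j \in U) -> separates U N' -> separates U N.
Proof.
move=> ij NE.
wlog jU : U / j \in U => [wl|].
  case: (boolP (j \in U)) => jU ijU sU; first by apply: wl; rewrite ?jU.
  apply: separatesC; apply: wl; rewrite ?inE ?jU ?ijU ?(negbTE jU) //.
  by apply: separatesC; rewrite setCK.
rewrite jU => iU sU J1 J2; rewrite (NE J1) (NE J2).
have drop J : (i |: J :\ j) :\: U = J :\: U.
  apply/setP => x; rewrite !inE; case: (x =P i) => [->|_]; first by rewrite iU.
  by case: (x =P j) => [->|_] //=; rewrite jU.
have aux J : J1 \in N' -> J \in N' -> J :\: U = J2 :\: U ->
    J1 :&: U :|: J2 :\: U \in N.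
  by move=> h1 h <-; rewrite NE sU.
have aux2 J : [&& j \in J1, i \notin J1 & i |: J1 :\ j \in N'] -> J \in N' -> J :\: U = J2 :\: U ->
    J1 :&: U :|: J2 :\: U \in N.
  move=> /and3P[jJ iJ h1] h <-; rewrite NE; apply/orP; right; apply/and3P; split.
  - by rewrite !inE jJ jU.
  - by rewrite !inE (negbTE iJ) iU.
  suff -> : i |: (J1 :&: U :|: J :\: U) :\ j = (i |: J1 :\ j) :&: U :|: J :\: U by exact: sU.
  apply/setP => x; rewrite !inE; case: (x =P i) => [->|_]; first by rewrite iU.
  by case: (x =P j) => [->|_] //=; rewrite jU.
by case/orP => [h1|h1]; case/orP => [h2|/and3P[_ _ h2]];
  [apply: (aux J2)|apply: (aux _ h1 h2)|apply: (aux2 J2)|apply: (aux2 _ h1 h2)].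
Qed.

Section Bridge.
Variables (K : realFieldType) (n k : nat).
Implicit Types (X Y : 'M[K]_(k, n)).

Definition add_col (i j : 'I_n) (c : K) X : 'M[K]_(k, n) :=
  \matrix_(a, b) (X a b + (if b == j then c * X a i else 0)).

Lemma bases_card X J : J \in bases X -> #|J| = k.
Proof. by rewrite inE; exact: minor_neq0_card. Qed.

Lemma bases_exchange X (J R : {set 'I_n}) x : J \in bases X -> x |: R \in bases X -> x \notin R ->
  exists2 y, y \in J & y |: R \in bases X /\ x |: J :\ y \in bases X.
Proof.
rewrite !inE => h1 h2 h3; have [y yJ [y1 y2]] := minor_exchange h1 h2 h3.
by exists y => //; rewrite !inE.
Qed.

Lemma rank_in_between (R : {set 'I_n}) (i j : 'I_n) : (i < j)%N -> i \notin R ->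
  rank_in R j = (rank_in R i + #|R :&: [set x : 'I_n | (i < x < j)%N]|)%N.
Proof.
move=> ij iR; rewrite /rank_in.
have -> : [set r in R | (r < j)%N] =
   [set r in R | (r < i)%N] :|: (R :&: [set x : 'I_n | (i < x < j)%N]).
  apply/setP => x; rewrite !inE -andb_orr.
  case: (boolP (x \in R)) => //= xR.
  have xi : (x : nat) != i by apply: contraNneq iR => /val_inj <-.
  by move: xi ij; clear; lia.
rewrite cardsU -[RHS]subn0; congr (_ - _)%N; apply/eqP; rewrite cards_eq0.
by apply/eqP/setP => x; rewrite !inE; case: (x \in R) => //=; clear; lia.
Qed.

(* Elements strictly between i and j are not movable, so they lie in all bases or
   in none. *)
Lemma bridge_sign (N : {set {set 'I_n}}) i j (J J' : {set 'I_n}) :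
  (forall J, J \in N -> #|J| = k) -> i != j ->
  (forall x, x \in movable N -> x != i -> (cyc_pos i j <= cyc_pos i x)%N) ->
  J \in N -> J' \in N -> j \in J -> j \in J' -> i \notin J -> i \notin J' ->
  odd (rank_in (J :\ j) i + rank_in (J :\ j) j)
  = odd (rank_in (J' :\ j) i + rank_in (J' :\ j) j).
Proof.
move=> cN ij nxt JN JN' jJ jJ' iJ iJ'.
pose arc := [set x | (0 < cyc_pos i x < cyc_pos i j)%N].
have sub J1 J2 : J1 \in N -> J2 \in N -> J1 :&: arc \subset J2 :&: arc.
  move=> h1 h2; apply/subsetP => x; rewrite !inE => /and3P[x1 x2 x3].
  rewrite x2 x3 !andbT; apply: contraLR x3 => xJ2; rewrite -leqNgt nxt //.
    exact: (movableP h1 h2).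
  by apply: contraTneq x2 => ->; rewrite cyc_pos_xx.
have earc : J :&: arc = J' :&: arc by apply/eqP; rewrite eqEsubset !sub.
have iR (J0 : {set 'I_n}) : i \notin J0 -> i \notin J0 :\ j by rewrite !inE negb_and orbC => ->.
have jR (J0 : {set 'I_n}) : j \notin J0 :\ j by rewrite !inE eqxx.
have jarc : j \notin arc by rewrite inE ltnn andbF.
have eD (J0 : {set 'I_n}) : (J0 :\ j) :&: arc = J0 :&: arc.
  apply/setP => x; rewrite !in_setI in_setD1.
  by case: (x =P j) => [->|//]; rewrite (negbTE jarc) !andbF.
have ij' : (i : nat) != j by [].
case: (ltngtP i j) ij' => // ltij _.
  have E (J0 : {set 'I_n}) : (J0 :\ j) :&: [set x : 'I_n | (i < x < j)%N] = J0 :&: arc.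
    rewrite -eD; congr (_ :&: _); apply/setP => x; rewrite !inE !cyc_posE.
    have := ltn_ord x; have := ltn_ord i; have := ltn_ord j; move: ltij; clear.
    by do ?case: ifP; lia.
  rewrite !(rank_in_between ltij) ?iR // !E earc.
  by rewrite !addnA !addnn !oddD !odd_double.
(* Here the places between [j] and [i] are complementary to the arc, so the count is that of
   [J0 :\ j] minus the constant one on the arc. *)
have E (J0 : {set 'I_n}) : i \notin J0 ->
    (J0 :\ j) :&: [set x : 'I_n | (j < x < i)%N] = (J0 :\ j) :\: (J0 :&: arc).
  move=> iJ0; apply/setP => x; rewrite !in_setI !in_setD !in_setI.
  case: (x =P i) => [->|/eqP xi]; first by rewrite (negbTE iJ0) ?andbF /= ?andbF.
  rewrite !in_set1; case: (x =P j) => //= /eqP xj; case: (x \in J0) ; rewrite ?andbF ?andbT //=.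
  rewrite !inE !cyc_posE.
  have xi' : (x : nat) != i by []. have xj' : (x : nat) != j by [].
  have := ltn_ord x; have := ltn_ord i; have := ltn_ord j; move: ltij xi' xj'; clear.
  by do ?case: ifP; lia.
rewrite !(rank_in_between ltij) // !E // (cardsD _ (J :&: arc)) (cardsD _ (J' :&: arc)).
have cD (J0 : {set 'I_n}) : J0 \in N -> j \in J0 -> #|J0 :\ j| = k.-1.
  by move=> h1 h2; rewrite -(cN _ h1) (cardsD1 j J0) h2.
have I0 (J0 : {set 'I_n}) : (J0 :\ j) :&: (J0 :&: arc) = J0 :&: arc.
  rewrite -eD; apply/setP => x; rewrite !inE.
  by case: (x \in J0); rewrite ?andbF //= ?andbT; case: (x == j).
rewrite !I0 !cD // earc; set z := (_ - _)%N.
by rewrite addnAC addnn oddD odd_double addnAC addnn oddD odd_double.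
Qed.

End Bridge.

(** * Monomial relations among necklace minors *)

Section NecklaceIndependence.
Variables (K : realFieldType) (n k : nat).
Implicit Types (X Y : 'M[K]_(k, n)) (J : {set 'I_n}) (I : 'I_n -> {set 'I_n}) (e : 'I_n -> int).

Definition partial_sum e (x : 'I_n) : int := \sum_(a : 'I_n | (a <= x)%N) e a.

(** For [i < j] the arc is the interval after [i] up to [j]; otherwise the interval from [j] to [i]
    is its complement, and the total sum is 0. *)
Lemma partial_sum_arc e i j : \sum_a e a = 0 -> i != j ->
  \sum_(a | (0 < cyc_pos i a <= cyc_pos i j)%N) e a = 0 ->
  partial_sum e i = partial_sum e j.
Proof.
move=> s0 ij arc0.
have split_sum (x y : 'I_n) : (x < y)%N ->
    partial_sum e y = partial_sum e x + \sum_(a : 'I_n | (x < a <= y)%N) e a.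
  move=> xy; rewrite /partial_sum (bigID (fun a : 'I_n => (a <= x)%N)) /=.
  by congr (_ + _); apply: eq_bigl => a; move: xy; clear; lia.
have ij' : (i : nat) != j by [].
case: (ltngtP i j) ij' => // lt _.
  rewrite (split_sum _ _ lt) -[LHS]addr0 -[X in _ + X = _]arc0; congr (_ + _).
  apply: eq_bigl => a; rewrite !cyc_posE.
  have := ltn_ord a; have := ltn_ord i; have := ltn_ord j; move: lt; clear.
  by do ?case: ifP; lia.
rewrite (split_sum _ _ lt) -[RHS]addr0; congr (_ + _).
rewrite -[RHS]s0 [RHS](bigID (fun a => 0 < cyc_pos i a <= cyc_pos i j)%N) /= arc0 add0r.
apply: eq_bigl => a; rewrite !cyc_posE.
have := ltn_ord a; have := ltn_ord i; have := ltn_ord j; move: lt; clear.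
by do ?case: ifP; lia.
Qed.

Lemma exprz_inj_exponent (a b : K) (m : int) : 0 < a -> a < b -> a ^ m = b ^ m -> m = 0.
Proof.
move=> a0 ab e.
have b0 : 0 < b := lt_trans a0 ab.
have : (b / a) ^ m = 1.
  by rewrite expfzMl exprz_inv -invr_expz e divff // expfz_neq0 // gt_eqF.
move/eqP; rewrite pexprz_eq1 ?divr_ge0 ?ltW // => /orP[/eqP//|/eqP h].
have a1 : a != 0 by rewrite gt_eqF.
by move: ab; rewrite -(divfK a1 b) h mul1r ltxx.
Qed.

(** The relation is assumed at all matrices with the given bases, and [I] is any family of greedy
    bases, so that the induction can change both. *)
Theorem necklace_relation_separates X I e c0 : tnn X -> bases X != set0 ->
  (forall a, greedy (bases X) a (I a)) -> \sum_a e a = 0 ->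
  (forall Y, tnn Y -> bases Y = bases X -> \prod_a minor Y (I a) ^ e a = 1) ->
  separates [set x | partial_sum e x == partial_sum e c0] (bases X).
Proof.
have [m] := ubnP #|bases X|; elim: m => // m IH in X I * => leN tX nz gI s0 rel.
have cN J : J \in bases X -> #|J| = k := @bases_card _ _ _ X J.
have exN := @bases_exchange _ _ _ X.
case: (eqVneq (movable (bases X)) set0) => [T0|T0].
  move=> J1 J2 N1 N2; have -> : J2 = J1.
    apply/eqP; rewrite eqEcard !cN // leqnn andbT; apply/subsetP => x x2.
    apply: contraT => x1; have := movableP N2 N1 x2 x1.
    by rewrite T0 inE.
  by rewrite setID.
have [i [j [iT jT ij [nxt freer gj]]]] :=
  bridge_exists cN exN (fun R0 i b p q => @tnn_noncrossing _ _ _ X R0 i b p q tX) T0.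
pose sw (J : {set 'I_n}) := i |: J :\ j.
have [jI iI swI] := gj _ (gI j).
(* By [bridge_sign] this sign is the same for every basis affected by the move, so scaling by it
   makes all corrections to the minors positive for [c > 0]. *)
pose eps : K := (-1) ^+ (rank_in (I j :\ j) i + rank_in (I j :\ j) j).
have jsw J : (j \in sw J) = false by rewrite !inE eqxx eq_sym (negbTE ij).
have swN J : j \in J -> i \notin J -> sw J \in bases X -> J \in bases X.
  move=> jJ iJ h; have jS : j \notin sw J by rewrite !inE eqxx eq_sym (negbTE ij).
  suff <- : j |: sw J :\ i = J by by apply: freer (setU11 _ _) _; rewrite ?jsw.
  apply/setP => x; rewrite !inE.
  by case: (x =P j) => [->|_] //=; case: (x =P i) => [->|_] //=; rewrite (negbTE iJ).
have IjN := (gI j).1.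
have addE Y c J : {subset bases Y <= bases X} ->
    minor (add_col i j (c * eps) Y) J =
    minor Y J + (if (j \in J) && (i \notin J) then c * minor Y (sw J) else 0).
  move=> sub; rewrite (minor_add_col (c := c * eps) (X := Y) ij); last by move=> a b; rewrite mxE.
  congr (_ + _); case: ifP => // /andP[jJ iJ].
  rewrite -/(sw J); case: (boolP (sw J \in bases X)) => [h|h]; last first.
    have -> : minor Y (sw J) = 0 by apply/eqP; apply: contraNT h => h; apply: sub; rewrite inE.
    by rewrite !mulr0.
  have JN := swN _ jJ iJ h.
  rewrite -[in X in _ * X * _]signr_odd (bridge_sign cN ij nxt JN IjN jJ jI iJ iI).
  by rewrite signr_odd -[c * eps * _]mulrA -expr2 sqrr_sign mulr1.
pose Z (J : {set 'I_n}) := [&& j \in J, i \notin J & sw J \in bases X].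
have ZI : Z (I j) by rewrite /Z jI iI.
(* The least ratio is the largest multiple that can be subtracted; at a minimizer [Jm] the minor
   becomes 0, so at least one basis is lost. *)
pose q J := minor X J / minor X (sw J).
have [Jm Zm qm] := arg_minP q ZI.
set t := q Jm in qm.
have gt0 Y J : tnn Y -> J \in bases Y -> 0 < minor Y J.
  by move=> tY; rewrite inE lt_neqAle eq_sym tY andbT.
have ZN J : Z J -> J \in bases X by case/and3P=> *; exact: swN.
have t0 : 0 < t.
  case/and3P: (Zm) => _ _ h; apply: divr_gt0; apply: gt0 => //; exact: ZN.
pose X' := add_col i j (- t * eps) X.
have X'E J : minor X' J =
    minor X J - (if (j \in J) && (i \notin J) then t * minor X (sw J) else 0).
  by rewrite addE //; case: ifP => _; rewrite ?mulNr ?subr0 ?addr0.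
have tX' : tnn X'.
  move=> J; rewrite X'E; case: ifP => [/andP[jJ iJ]|_]; last by rewrite subr0.
  case: (boolP (sw J \in bases X)) => [h|]; last first.
    by rewrite inE negbK => /eqP ->; rewrite mulr0 subr0.
  rewrite subr_ge0 -ler_pdivlMr ?gt0 //; apply: qm.
  by rewrite /Z jJ iJ.
have NE0 J : minor X J = minor X' J +
    (if (j \in J) && (i \notin J) then t * minor X' (sw J) else 0).
  rewrite !X'E; case: ifP => [/andP[jJ iJ]|_]; last by rewrite subr0 addr0.
  by rewrite jsw /= subr0 subrK.
have swE Y s J : tnn Y -> 0 < s ->
   (minor Y J + (if (j \in J) && (i \notin J) then s * minor Y (sw J) else 0) != 0) =
   (J \in bases Y) || [&& j \in J, i \notin J & sw J \in bases Y].
  move=> tY s0'; rewrite !inE.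
  case: ifP => [/andP[-> ->]|]; last by rewrite addr0 => /negbT/nandP[]/negbTE ->; rewrite ?andbF orbF.
  rewrite paddr_eq0 ?mulr_ge0 ?(ltW s0') // negb_and mulf_eq0 negb_or.
  by rewrite (gt_eqF s0').
have NE J : (J \in bases X) =
    (J \in bases X') || [&& j \in J, i \notin J & sw J \in bases X'].
  by rewrite inE NE0 swE.
have sub : {subset bases X' <= bases X} by move=> J JN'; rewrite NE JN'.
have JmN' : Jm \notin bases X'.
  case/and3P: (Zm) => jJ iJ h; rewrite inE negbK X'E jJ iJ /= /t /q divfK ?subrr //.
  by move: h; rewrite inE.
have ltN : (#|bases X'| < #|bases X|)%N.
  apply: proper_card; apply/properP; split; first exact/subsetP.
  by exists Jm => //; exact: ZN.
have nz' : bases X' != set0.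
  case/set0Pn: nz => J; rewrite NE => /orP[h|/and3P[_ _ h]]; apply/set0Pn; first by exists J.
  by exists (sw J).
have [I' gI'] := greedy_exists j nz'.
pose arc a := (0 < cyc_pos i a <= cyc_pos i j)%N.
have arcj : arc j.
  rewrite /arc leqnn andbT lt0n -(cyc_pos_xx i); apply: contra ij.
  by move/eqP/cyc_pos_inj => ->.
have mov' x : x \in movable (bases X') -> x \in movable (bases X).
  rewrite !inE => /andP[/exists_inP[J1 h1 x1] /exists_inP[J2 h2 x2]].
  by apply/andP; split; apply/exists_inP; [exists J1|exists J2]; rewrite ?sub.
(* No movable element lies strictly between [i] and [j], so the orders starting at points of the arc
   agree on movable elements and share their greedy basis. *)
have arc_order a x y : arc a -> x \in movable (bases X) -> y \in movable (bases X) ->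
    (cyc_pos a y < cyc_pos a x)%N -> (cyc_pos j y < cyc_pos j x)%N.
  have pos z : z \in movable (bases X) -> (z == i) || (cyc_pos i j <= cyc_pos i z)%N.
    by move=> zT; case: eqP => //= /eqP zi; exact: nxt.
  move=> /andP[a1 a2] /pos xT /pos yT; rewrite !(cyc_pos_shift i a) !(cyc_pos_shift i j).
  have := cyc_pos_lt i x; have := cyc_pos_lt i y; have := cyc_pos_lt i j.
  case/orP: xT => [/eqP->|xT]; case/orP: yT => [/eqP->|yT]; rewrite ?cyc_pos_xx;
    move: a1 a2; try move: xT; try move: yT; clear; by do ?case: ifP; lia.
have arc_greedy (N0 : {set {set 'I_n}}) a J : (forall x, x \in movable N0 -> x \in movable (bases X)) ->
    arc a -> greedy N0 j J -> greedy N0 a J.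
  move=> mv ha [JN gJ]; split=> // x y xJ yJ lt; apply/negP => h.
  have yx : y != x by apply: contraNneq yJ => ->.
  have xT : x \in movable N0.
    by apply: (movableP JN h); rewrite // !inE eqxx eq_sym (negbTE yx).
  have yT : y \in movable N0 by apply: (movableP h JN); rewrite // !inE eqxx.
  have := gJ _ _ xJ yJ (arc_order _ _ _ ha (mv _ xT) (mv _ yT) lt).
  by rewrite h.
have Iarc a : arc a -> I a = I j.
  move=> ha; apply: (greedy_uniq cN exN (gI a)).
  exact: arc_greedy.
have narc a : ~~ arc a -> (cyc_pos a i < cyc_pos a j)%N.
  move=> ha; rewrite !(cyc_pos_shift i a) cyc_pos_xx; move: ha arcj; rewrite /arc.
  have := cyc_pos_lt i j; have := cyc_pos_lt i a; clear.
  by do ?case: ifP; lia.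
(* From a starting point off the arc, [i] precedes [j], so greediness forbids the swap and this
   coordinate does not feel the bridge. *)
have Inarc a : ~~ arc a -> (j \in I a) && (i \notin I a) -> sw (I a) \notin bases X.
  by move=> ha /andP[h1 h2]; apply: ((gI a).2 _ _ h1 h2); exact: narc.
have gI2 a : greedy (bases X') a (if arc a then I' else I a).
  case: ifP => ha; first exact: arc_greedy.
  have [IN gIa] := gI a; split=> [|x y xI yI lt]; last by apply: contra (gIa _ _ xI yI lt); exact: sub.
  have := Inarc a (negbT ha); have := IN; rewrite inE [in X in _ -> _ -> X]inE X'E.
  case: ifP => _; last by rewrite subr0.
  by move=> h /(_ isT); rewrite inE negbK => /eqP ->; rewrite mulr0 subr0.
(* Adding the bridge back with any [s > 0] gives a matrix with the bases of [X]; in the relation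
   there, only the arc factor depends on [s]. *)
have relY Y s : tnn Y -> bases Y = bases X' -> 0 < s ->
    \prod_(a | ~~ arc a) minor Y (I a) ^ e a *
    (minor Y (I j) + s * minor Y (sw (I j))) ^ (\sum_(a | arc a) e a) = 1.
  move=> tY bY s0'.
  have subY : {subset bases Y <= bases X} by rewrite bY.
  have YsE J := addE _ s J subY.
  rewrite -[RHS](rel (add_col i j (s * eps) Y)).
  - rewrite [RHS](bigID arc) /= mulrC; congr (_ * _).
      rewrite -prodr_exprz_sum; last first.
        have := swE Y s (I j) tY s0'; rewrite jI iI /= => ->.
        by rewrite bY; have := NE (I j); rewrite IjN jI iI => /esym.
      by apply: eq_bigr => a ha; rewrite (Iarc _ ha) YsE jI iI.
    apply: eq_bigr => a ha; rewrite YsE; case: ifP => h; last by rewrite addr0.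
    have := Inarc a ha h => nsw.
    have -> : minor Y (sw (I a)) = 0 by apply/eqP; apply: contraNT nsw => h'; apply: subY; rewrite inE.
    by rewrite mulr0 addr0.
  - move=> J; rewrite YsE; case: ifP => _; last by rewrite addr0 tY.
    by rewrite addr_ge0 ?tY // mulr_ge0 ?tY // ltW.
  - by apply/setP => J; rewrite inE YsE swE // bY -NE.
(* Two values of [s] give distinct positive bases with equal powers. The arc factor then disappears,
   so the relation descends to [X']. *)
have sarc : \sum_(a | arc a) e a = 0.
  have b0 : 0 < minor X' (sw (I j)).
    apply: gt0 => //; rewrite inE X'E.
    by rewrite jsw /= subr0; move: swI; rewrite inE.
  have a0 : 0 <= minor X' (I j) by exact: tX'.
  have h1 := relY X' 1 tX' erefl ltr01.
  have h2 := relY X' 2 tX' erefl (ltr0Sn _ 1).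
  apply: (@exprz_inj_exponent (minor X' (I j) + 1 * minor X' (sw (I j)))
     (minor X' (I j) + 2 * minor X' (sw (I j)))).
  - by rewrite mul1r ltr_wpDl.
  - by rewrite ltrD2l ltr_pM2r // ltr1n.
  apply: (mulfI _ (etrans h1 (esym h2))).
  by apply: contra_eq_neq h1 => ->; rewrite mul0r eq_sym oner_neq0.
have eij := partial_sum_arc s0 ij sarc.
apply: (separates_bridge ij NE); first by rewrite !inE eij.
apply: (IH X' (fun a => if arc a then I' else I a)) => //.
  by rewrite -ltnS (leq_trans _ leN).
move=> Y tY bY; rewrite (bigID arc) /=.
rewrite (eq_bigr (fun a => minor Y I' ^ e a)); last by move=> a ->.
rewrite prodr_exprz_sum; last by have := gI'.1; rewrite -bY inE.
rewrite sarc expr0z mul1r.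
have := relY Y 1 tY bY ltr01; rewrite sarc expr0z mulr1 => h.
by rewrite -[RHS]h; apply: eq_bigr => a /negbTE ->.
Qed.

End NecklaceIndependence.

(** * Restrictions of positroids *)

Lemma minor_map n (A B : comNzRingType) (f : {rmorphism A -> B}) k (X : 'M[A]_(k, n)) J :
  minor (map_mx f X) J = f (minor X J).
Proof.
rewrite /minor; case: ifP => _; last by rewrite rmorph0.
rewrite -det_map_mx; congr (\det _); apply/matrixP => i l; rewrite !mxE.
by case: onth => [x|]; rewrite ?mxE ?rmorph0.
Qed.

Lemma minor_mulmx n (A : comNzRingType) k (G : 'M[A]_k) (X : 'M[A]_(k, n)) J :
  minor (G *m X) J = \det G * minor X J.
Proof.
rewrite /minor; case: ifP => _; last by rewrite mulr0.
rewrite -det_mulmx; congr (\det _); apply/matrixP => i l; rewrite !mxE.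
case E: onth => [x|]; first by rewrite !mxE; apply: eq_bigr => a _; rewrite !mxE E.
by rewrite big1 // => a _; rewrite !mxE E mulr0.
Qed.

Lemma minor_scale_col n (A : comNzRingType) k (s : 'I_n -> A) (X : 'M[A]_(k, n)) J :
  minor (\matrix_(i, x) (s x * X i x)) J = (\prod_(x in J) s x) * minor X J.
Proof.
rewrite /minor; case: (#|J| =P k) => [cJ|_]; last by rewrite mulr0.
pose d : 'rV[A]_k := \row_l (if onth (enum J) l is Some x then s x else 0).
have -> : \prod_(x in J) s x = \det (diag_mx d).
  rewrite det_diag -big_enum /=.
  case: (set_0Vmem J) => [J0|[x0 _]].
    rewrite J0 enum_set0 big_nil big1 // => l _.
    by have := ltn_ord l; rewrite -[X in (_ < X)%N]cJ J0 cards0.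
  rewrite (big_nth x0) -cardE cJ big_mkord; apply: eq_bigr => l _; rewrite [RHS]mxE.
  have : onth (enum J) l by rewrite onthTE -cardE cJ.
  by case E: onth => [y|//] _; rewrite (@onth_nth _ x0 _ _ _ E).
rewrite mulrC -det_mulmx; congr (\det _); apply/matrixP => i l; rewrite mul_mx_diag !mxE.
by case E: onth => [x|]; rewrite ?mxE ?mul0r // mulrC.
Qed.

Lemma disjointsU1 (T : finType) (x : T) (A B : {set T}) :
  [disjoint x |: A & B] = (x \notin B) && [disjoint A & B].
Proof.
by rewrite !disjoints_subset subUset sub1set inE.
Qed.

Section Restriction.
Variables (K : realFieldType) (n : nat).

(* Flipping the sign of a row turns constant-sign minors into nonnegative ones. *)
Lemma tnn_normalize k (X : 'M[K]_(k, n)) (f : {set 'I_n} -> K) c :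
  (forall J, 0 <= f J) -> (forall J, minor X J = c * f J) ->
  exists2 Y : 'M[K]_(k, n), tnn Y & bases Y = bases X.
Proof.
move=> f0 fX; case: (lerP 0 c) => c0.
  by exists X => // J; rewrite fX mulr_ge0.
case: k X fX => [|k] X fX.
  exists X => // J; rewrite /minor; case: eqP => // _; by rewrite det_mx00.
pose G : 'M[K]_k.+1 := diag_mx (\row_i (if i == 0 then -1 else 1)).
have dG : \det G = -1.
  by rewrite det_diag big_ord_recl !mxE /= big1 ?mulr1 // => i _; rewrite mxE.
exists (G *m X) => [J|]; first by rewrite minor_mulmx dG fX mulN1r -mulNr mulr_ge0 // oppr_ge0 ltW.
by apply/setP => J; rewrite !inE minor_mulmx dG mulN1r oppr_eq0.
Qed.

(** Normalizing by [J0] turns column [b] into a unit vector, and deleting its row contracts [b]. The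
    signs on the columns before [b] undo the position of [b], and the zero column makes [b] a
    loop. *)
Lemma tnn_contract k (X : 'M[K]_(k.+1, n)) b J0 : tnn X -> J0 \in bases X -> b \in J0 ->
  exists2 Y : 'M[K]_(k, n), tnn Y &
    forall J, (J \in bases Y) = (b \notin J) && (b |: J \in bases X).
Proof.
move=> tX J0N bJ0; have cJ := bases_card J0N.
move: J0N; rewrite inE {1}/minor cJ eqxx; set M := \matrix_(_, _) _ => nzM.
have uM : M \in unitmx by rewrite unitmxE unitfE.
have [l0 el] : exists l, onth (enum J0) l = Some b by apply/onthP; rewrite mem_enum.
have lk : (l0 < k.+1)%N by rewrite -cJ cardE -onthTE el.
pose l := Ordinal lk.
pose W := invmx M *m X.
have colb i : W i b = (i == l)%:R.
  have := congr1 (fun U : 'M_k.+1 => U i l) (mulVmx uM); rewrite !mxE => <-.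
  by apply: eq_bigr => a _; rewrite !mxE el.
pose s (x : 'I_n) : K := if x == b then 0 else if (x < b)%N then -1 else 1.
pose Y0 : 'M[K]_(k, n) := \matrix_(i, x) (s x * (row' l W) i x).
have E J : minor Y0 J = (-1) ^+ l * \det (invmx M) * (if b \in J then 0 else minor X (b |: J)).
  rewrite minor_scale_col; case: ifP => [bJ|/negbT bJ].
    by rewrite mulr0 (bigD1 b) //= /s eqxx !mul0r.
  case: (#|J| =P k) => [cJ'|cJ']; last first.
    rewrite /minor cardsU1 bJ; move/eqP: cJ' => /negbTE cJ'.
    by rewrite cJ' add1n eqSS cJ' !mulr0.
  rewrite -mulrA -minor_mulmx -/W minor_setU1 ?cJ' //.
  have -> : \prod_(x in J) s x = (-1) ^+ rank_in J b.
    rewrite (eq_bigr (fun x : 'I_n => if (x < b)%N then -1 else 1 : K)); last first.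
      by move=> x xJ; rewrite /s; case: eqP => // xb; rewrite -xb xJ in bJ.
    rewrite -big_mkcondr /= prodr_const; congr (_ ^+ _).
    by apply: eq_card => x; rewrite !inE.
  rewrite mulrCA; congr (_ * _).
  rewrite mxE (bigD1 l) //= big1 ?addr0 => [|i il]; last by rewrite colb (negbTE il) mulr0.
  rewrite colb eqxx mulr1 mxE signrMK /minor cJ' eqxx; congr (\det _).
  by apply/matrixP => i x; rewrite !mxE; case: onth => // y; rewrite mxE.
have f0 (J : {set 'I_n}) : 0 <= (if b \in J then 0 else minor X (b |: J)) by case: ifP.
have [Y tY bY] := tnn_normalize f0 E.
exists Y => // J; rewrite bY !inE E.
have c0 : (-1) ^+ l * \det (invmx M) != 0 :> K.
  by rewrite mulf_neq0 ?signr_eq0 // det_inv invr_eq0.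
by rewrite mulf_eq0 (negbTE c0) /=; case: ifP => //=; rewrite eqxx.
Qed.

Lemma tnn_contract_set m (B : {set 'I_n}) k (X : 'M[K]_(m + k, n)) J0 :
  #|B| = m -> tnn X -> J0 \in bases X -> B \subset J0 ->
  exists2 Y : 'M[K]_(k, n), tnn Y &
    forall J, (J \in bases Y) = [disjoint J & B] && (J :|: B \in bases X).
Proof.
elim: m => [|m IH] in B X J0 * => cB tX J0N BJ0.
  have -> : B = set0 by apply/eqP; rewrite -cards_eq0 cB.
  by exists X => // J; rewrite setU0 disjoint_sym disjoints_subset sub0set.
have [b bB] : exists b, b \in B by apply/set0Pn; rewrite -cards_eq0 cB.
have [Y1 tY1 Y1E] := tnn_contract (k := m + k) tX J0N (subsetP BJ0 _ bB).
have cB1 : #|B :\ b| = m by move: cB; rewrite (cardsD1 b B) bB => -[].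
have J1N : J0 :\ b \in bases Y1.
  by rewrite Y1E !inE eqxx /= setD1K ?(subsetP BJ0) //; move: J0N; rewrite inE.
have [Y tY YE] := IH (B :\ b) Y1 _ cB1 tY1 J1N (setSD _ BJ0).
exists Y => // J; rewrite YE Y1E.
have -> : b |: (J :|: B :\ b) = J :|: B by rewrite setUCA setD1K.
rewrite andbA; congr (_ && _).
rewrite -[in RHS](setD1K bB) !(disjoint_sym J) disjointsU1 andbC.
by rewrite !inE eqxx orbF.
Qed.

Lemma tnn_restrict k (X : 'M[K]_(k, n)) (S : {set 'I_n}) : tnn X ->
  exists2 Y : 'M[K]_(k, n), tnn Y &
    forall J, (J \in bases Y) = (J \subset S) && (J \in bases X).
Proof.
move=> tX; pose s x : K := (x \in S)%:R.
have E J : minor (\matrix_(i, x) (s x * X i x)) J = (J \subset S)%:R * minor X J.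
  rewrite minor_scale_col; congr (_ * _); case: subsetP => [JS|nJS].
    by rewrite big1 // => x /JS xS; rewrite /s xS.
  apply/eqP; apply: contra_notT nJS => /prodf_neq0 h x /h.
  by rewrite /s; case: (x \in S) => //; rewrite eqxx.
exists (\matrix_(i, x) (s x * X i x)) => [J|J]; first by rewrite E mulr_ge0.
by rewrite !inE E mulf_eq0; case: (J \subset S); rewrite ?oner_eq0 ?eqxx.
Qed.

End Restriction.

(** In a direct sum, the bases of a block are the sets that complete the rest of one fixed basis
    [J0]. So restriction becomes contraction of [J0 :\: P j] followed by deletion, both of which
    preserve total nonnegativity. *)
Lemma restriction_block n (M : {set {set 'I_n}}) (P : component_partition M) j J0 J :
  J0 \in M -> (J \in restriction M (P j)) = (J \subset P j) && (J :|: J0 :\: P j \in M).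
Proof.
move=> J0M; have blocksE J' : (J' \in M) = [forall i, J' :&: P i \in restriction M (P i)].
  by rewrite {1}(block_sum P) inE.
apply/idP/andP => [Jr|[JP]].
  have JP : J \subset P j by case/imsetP: (Jr) => J1 _ ->; exact: subsetIr.
  split=> //; rewrite blocksE; apply/forallP => i; case: (eqVneq i j) => [->|ij].
    suff -> : (J :|: J0 :\: P j) :&: P j = J by [].
    apply/setP => x; rewrite !inE; have := subsetP JP x.
    by case: (x \in J) => [->//|_]; case: (x \in P j); rewrite ?andbF.
  suff -> : (J :|: J0 :\: P j) :&: P i = J0 :&: P i.
    by move: J0M; rewrite blocksE => /forallP.
  apply/setP => x; rewrite !inE; case: (boolP (x \in P i)) => [xi|]; rewrite ?andbF // !andbT.
  have xj : x \notin P j.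
    by apply: contra ij => xj; apply/eqP; apply: (block_disj (c := P) xi xj).
  by rewrite xj /=; have := subsetP JP x; case: (x \in J) => // /(_ isT); rewrite (negbTE xj).
rewrite blocksE => /forallP/(_ j).
suff -> : (J :|: J0 :\: P j) :&: P j = J by [].
apply/setP => x; rewrite !inE; have := subsetP JP x.
by case: (x \in J) => [->//|_]; case: (x \in P j); rewrite ?andbF.
Qed.

Lemma block_tnn (R : realType) n (M : {set {set 'I_n}}) (P : component_partition M) j :
  positroid R M -> exists r (X : 'M[R]_(r, n)), tnn X /\ bases X = restriction M (P j).
Proof.
case=> k [X [tX MX M0]]; have [J0 J0M] := set0Pn _ M0.
pose B := J0 :\: P j.
have MXE J : (J \in M) = (minor X J != 0) by rewrite {1}MX inE.
have J0X : J0 \in bases X by rewrite inE; move: J0M; rewrite MX inE.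
have cJ0 := bases_card J0X.
have [m eB] : exists m, #|B| = m by exists #|B|.
have [r er] : exists r, #|J0 :&: P j| = r by exists #|J0 :&: P j|.
have ek : k = (m + r)%N by rewrite -eB -er -cJ0 addnC cardsID.
clear cJ0; subst k.
have [Y tY YE] := tnn_contract_set eB tX J0X (subsetDl _ _).
have [Z tZ ZE] := tnn_restrict (P j) tY.
exists r, Z; split=> //; apply/setP => J; rewrite ZE YE (restriction_block j J J0M).
apply: andb_id2l => JP.
rewrite inE MXE; apply: andb_idl => _.
rewrite disjoint_sym disjoints_subset /B; apply/subsetP => x; rewrite !inE => /andP[xP _].
by apply: contra xP; exact: (subsetP JP).
Qed.

(** * Evaluation of Plücker algebras *)

Section PluckerEval.
Variables (F : fieldType) (n : nat).
Implicit Types (P Q : plucker_poly F n) (J : {set 'I_n}).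

Section Morphism.
Variables (A : comAlgType F) (D : {set 'I_n} -> A).

Lemma plucker_evalM P Q : plucker_eval D (P * Q) = plucker_eval D P * plucker_eval D Q.
Proof. by rewrite /plucker_eval rmorphM. Qed.

Lemma plucker_evalD P Q : plucker_eval D (P + Q) = plucker_eval D P + plucker_eval D Q.
Proof. by rewrite /plucker_eval rmorphD. Qed.

Lemma plucker_evalB P Q : plucker_eval D (P - Q) = plucker_eval D P - plucker_eval D Q.
Proof. by rewrite /plucker_eval rmorphB. Qed.

Lemma plucker_eval1 : plucker_eval D 1 = 1.
Proof. by rewrite /plucker_eval rmorph1. Qed.

Lemma plucker_evalZ c P : plucker_eval D (c *: P) = c *: plucker_eval D P.
Proof. by rewrite /plucker_eval mmapZ mulr_algl. Qed.

Lemma plucker_evalX P m : plucker_eval D (P ^+ m) = plucker_eval D P ^+ m.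
Proof. by rewrite /plucker_eval rmorphXn. Qed.

Lemma plucker_eval_prod (I : Type) (r : seq I) (p : pred I) (f : I -> plucker_poly F n) :
  plucker_eval D (\prod_(i <- r | p i) f i) = \prod_(i <- r | p i) plucker_eval D (f i).
Proof. by rewrite /plucker_eval rmorph_prod. Qed.

Lemma plucker_eval_sum (I : Type) (r : seq I) (p : pred I) (f : I -> plucker_poly F n) :
  plucker_eval D (\sum_(i <- r | p i) f i) = \sum_(i <- r | p i) plucker_eval D (f i).
Proof. by rewrite /plucker_eval rmorph_sum. Qed.

Lemma plucker_eval_var J : plucker_eval D (pvar F J) = D J.
Proof.
by rewrite /plucker_eval /pvar mmapX mmap1U enum_rankK.
Qed.

Lemma plucker_eval_neck M S e :
  plucker_eval D (neck_mono F M S e) = \prod_(a in S) D (necklace M a) ^+ e a.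
Proof.
rewrite /neck_mono plucker_eval_prod; apply: eq_bigr => a _.
by rewrite plucker_evalX plucker_eval_var.
Qed.

Lemma plucker_eval_homog (t : F) m P : P \is m.-homog ->
  plucker_eval (fun J => t *: D J) P = t ^+ m *: plucker_eval D P.
Proof.
move/dhomogP => hP; rewrite /plucker_eval /mmap scaler_sumr.
rewrite big_seq [RHS]big_seq; apply: eq_bigr => mm /hP dm.
rewrite [RHS]scalerAr; congr (_ * _); rewrite /mmap1.
under eq_bigr do rewrite exprZn.
by rewrite scaler_prod prodrXr -mdegE dm.
Qed.

End Morphism.

Lemma plucker_eval_morph (A B : comAlgType F) (f : {rmorphism A -> B})
    (D : {set 'I_n} -> A) P : (forall a : F, f a%:A = a%:A) ->
  f (plucker_eval D P) = plucker_eval (f \o D) P.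
Proof.
move=> fA; rewrite /plucker_eval /mmap rmorph_sum; apply: eq_bigr => m _.
rewrite rmorphM [f _]fA; congr (_ * _); rewrite /mmap1 rmorph_prod.
by apply: eq_bigr => i _; rewrite rmorphXn.
Qed.

Lemma eq_plucker_eval (A : comAlgType F) (D D' : {set 'I_n} -> A) P :
  D =1 D' -> plucker_eval D P = plucker_eval D' P.
Proof.
move=> e; rewrite /plucker_eval /mmap; apply: eq_bigr => m _; congr (_ * _).
by apply: eq_bigr => i _; rewrite e.
Qed.

Variables (N : {set {set 'I_n}}) (S : {set 'I_n}) (A : positroid_ring F N S).

Lemma Delta_nonbase J : J \notin N -> Delta A J = 0.
Proof.
move=> JN; rewrite -plucker_eval_var; apply/pr_kernel.
exists (fun=> 0%N), (fun J' => (J' == J)%:R); rewrite (bigD1 J) //= eqxx mul1r.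
rewrite big1 ?addr0 => [|J' /andP[_ /negbTE ->]]; last by rewrite mul0r.
by rewrite /neck_mono big1 // mul1r subrr /plucker_eval rmorph0.
Qed.

(** Such a [Y] is a point of the positroid variety: evaluated at [Y], the certificate of [pr_kernel]
    loses its nonbasis terms, and the necklace monomial can be cancelled. *)
Lemma plucker_eval_point (Y : 'M[F]_(mrank N, n)) P :
  (forall J, J \notin N -> minor Y J = 0) -> (forall J, J \in N -> J \subset S) ->
  (forall a, a \in S -> minor Y (necklace N a) != 0) ->
  plucker_eval (@Delta _ _ _ _ A) P = 0 ->
  plucker_eval (fun J => minor Y J : F^o) P = 0.
Proof.
move=> Y0 NS Yn /pr_kernel[e [Q]].
pose f : {rmorphism {mpoly F[mrank N * n]} -> F^o} := meval (fun i => mxvec Y 0 i).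
have fA (a : F) : f a%:A = a%:A.
  by rewrite /f /= -mul_mpolyC mulr1 mevalC [a%:A]mulr1.
have fgen J : f (generic_minor F (mrank N) S J) = minor Y J.
  rewrite /generic_minor; case: ifPn => [_|JS]; last first.
    by rewrite rmorph0 Y0 //; apply: contra JS => /NS.
  rewrite -minor_map; congr minor; apply/matrixP => a b; rewrite !mxE.
  by rewrite /f /= mevalXU mxvecE.
move/(congr1 f); rewrite rmorph0 plucker_eval_morph // (eq_plucker_eval _ fgen).
rewrite plucker_evalB plucker_evalM plucker_eval_sum big1 ?subr0 => [|J JN]; last first.
  by rewrite plucker_evalM plucker_eval_var Y0 ?mulr0.
rewrite plucker_eval_neck => /eqP; rewrite mulf_eq0 => /orP[|/eqP//].
rewrite prodf_seq_eq0 => /hasP[a _ /andP[aS]]; rewrite expf_eq0 => /andP[_ /eqP h].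
by have := Yn a aS; rewrite h eqxx.
Qed.

End PluckerEval.

(** * Independence of necklace coordinates *)

Lemma all2_leq_sumn (s t : seq nat) : all2 leq s t -> (sumn s <= sumn t)%N.
Proof.
elim: s t => [|x s IH] [|y t] //= /andP[xy st].
by rewrite leq_add // IH.
Qed.

Lemma gale_le_sum n (a : 'I_n) J B : gale_le a J B ->
  (\sum_(x in J) cyc_pos a x <= \sum_(x in B) cyc_pos a x)%N.
Proof.
move/all2_leq_sumn.
have E (C : {set 'I_n}) :
    sumn (sort leq [seq cyc_pos a i | i <- enum C]) = (\sum_(x in C) cyc_pos a x)%N.
  have /permPl/perm_sumn -> := perm_sort leq [seq cyc_pos a i | i <- enum C].
  by rewrite sumnE big_map big_enum.
by rewrite !E.
Qed.

Section NecklaceRing.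
Variables (F : fieldType) (n : nat) (N : {set {set 'I_n}}) (S : {set 'I_n}).
Variable A : positroid_ring F N S.

(** Existence of a Gale-minimal basis is read off from [pr_unit]: without one, [necklace] takes its
    default [set0], a nonbasis, whose coordinate would be 0 and yet a unit. *)
Lemma necklace_greedy a : set0 \notin N -> a \in S -> greedy N a (necklace N a).
Proof.
move=> N0 aS; rewrite /necklace; case: pickP => [J /andP[JN /forallP gJ]|nJ] /=; last first.
  have [r] := pr_unit A aS; rewrite Delta_nonbase ?mul0r.
    by move/esym/eqP; rewrite oner_eq0.
  rewrite /necklace; case: pickP => [J|_]; first by rewrite nJ.
  exact: N0.
split=> // x y xJ yJ lt; apply/negP => h.
have /gale_le_sum := implyP (gJ (y |: J :\ x)) h.
rewrite (big_setU1 y) ?inE ?negb_and ?yJ ?orbT //= (big_setD1 x xJ) /=.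
by rewrite leq_add2r leqNgt lt.
Qed.

Lemma necklace_in a : set0 \notin N -> a \in S -> necklace N a \in N.
Proof. by move=> N0 aS; case: (necklace_greedy N0 aS). Qed.

Lemma Delta_neck_unit a : a \in S -> exists2 r, Delta A (necklace N a) * r = 1 &
  pr_frac A (Delta A (necklace N a)) != 0.
Proof.
move=> aS; have [r dr] := pr_unit A aS; exists r => //.
apply/eqP => h; have := congr1 (pr_frac A) dr.
by rewrite rmorphM h mul0r rmorph1 => /esym/eqP; rewrite oner_eq0.
Qed.

End NecklaceRing.

Lemma exprz_pos_neg (K : fieldType) (x : K) e : x != 0 ->
  x ^ e * x ^+ pos_part (- e) = x ^+ pos_part e.
Proof.
move=> x0; rewrite !exprnP -expfzDr //; congr (_ ^ _); rewrite /pos_part.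
by clear; case: ifP; case: ifP; lia.
Qed.

Lemma mrank_bases (R : realFieldType) n r (X : 'M[R]_(r, n)) :
  bases X != set0 -> mrank (bases X) = r.
Proof.
case/set0Pn => J JN; apply/eqP; rewrite eqn_leq; apply/andP; split.
  by apply/bigmax_leqP => J' /bases_card ->.
by apply: leq_trans (leq_bigmax_cond _ JN); rewrite (bases_card JN).
Qed.

(** Take a circuit through [a] and [b]. If [U] split it, both parts would be independent, and mixing
    the two bases containing them would give a basis containing the circuit. *)
Lemma separates_connected n (N : {set {set 'I_n}}) (S U : {set 'I_n}) a b :
  connected_matroid N S -> separates U N -> a \in S -> b \in S ->
  a \in U -> b \in U.
Proof.
move=> conn sU aS bS aU; case: (eqVneq a b) => [<-//|ab].
apply: contraT => bU; have [C [/minsetP[/= /andP[CS nC] Cmin] aC bC]] := conn a b aS bS ab.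
have sub (B : {set 'I_n}) x : B \subset C -> x \in C -> x \notin B -> indep N B.
  move=> BC xC xB; apply: contraNT xB => nB; rewrite (Cmin B) //=.
  by rewrite nB (subset_trans BC).
have b1 : b \notin C :&: U by rewrite !inE (negbTE bU) andbF.
have a2 : a \notin C :\: U by rewrite !inE aU.
have /exists_inP[J1 J1N C1] := sub _ b (subsetIl _ _) bC b1.
have /exists_inP[J2 J2N C2] := sub _ a (subsetDl _ _) aC a2.
case/negP: nC; apply/exists_inP; exists ((J1 :&: U) :|: (J2 :\: U)); first exact: sU.
apply/subsetP => x xC; rewrite !inE; case: (boolP (x \in U)) => xU /=.
  by rewrite andbT orbF; apply: (subsetP C1); rewrite !inE xC.
by rewrite andbF /=; apply: (subsetP C2); rewrite !inE xC xU.
Qed.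

(** The relation over the complex numbers is evaluated at real totally nonnegative matrices.
    Connectedness makes the partial sums of [e] constant on [S], and the constant is 0. *)
Theorem necklace_independent (R : realType) n r (X : 'M[R]_(r, n)) (S : {set 'I_n})
    (A : positroid_ring R[i] (bases X) S) (e : 'I_n -> int) :
  tnn X -> bases X != set0 -> (0 < r)%N -> (forall J, J \in bases X -> J \subset S) ->
  connected_matroid (bases X) S ->
  \prod_(a in S) pr_frac A (Delta A (necklace (bases X) a)) ^ e a = 1 ->
  forall a, a \in S -> e a = 0.
Proof.
move=> tX nz r0 NS conn eq1.
pose I a := necklace (bases X) a.
have N0 : set0 \notin bases X.
  by apply/negP => /bases_card; rewrite cards0 => h; rewrite -h in r0.
have IN a : a \in S -> I a \in bases X := necklace_in A N0.
have rel (Y : 'M[R]_(r, n)) : tnn Y -> bases Y = bases X -> \prod_(a in S) minor Y (I a) ^ e a = 1.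
  move=> tY bY.
  pose P : plucker_poly R[i] n := \prod_(a in S) pvar _ (I a) ^+ pos_part (e a)
     - \prod_(a in S) pvar _ (I a) ^+ pos_part (- e a).
  have P0 : plucker_eval (@Delta _ _ _ _ A) P = 0.
    apply: (@pr_frac_inj _ _ _ _ A); rewrite plucker_evalB !plucker_eval_prod.
    rewrite rmorph0 rmorphB !rmorph_prod /=; apply/eqP; rewrite subr_eq0; apply/eqP.
    rewrite -[RHS]mul1r -[X in _ = X * _]eq1 -big_split /=; apply: eq_bigr => a aS.
    rewrite !plucker_evalX !plucker_eval_var !rmorphXn exprz_pos_neg //.
    by have [] := Delta_neck_unit A aS.
  have rk : r = mrank (bases X) by rewrite mrank_bases.
  have [Y' eY'] : exists Y' : 'M[R]_(mrank (bases X), n), forall J, minor Y' J = minor Y J.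
    by case: (mrank (bases X)) / rk; exists Y.
  have := @plucker_eval_point _ _ _ _ A (map_mx (real_complex R) Y') P.
  have mY J : minor (map_mx (real_complex R) Y') J = real_complex R (minor Y J).
    by rewrite minor_map eY'.
  have Yn a : a \in S -> minor Y (I a) != 0.
    by move=> aS; have := IN a aS; rewrite -bY inE.
  move=> /(_ _ NS _ P0); rewrite plucker_evalB !plucker_eval_prod => h.
  have {h} /eqP : \prod_(a in S) real_complex R (minor Y (I a)) ^+ pos_part (e a)
      - \prod_(a in S) real_complex R (minor Y (I a)) ^+ pos_part (- e a) = 0.
    rewrite -[RHS]h.
    - by congr (_ - _); apply: eq_bigr => a aS; rewrite plucker_evalX plucker_eval_var mY.
    - by move=> J; rewrite mY -bY inE negbK => /eqP ->.
    - by move=> a aS; rewrite mY fmorph_eq0 Yn.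
  rewrite subr_eq0 => /eqP h.
  have : \prod_(a in S) minor Y (I a) ^+ pos_part (e a)
      = \prod_(a in S) minor Y (I a) ^+ pos_part (- e a).
    apply: (fmorph_inj (real_complex R)); rewrite !rmorph_prod.
    by under eq_bigr do rewrite rmorphXn; under [RHS]eq_bigr do rewrite rmorphXn.
  rewrite (eq_bigr (fun a => minor Y (I a) ^ e a * minor Y (I a) ^+ pos_part (- e a))).
    rewrite big_split /= => h'; apply: (@mulIf _ (\prod_(a in S) minor Y (I a) ^+ pos_part (- e a))).
      by apply/prodf_neq0 => a aS; rewrite expf_neq0 // Yn.
    by rewrite mul1r.
  by move=> a aS; rewrite exprz_pos_neg // Yn.
have s0 : \sum_(a in S) e a = 0.
  case: r r0 X A tX nz NS conn eq1 @I N0 IN rel => // r _ X A tX nz NS conn eq1 I N0 IN rel.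
  (* Multiplying by [G] doubles all minors, so the relation is rescaled by 2 to the sum of the
     exponents. *)
  pose G : 'M[R]_r.+1 := diag_mx (\row_i (if i == 0 then 2 else 1)).
  have dG : \det G = 2.
    by rewrite det_diag big_ord_recl !mxE /= big1 ?mulr1 // => i _; rewrite mxE.
  have two0 : 2 != 0 :> R by rewrite pnatr_eq0.
  have h1 : \prod_(a in S) minor X (I a) ^ e a = 1 by exact: rel.
  have : \prod_(a in S) minor (G *m X) (I a) ^ e a = 1.
    apply: rel => [J|]; first by rewrite minor_mulmx dG mulr_ge0 ?ler0n.
    by apply/setP => J; rewrite !inE minor_mulmx dG mulf_eq0 (negbTE two0).
  under eq_bigr do rewrite minor_mulmx dG expfzMl.
  rewrite big_split /= h1 mulr1 prodr_exprz_sum // => /eqP.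
  rewrite pexprz_eq1 ?ler0n // => /orP[/eqP//|].
  by rewrite (_ : 2 = 1 + 1) // -subr_eq0 addrK oner_eq0.
pose e' a := if a \in S then e a else 0.
have [I' gI'] : exists I' : 'I_n -> {set 'I_n}, forall a,
    greedy (bases X) a (I' a) /\ (a \in S -> I' a = I a).
  have h a : exists J, greedy (bases X) a J /\ (a \in S -> J = I a).
    case: (boolP (a \in S)) => aS; last by have [J gJ] := greedy_exists a nz; exists J.
    by exists (I a); split=> //; exact: (necklace_greedy A N0 aS).
  by exists (fun a => projT1 (cid (h a))) => a; exact: (projT2 (cid (h a))).
have sep a : separates [set x | partial_sum e' x == partial_sum e' a] (bases X).
  apply: (necklace_relation_separates (I := I')) => //.
  - by move=> b; exact: (gI' b).1.
  - by rewrite -big_mkcond.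
  - move=> Y tY bY; rewrite -[RHS](rel Y tY bY) [RHS]big_mkcond /=; apply: eq_bigr => b _.
    by rewrite /e'; case: ifP => bS; rewrite ?expr0z // (gI' b).2.
have cst a b : a \in S -> b \in S -> partial_sum e' a = partial_sum e' b.
  move=> aS bS; apply/eqP.
  have := separates_connected conn (sep b) bS aS; rewrite !inE eqxx; exact.
have supp (p : pred 'I_n) : \sum_(a | p a) e' a = \sum_(a in S | p a) e a.
  by rewrite [RHS]big_mkcondl.
(* At the largest element of [S] the partial sum is the total, so the common value is 0. *)
move=> a0 a0S; have [M MS Mmax] := @arg_maxnP _ a0 (fun x => x \in S) val a0S.
have E0 b : b \in S -> partial_sum e' b = 0.
  move=> bS; rewrite (cst _ _ bS MS) /partial_sum supp -[RHS]s0; apply: eq_bigl => x.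
  by case: (boolP (x \in S)) => //= /Mmax; rewrite /= => ->.
have e'0 m (a : 'I_n) : (a < m)%N -> e' a = 0.
  elim: m a => // m IH a am; case: (boolP (a \in S)) => aS; last by rewrite /e' (negbTE aS).
  have := E0 _ aS; rewrite /partial_sum (bigD1 a) //= big1 ?addr0 // => x /andP[xa nxa].
  have xa' : (x < a)%N by rewrite ltn_neqAle xa andbT.
  by apply: IH; exact: leq_trans xa' am.
by have := e'0 n a0 (ltn_ord a0); rewrite /e' a0S.
Qed.

(** A nonzero rational kernel vector, with its denominators cleared. *)
Lemma int_kernel (I J : finType) (S : {set I}) (g : I -> J -> int) : (#|J| < #|S|)%N ->
  exists e : I -> int, (exists2 i, i \in S & e i != 0) /\
    forall j, \sum_(i in S) e i * g i j = 0.
Proof.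
move=> ltJ.
pose G : 'M[rat]_(#|S|, #|J|) := \matrix_(i, j) (g (enum_val i) (enum_val j))%:~R.
have K0 : kermx G != 0.
  rewrite kermx_eq0 /row_free; apply: contraTneq ltJ => <-.
  by rewrite -leqNgt rank_leq_col.
have /rowV0Pn[v /sub_kermxP vG /rV0Pn[i0 vi0]] := K0.
pose e' i : int := numq (v 0 i) * \prod_(l | l != i) denq (v 0 l).
pose d : int := \prod_l denq (v 0 l).
have e'E i : (e' i)%:~R = v 0 i * d%:~R :> rat.
  rewrite /e' /d [in RHS](bigD1 i) //= !intrM numqE mulrA; congr (_ * _).
pose e x : int := \sum_(i | enum_val i == x) e' i.
have eE i : e (enum_val i) = e' i.
  by rewrite /e (big_pred1 i) // => l; rewrite (inj_eq enum_val_inj).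
exists e; split.
  exists (enum_val i0); first exact: enum_valP.
  rewrite eE -(intr_eq0 rat) e'E mulf_neq0 // intr_eq0.
  by apply/prodf_neq0 => l _; rewrite denq_neq0.
move=> j; apply/eqP; rewrite -(intr_eq0 rat) big_enum_val rmorph_sum /=; apply/eqP.
have := congr1 (fun M : 'rV_ _ => M 0 (enum_rank j)) vG.
rewrite !mxE => /(congr1 ( *%R d%:~R)); rewrite mulr0 mulr_sumr => h; rewrite -[RHS]h.
apply: eq_bigr => i _.
by rewrite mxE enum_rankK eE intrM e'E; ring.
Qed.

(** * Injectivity of the boundary faces *)

Section GapFaces.
Variables (F : fieldType) (n : nat).

Lemma card_bface (S : {set 'I_n}) (D : plabic S) :
  #|{: bface D}| = #|[set gap_face D s | s in S]|.
Proof.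
rewrite card_sig; apply: eq_card => f; rewrite inE /=.
apply/exists_inP/imsetP => [[s sS /eqP <-]|[s sS ->]]; first by exists s.
by exists s.
Qed.

Lemma gap_face_bdry (S : {set 'I_n}) (D : plabic S) s : s \in S -> bdry_face (gap_face D s).
Proof. by move=> sS; apply/exists_inP; exists s. Qed.

End GapFaces.

Lemma diagram_fvar_neq0 (F : fieldType) n N (S : {set 'I_n}) (A : positroid_ring F N S)
    (s : hpos_seed A) (f : froz (hp_seed s)) : fvar f != 0.
Proof.
have : coef_group (hp_seed s) (fvar f).
  exists (fun f' => (f' == f)%:Z); rewrite (bigD1 f) //= eqxx expr1z big1 ?mulr1 // => f' /negbTE ->.
  by rewrite expr0z.
case/(hp_coef s) => e ->; apply/prodf_neq0 => a aS; apply: expfz_neq0.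
by have [] := Delta_neck_unit A aS.
Qed.

Theorem gap_face_inj_tnn (R : realType) n r (X : 'M[R]_(r, n)) (S : {set 'I_n})
    (A : positroid_ring R[i] (bases X) S) (s : hpos_seed A) :
  tnn X -> bases X != set0 -> (0 < r)%N -> (forall J, J \in bases X -> J \subset S) ->
  connected_matroid (bases X) S ->
  {in S &, injective (gap_face (hp_diag s))}.
Proof.
move=> tX nz r0 NS conn; apply/imset_injP; apply: contraT => ninj.
have ltb : (#|{: froz (hp_seed s)}| < #|S|)%N.
  by rewrite /= card_bface ltn_neqAle ninj leq_imset_card.
pose z a := pr_frac A (Delta A (necklace (bases X) a)).
have hz a : exists g : froz (hp_seed s) -> int, a \in S -> z a = \prod_f fvar f ^ g f.
  case: (boolP (a \in S)) => aS; last by exists (fun=> 0).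
  have : necklace_group (z a).
    exists (fun b => (b == a)%:Z); rewrite (bigD1 a) //= eqxx expr1z big1 ?mulr1 //.
    by move=> b /andP[_ /negbTE ->]; rewrite expr0z.
  by case/(hp_coef s) => g ->; exists g.
pose g a := projT1 (cid (hz a)).
have gE a : a \in S -> z a = \prod_f fvar f ^ g a f := projT2 (cid (hz a)).
(* A kernel vector of the exponent matrix is a nontrivial monomial relation among the necklace
   coordinates. *)
have [e [[a aS ea] eg]] := int_kernel g ltb.
have h := necklace_independent (A := A) (e := e) tX nz r0 NS conn.
case/eqP: ea; apply: h aS.
rewrite (eq_bigr (fun a => \prod_f fvar f ^ (e a * g a f))).
  rewrite exchange_big big1 //= => f _.
  by rewrite prodr_exprz_sum ?diagram_fvar_neq0 // eg expr0z.
move=> b bS; rewrite -/(z b) gE //.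
rewrite (big_morph (fun x => x ^ e b) (fun x y => expfzMl x y _) (exp1rz _ _)).
by apply: eq_bigr => f _; rewrite exprz_exp mulrC.
Qed.

Section BlockFacts.
Variables (R : realType) (n : nat) (M : {set {set 'I_n}}) (P : component_partition M).
Hypotheses (HM : positroid R M) (HL : loopless M).

Lemma restriction_sub j J : J \in restriction M (P j) -> J \subset P j.
Proof. by case/imsetP => J1 _ ->; exact: subsetIr. Qed.

Lemma restriction_rank j : exists r (X : 'M[R]_(r, n)),
  [/\ tnn X, bases X = restriction M (P j), bases X != set0 & (0 < r)%N].
Proof.
have [r [X [tX bX]]] := block_tnn j HM.
have [a aP] := set0Pn _ (block_neq0 j).
have /exists_inP[J JM aJ] := forallP HL a.
have : J :&: P j \in restriction M (P j).
  rewrite (restriction_block _ _ JM) subsetIr /=; suff -> : J :&: P j :|: J :\: P j = J by [].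
  exact: setID.
rewrite -bX => JX; exists r, X; split=> //; first by apply/set0Pn; exists (J :&: P j).
by rewrite -(bases_card JX); apply/card_gt0P; exists a; rewrite inE aJ.
Qed.

Lemma block_mrank_gt0 j : (0 < mrank (restriction M (P j)))%N.
Proof.
by have [r [X [tX <- nz r0]]] := restriction_rank j; rewrite mrank_bases.
Qed.

Lemma gap_face_inj j (A : positroid_ring R[i] (restriction M (P j)) (P j)) (s : hpos_seed A) :
  {in P j &, injective (gap_face (hp_diag s))}.
Proof.
have [r [X [tX bX nz r0]]] := restriction_rank j.
have NS := @restriction_sub j; have conn := @block_connected _ _ P j.
move: A s NS conn; case: _ / bX => A s NS conn.
exact: gap_face_inj_tnn.
Qed.

End BlockFacts.

(** * Degrees *)

Section Degree.
Variables (F : fieldType) (n : nat) (N : {set {set 'I_n}}) (S : {set 'I_n}).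
Variable A : positroid_ring F N S.
Implicit Types (r : A) (d : int).

Lemma pvar_homog (J : {set 'I_n}) : pvar F J \is 1.-homog.
Proof. by rewrite /pvar dhomogX /= mdeg1. Qed.

Lemma neck_homog e : neck_mono F N S e \is (\sum_(a in S) e a)%N.-homog.
Proof.
rewrite /neck_mono; elim/big_rec2: _ => [|a m P _ hP]; first exact: dhomog1.
by apply: dhomogM => //; have := dhomogMn (e a) (pvar_homog (necklace N a)); rewrite mul1n.
Qed.

Lemma neck_monoD e e' :
  neck_mono F N S (fun a => (e a + e' a)%N) = neck_mono F N S e * neck_mono F N S e'.
Proof. by rewrite /neck_mono -big_split; apply: eq_bigr => a _; rewrite exprD. Qed.

Lemma degree_mul d d' r r' :
  has_degree d r -> has_degree d' r' -> has_degree (d + d') (r * r').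
Proof.
move=> [e [m [P [hP em eP]]]] [e' [m' [P' [hP' em' eP']]]].
exists (fun a => (e a + e' a)%N), (m + m')%N, (P * P'); split; first exact: dhomogM.
  by rewrite PoszD em em' big_split /= PoszD; ring.
by rewrite neck_monoD !plucker_evalM mulrACA eP eP'.
Qed.

Lemma degree_add d r r' : has_degree d r -> has_degree d r' -> has_degree d (r + r').
Proof.
move=> [e [m [P [hP em eP]]]] [e' [m' [P' [hP' em' eP']]]].
exists (fun a => (e a + e' a)%N), (m + \sum_(a in S) e' a)%N,
  (P * neck_mono F N S e' + neck_mono F N S e * P'); split.
- apply: dhomogD; first by apply: dhomogM => //; exact: neck_homog.
  have -> : (m + \sum_(a in S) e' a = \sum_(a in S) e a + m')%N.
    by apply/eqP; rewrite -eqz_nat !PoszD em em'; apply/eqP; ring.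
  by apply: dhomogM => //; exact: neck_homog.
- by rewrite PoszD em big_split /= PoszD; ring.
by rewrite neck_monoD plucker_evalD !plucker_evalM -eP -eP'; ring.
Qed.

Lemma degree1 : has_degree 0 (1 : A).
Proof.
exists (fun=> 0%N), 0%N, 1; split; first exact: dhomog1.
  by rewrite big1 // addr0.
by rewrite mul1r /neck_mono big1.
Qed.

Lemma degree_Delta J : has_degree 1 (Delta A J).
Proof.
exists (fun=> 0%N), 1%N, (pvar F J); split; first exact: pvar_homog.
  by rewrite big1 // add0r.
by rewrite /neck_mono big1 ?plucker_eval1 ?mulr1 // plucker_eval_var.
Qed.

Lemma degree_inv a r : a \in S -> Delta A (necklace N a) * r = 1 -> has_degree (-1) r.
Proof.
move=> aS h; exists (fun b => (b == a) : nat), 0%N, 1; split; first exact: dhomog1.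
  rewrite (bigD1 a) //= eqxx big1 ?addn0 ?addrN //.
  by move=> b /andP[_ /negbTE ->].
rewrite plucker_eval_neck (bigD1 a) //= eqxx expr1 big1 ?mulr1 ?plucker_eval1 1?mulrC //.
by move=> b /andP[_ /negbTE ->].
Qed.

Lemma degree0 d : S != set0 -> has_degree d (0 : A).
Proof.
case/set0Pn => a aS.
(* A denominator of this size makes the degree of the numerator nonnegative even for negative [d],
   as [S] has an element. *)
exists (fun=> absz d), (absz ((\sum_(b in S) absz d)%N%:Z + d)), 0; split.
- exact: dhomog0.
- rewrite gez0_abs // (big_setD1 a aS) /= PoszD.
  by move: (\sum_(b in _) _)%N => x; lia.
by rewrite mul0r /plucker_eval rmorph0.
Qed.

End Degree.

Section DegreeUniq.
Variables (F : numFieldType) (n : nat) (N : {set {set 'I_n}}) (S : {set 'I_n}).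
Variable A : positroid_ring F N S.
Hypothesis rank_gt0 : (0 < mrank N)%N.

Lemma neck_eval_reg e (r : A) :
  r * plucker_eval (@Delta _ _ _ _ A) (neck_mono F N S e) = 0 -> r = 0.
Proof.
move=> h; apply: (@pr_frac_inj _ _ _ _ A); rewrite rmorph0; apply/eqP.
have /eqP := congr1 (pr_frac A) h; rewrite rmorphM rmorph0 mulf_eq0 => /orP[//|].
rewrite plucker_eval_neck rmorph_prod prodf_seq_eq0 => /hasP[a _ /andP[aS]].
rewrite rmorphXn expf_eq0 => /andP[_ h0].
by have [_ _] := Delta_neck_unit A aS; rewrite h0.
Qed.

(* Rescaling the generic matrix shows that the ideal of relations is homogeneous. *)
Lemma degree_uniq (d d' : int) (r : A) :
  has_degree d r -> has_degree d' r -> r != 0 -> d = d'.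
Proof.
move=> [e [m [P [hP em eP]]]] [e' [m' [P' [hP' em' eP']]]] r0.
(* Doubling the generic matrix multiplies its maximal minors by [t], and [t > 1] because the rank is
   positive. *)
pose k := mrank N; pose t : F := 2 ^+ k.
pose p1 := neck_mono F N S e' * P; pose p2 := neck_mono F N S e * P'.
pose da := (\sum_(x in S) e' x + m)%N; pose db := (\sum_(x in S) e x + m')%N.
have h1 : p1 \is da.-homog by apply: dhomogM => //; exact: neck_homog.
have h2 : p2 \is db.-homog by apply: dhomogM => //; exact: neck_homog.
have e12 : plucker_eval (@Delta _ _ _ _ A) (p1 - p2) = 0.
  by rewrite plucker_evalB !plucker_evalM -eP -eP'; ring.
have /pr_kernel[e'' [Q eQ]] := e12.
pose gen := @generic_minor F n k S.
pose f : {rmorphism {mpoly F[k * n]} -> {mpoly F[k * n]}} :=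
  mmap (in_alg {mpoly F[k * n]}) (fun i => 2 *: 'X_i).
have fA (c : F) : f c%:A = c%:A.
  by rewrite /f /= -[in LHS]mul_mpolyC mulr1 mmapC.
have fgen J : f (gen J) = t *: gen J.
  rewrite /gen /generic_minor; case: ifP => _; last by rewrite rmorph0 scaler0.
  rewrite -minor_map -mul_mpolyC /t rmorphXn /= -det_scalar -minor_mulmx; congr minor.
  apply/matrixP => i x; rewrite mul_scalar_mx !mxE /f /= mmapX mmap1U mul_mpolyC.
  by [].
have sigE (Q0 : plucker_poly F n) : exists Q1, plucker_eval gen Q1 = plucker_eval (fun J => t *: gen J) Q0.
  exists (plucker_eval (fun J => t *: pvar F J) Q0).
  pose g : {rmorphism plucker_poly F n -> {mpoly F[k * n]}} :=
    mmap (in_alg {mpoly F[k * n]}) (fun i => gen (enum_val i)).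
  have gA (c : F) : g c%:A = c%:A by rewrite /g /= -[in LHS]mul_mpolyC mulr1 mmapC.
  rewrite -[LHS]/(g _) (plucker_eval_morph _ _ gA); apply: eq_plucker_eval => J /=.
  by rewrite /g /= mmapZ mulr_algl -/(plucker_eval gen _) plucker_eval_var.
pose Q' J := t *: projT1 (cid (sigE (Q J))).
pose s := (\sum_(x in S) e'' x)%N.
(* The certificate for [p1 - p2] is rescaled. As [p1] and [p2] have the same nonzero value in the
   ring, [t ^+ da] and [t ^+ db] must agree. *)
have : plucker_eval (@Delta _ _ _ _ A) (t ^+ s *: (t ^+ da *: p1 - t ^+ db *: p2)) = 0.
  apply/pr_kernel; exists e'', Q'.
  have := congr1 f eQ; rewrite rmorph0 plucker_eval_morph // (eq_plucker_eval _ fgen).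
  rewrite !plucker_evalB !plucker_evalM !plucker_evalZ !plucker_evalB !plucker_evalZ.
  rewrite !plucker_eval_sum (plucker_eval_homog _ _ h1) (plucker_eval_homog _ _ h2).
  rewrite (plucker_eval_homog _ _ (neck_homog F N S e'')) => h; rewrite -[RHS]h.
  congr (_ - _); first by rewrite -scalerAr -scalerAl.
  apply: eq_bigr => J _; rewrite !plucker_evalM !plucker_eval_var plucker_evalZ.
  by rewrite (projT2 (cid (sigE (Q J)))) -scalerAl -scalerAr.
have -> : plucker_eval (@Delta _ _ _ _ A) (t ^+ s *: (t ^+ da *: p1 - t ^+ db *: p2)) =
   (t ^+ s * (t ^+ da - t ^+ db)) *: plucker_eval (@Delta _ _ _ _ A) p1.
  rewrite plucker_evalZ plucker_evalB !plucker_evalZ -scalerA scalerBl; congr (_ *: (_ - _ *: _)).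
  by apply/esym/eqP; rewrite -subr_eq0 -plucker_evalB e12.
have t0 : t != 0 by rewrite expf_neq0 // pnatr_eq0.
move/eqP; rewrite -mulr_algl => /eqP h.
have hc : (t ^+ s * (t ^+ da - t ^+ db) == 0) || (plucker_eval (@Delta _ _ _ _ A) p1 == 0).
  case: eqP => //= /eqP c0; apply/eqP.
  have := congr1 (fun z => (t ^+ s * (t ^+ da - t ^+ db))^-1 *: z) h.
  by rewrite mulr_algl scalerA mulVf // scale1r scaler0.
case/orP: hc; last first.
  rewrite plucker_evalM -eP mulrCA mulrA => /eqP h0.
  by case/eqP: r0; exact: (neck_eval_reg (neck_eval_reg h0)).
rewrite mulf_eq0 expf_eq0 (negbTE t0) andbF /= subr_eq0 => /eqP ab.
have t1 : 1 < t by rewrite exprn_egt1 ?ltr1n // -lt0n.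
have {}ab : da = db by apply: (ieexprIn (lt_trans ltr01 t1) _ ab); rewrite gt_eqF.
by move: ab; rewrite /da /db => /(congr1 Posz); rewrite !PoszD em em' => /eqP; lia.
Qed.

End DegreeUniq.

(** * Lifting homogeneous fractions to the Segre product *)

(** By Zorn, a maximal subspace avoiding [v] is a hyperplane; the functional is the coordinate along
    [v]. *)
Lemma linear_functional (F : fieldType) (V : lmodType F) (v : V) : v != 0 ->
  exists l : V -> F, (forall a x y, l (a *: x + y) = a * l x + l y) /\ l v = 1.
Proof.
move=> v0.
pose Q (W : classical_sets.set V) := ~ W v /\ forall a x y, W x -> W y -> W (a *: x + y).
have [|W [[Wv Wlin] Wmax]] := @classical_sets.Zorn_bigcup V Q.
  move=> G GQ tot; split.
    by case=> U GU Uv; case: (GQ U GU).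
  move=> a x y [U1 G1 x1] [U2 G2 y2].
  case: (tot _ _ G1 G2) => sub.
    by exists U2 => //; case: (GQ _ G2) => _; apply => //; exact: sub.
  by exists U1 => //; case: (GQ _ G1) => _; apply => //; exact: sub.
(* The empty set also satisfies [Q], so maximality is needed to get 0 into [W]. *)
have W0 : W 0.
  apply: contrapT => n0.
  have We x : ~ W x.
    by move=> Wx; apply: n0; have := Wlin (-1) _ _ Wx Wx; rewrite scaleN1r addNr.
  apply: (Wmax (fun x : V => x = 0)); first by split=> [x /We//|/(_ 0 erefl)].
  split=> /= [e|a x y -> ->]; first by rewrite -e eqxx in v0.
  by rewrite scaler0 addr0.
have Wd x y : W x -> W y -> W (x + y) by move=> hx hy; have := Wlin 1 _ _ hx hy; rewrite scale1r.
have Wz a x : W x -> W (a *: x) by move=> hx; have := Wlin a _ _ hx W0; rewrite addr0.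
have ex x : exists a, W (x - a *: v).
  apply: contrapT => nx.
  pose W' : classical_sets.set V := fun y => exists b w, W w /\ y = w + b *: x.
  have WW' w : W w -> W' w by move=> hw; exists 0, w; rewrite scale0r addr0.
  apply: (Wmax W').
    split=> [w /WW'//|sub]; apply: nx; exists 0; rewrite scale0r subr0; apply: sub.
    by exists 1, 0; rewrite scale1r add0r.
  split.
    case=> b [w [hw e]]; have [b0|b0] := eqVneq b 0.
      by apply: Wv; rewrite e b0 scale0r addr0.
    apply: nx; exists b^-1.
    have -> : x - b^-1 *: v = (- b^-1) *: w.
      by rewrite e scalerDr scalerA mulVf // scale1r scaleNr opprD addrCA subrr addr0.
    exact: Wz.
  move=> a y z [b [w [hw ->]]] [c [w' [hw' ->]]].
  exists (a * b + c), (a *: w + w'); split; first exact: Wlin.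
  by rewrite scalerDr scalerA scalerDl addrACA.
have uniq x a b : W (x - a *: v) -> W (x - b *: v) -> a = b.
  move=> ha hb; apply/eqP; apply: contrapT => /negP ab; apply: Wv.
  have ab0 : a - b != 0 by rewrite subr_eq0.
  have := Wz (a - b)^-1 _ (Wlin (-1) _ _ ha hb).
  rewrite scaleN1r opprB addrA subrK -scalerBl scalerA mulVf // scale1r; exact.
pose l x := projT1 (cid (ex x)).
have lP x : W (x - l x *: v) := projT2 (cid (ex x)).
exists l; split=> [a x y|].
  apply: (uniq (a *: x + y)); first exact: lP.
  have -> : a *: x + y - (a * l x + l y) *: v = a *: (x - l x *: v) + (y - l y *: v).
    by rewrite scalerBr scalerDl opprD addrACA scalerA.
  by apply: Wlin; exact: lP.
by apply: (uniq v); [exact: lP|rewrite scale1r subrr].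
Qed.

Section Tensor.
Variables (F : fieldType) (c : nat) (A : 'I_c -> comAlgType F) (T : comAlgType F).
Variable tens : (forall j, A j) -> T.
Hypothesis tP : is_tensor_product tens.

(** Choose functionals with value 1 at each [s j]; their product factors through the tensor product
    and is 1 at [tens s]. *)
Lemma tens_neq0 (s : forall j, A j) : (forall j, s j != 0) -> tens s != 0.
Proof.
move=> s0; have lam j := cid (linear_functional (s0 j)).
pose l j : A j -> F := projT1 (lam j).
have llin j a (x y : A j) : l j (a *: x + y) = a * l j x + l j y := (projT2 (lam j)).1 a x y.
have l1 j : l j (s j) = 1 := (projT2 (lam j)).2.
pose phi (r : forall j, A j) : F^o := \prod_j l j (r j).
have phiE r i (x : A i) : phi (dfwith r x) = l i x * \prod_(j | j != i) l j (r j).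
  rewrite /phi (bigD1 i) //= dfwith_in; congr (_ * _).
  by apply: eq_bigr => j ji; rewrite dfwith_out // eq_sym.
have [r i a x y|f [[flin fphi] _]] := tens_univ tP (V := F^o) (phi := phi).
  by rewrite !phiE llin mulrDl -mulrA.
apply/eqP => t0; have := fphi s; rewrite t0.
have f0 : f 0 = 0.
  by have := flin 1 0 0; rewrite !scale1r addr0 => /eqP; rewrite -subr_eq0 opprD addNKr oppr_eq0 => /eqP.
rewrite f0 /phi big1 => [/esym/eqP|j _]; last exact: l1.
by rewrite oner_eq0.
Qed.

Lemma tens_dfwith0 (r : forall j, A j) i : tens (dfwith r (0 : A i)) = 0.
Proof.
have := @tens_linear _ _ _ _ _ tP r i 1 0 0; rewrite !scale1r addr0 => /eqP.
by rewrite -subr_eq0 opprD addNKr oppr_eq0 => /eqP.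
Qed.

Lemma tens_dfwithD (r : forall j, A j) i (x y : A i) :
  tens (dfwith r (x + y)) = tens (dfwith r x) + tens (dfwith r y).
Proof. by have := @tens_linear _ _ _ _ _ tP r i 1 x y; rewrite !scale1r. Qed.

Lemma tens_eq0 (r : forall j, A j) i : r i = 0 -> tens r = 0.
Proof.
move=> ri; rewrite -(tens_dfwith0 r i); congr tens.
by apply: functional_extensionality_dep => j; case: dfwithP.
Qed.

End Tensor.

Section HomFrac.
Variables (F : fieldType) (n : nat) (N : {set {set 'I_n}}) (S : {set 'I_n}).
Variable A : positroid_ring F N S.
Implicit Types (d : int) (z : pr_field A).

(** Denominators of degree 0 lose nothing, since there are units of every degree, and they let the
    denominators of all blocks be tensored together. *)
Definition homfrac d z : Prop := exists r s : A,
  [/\ has_degree d r, has_degree 0 s, s != 0 & z * pr_frac A s = pr_frac A r].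

Lemma pr_frac_neq0 (r : A) : (pr_frac A r != 0) = (r != 0).
Proof.
congr (~~ _); apply/eqP/eqP => [h|->]; last exact: rmorph0.
by apply: (@pr_frac_inj _ _ _ _ A); rewrite rmorph0.
Qed.

Lemma pr_mulf_neq0 (r s : A) : r != 0 -> s != 0 -> r * s != 0.
Proof. by rewrite -!pr_frac_neq0 rmorphM => h1 h2; rewrite mulf_neq0. Qed.

Lemma degree_unit d : S != set0 ->
  exists p q : A, [/\ has_degree d p, has_degree (- d) q & p * q = 1].
Proof.
case/set0Pn => a aS; have [u hu _] := Delta_neck_unit A aS.
have du := degree_Delta A (necklace N a); have du' := degree_inv aS hu.
have nat_case m : exists p q : A, [/\ has_degree m%:Z p, has_degree (- m%:Z) q & p * q = 1].
  elim: m => [|m [p [q [hp hq pq]]]].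
    by exists 1, 1; rewrite oppr0 mulr1; split=> //; exact: degree1.
  exists (p * Delta A (necklace N a)), (q * u); split.
  - by rewrite -addn1 PoszD; exact: degree_mul.
  - by rewrite -addn1 PoszD opprD; exact: degree_mul.
  - by rewrite mulrACA pq hu mulr1.
case: d => m; first exact: nat_case.
have [p [q [hp hq pq]]] := nat_case m.+1.
by exists q, p; rewrite NegzE opprK mulrC.
Qed.

Lemma unit_neq0 (p q : A) : p * q = 1 -> p != 0.
Proof. by move=> pq; apply: contra_eq_neq pq => ->; rewrite mul0r eq_sym oner_neq0. Qed.

Lemma homfrac_mul d d' z z' : homfrac d z -> homfrac d' z' -> homfrac (d + d') (z * z').
Proof.
move=> [r [s [hr hs s0 e]]] [r' [s' [hr' hs' s0' e']]].
exists (r * r'), (s * s'); split.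
- exact: degree_mul.
- by rewrite -[0]addr0; exact: degree_mul.
- exact: pr_mulf_neq0.
- by rewrite !rmorphM mulrACA e e'.
Qed.

Lemma homfrac_deg d (r : A) : has_degree d r -> homfrac d (pr_frac A r).
Proof.
by move=> hr; exists r, 1; split=> //; [exact: degree1|exact: oner_neq0|rewrite rmorph1 mulr1].
Qed.

Lemma homfrac1 : homfrac 0 (1 : pr_field A).
Proof. by rewrite -(rmorph1 (pr_frac A)); apply: homfrac_deg; exact: degree1. Qed.

Lemma homfrac_inv d z : S != set0 -> homfrac d z -> homfrac (- d) z^-1.
Proof.
move=> S0 [r [s [hr hs s0 e]]]; have [->|z0] := eqVneq z 0.
  by rewrite invr0 -(rmorph0 (pr_frac A)); apply: homfrac_deg; exact: degree0.
have [p [q [hp hq pq]]] := degree_unit d S0.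
have r0 : r != 0 by rewrite -pr_frac_neq0 -e mulf_neq0 // pr_frac_neq0.
(* The unit [q] of degree [- d] brings the new denominator back to degree 0. *)
exists (s * q), (r * q); split.
- by rewrite -[- d]add0r; exact: degree_mul.
- by rewrite -(addrN d); exact: degree_mul.
- by apply: pr_mulf_neq0 => //; apply: (@unit_neq0 _ p); rewrite mulrC.
- by rewrite !rmorphM -e; field.
Qed.

Lemma homfrac_exp d z m : homfrac d z -> homfrac (d * m%:Z) (z ^+ m).
Proof.
move=> hz; elim: m => [|m IH]; first by rewrite mulr0 expr0; exact: homfrac1.
by rewrite exprS intS mulrDr mulr1; exact: homfrac_mul.
Qed.

Lemma homfrac_expz d z (m : int) : S != set0 -> homfrac d z -> homfrac (d * m) (z ^ m).
Proof.
move=> S0 hz; case: m => m; first exact: homfrac_exp.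
rewrite NegzE mulrN -invr_expz; apply: homfrac_inv => //; exact: homfrac_exp.
Qed.

Lemma homfrac_prod (I : finType) (d : I -> int) (z : I -> pr_field A) :
  (forall i, homfrac (d i) (z i)) -> homfrac (\sum_i d i) (\prod_i z i).
Proof.
move=> hz; elim/big_rec2: _ => [|i x y _ h]; first exact: homfrac1.
exact: homfrac_mul.
Qed.

End HomFrac.

Lemma homfrac_uniq (F : numFieldType) n (N : {set {set 'I_n}}) (S : {set 'I_n})
    (A : positroid_ring F N S) d d' (z : pr_field A) :
  (0 < mrank N)%N -> homfrac d z -> homfrac d' z -> z != 0 -> d = d'.
Proof.
move=> rk [r [s [hr hs s0 e]]] [r' [s' [hr' hs' s0' e']]] z0.
have eq_rs : r * s' = r' * s.
  apply: (@pr_frac_inj _ _ _ _ A); rewrite !rmorphM -e -e'; ring.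
have h := degree_mul hr hs'; have h' := degree_mul hr' hs.
rewrite eq_rs addr0 in h; rewrite addr0 in h'.
apply: (degree_uniq rk h h').
by rewrite pr_mulf_neq0 // -pr_frac_neq0 -e' mulf_neq0 // pr_frac_neq0.
Qed.

Section Lift.
Variables (F : fieldType) (n : nat) (M : {set {set 'I_n}}) (P : component_partition M).
Variables (A : positroid_ring F M setT)
  (A_ : forall j, positroid_ring F (restriction M (P j)) (P j)) (dl : segre_iso A A_).
Implicit Types (r s : forall j, A_ j) (z w : forall j, pr_field (A_ j)) (d : int).

Definition theta r : pr_field A := pr_frac A (delinv dl (tens dl r)).

(** [delinv] is controlled only on the image of [del]; a tensor of elements of one common degree
    lies there by [del_graded]. *)
Lemma delinv_tens d r : (forall j, has_degree d (r j)) ->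
  exists a : A, del dl a = tens dl r /\ delinv dl (tens dl r) = a.
Proof.
move=> hr; have /(@del_graded _ _ _ _ _ _ dl)[a [_ ea]] : segre_part (tens dl) d (tens dl r).
  by exists 1%N, (fun=> r); split=> //; rewrite big_ord1.
by exists a; split=> //; rewrite -ea delK.
Qed.

Lemma theta_mul d d' r r' : (forall j, has_degree d (r j)) -> (forall j, has_degree d' (r' j)) ->
  theta (fun j => r j * r' j) = theta r * theta r'.
Proof.
move=> /delinv_tens[a [ea e]] /delinv_tens[a' [ea' e']].
rewrite /theta e e' -rmorphM; congr (pr_frac A _).
by rewrite (tens_mul (tensP dl)) -ea -ea' -rmorphM delK.
Qed.

Lemma theta1 : theta (fun=> 1) = 1.
Proof.
by rewrite /theta (tens_one (tensP dl)) -(rmorph1 (del dl)) delK rmorph1.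
Qed.

Lemma theta_neq0 d r : (forall j, has_degree d (r j)) -> (forall j, r j != 0) -> theta r != 0.
Proof.
move=> /delinv_tens[a [ea e]] r0; rewrite /theta e pr_frac_neq0.
apply: contra_eq_neq ea => ->; rewrite rmorph0 eq_sym.
exact: (tens_neq0 (tensP dl)).
Qed.

Lemma theta_eq0 r i : r i = 0 -> theta r = 0.
Proof.
move=> ri; rewrite /theta (tens_eq0 (tensP dl) ri) -(rmorph0 (del dl)) delK.
exact: rmorph0.
Qed.

Lemma theta_dfwithD d r i (x y : A_ i) : (forall j, j != i -> has_degree d (r j)) ->
  has_degree d x -> has_degree d y ->
  theta (dfwith r (x + y)) = theta (dfwith r x) + theta (dfwith r y).
Proof.
move=> hr hx hy.
have hd (u : A_ i) : has_degree d u -> forall j, has_degree d (dfwith r u j).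
  by move=> hu j; case: dfwithP => // j' ij; apply: hr; rewrite eq_sym.
have [a [ea e]] := delinv_tens (hd _ hx); have [b [eb e']] := delinv_tens (hd _ hy).
rewrite /theta e e' -rmorphD; congr (pr_frac A _).
by rewrite (tens_dfwithD (tensP dl)) -ea -eb -rmorphD delK.
Qed.

(* Z is the image in Frac(R_pi) of the tensor product of the homogeneous
   fractions z_j, all of the same degree d. *)
Definition lift d z (Z : pr_field A) : Prop := exists r s,
  [/\ forall j, has_degree d (r j), forall j, has_degree 0 (s j), forall j, s j != 0,
      forall j, z j * pr_frac (A_ j) (s j) = pr_frac (A_ j) (r j)
    & Z * theta s = theta r].

Lemma theta_ext r r' : (forall j, r j = r' j) -> theta r = theta r'.
Proof. by move=> e; congr theta; apply: functional_extensionality_dep. Qed.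

Lemma lift_ext d z z' Z : (forall j, z j = z' j) -> lift d z Z -> lift d z' Z.
Proof.
by move=> e [r [s [h1 h2 h3 h4 h5]]]; exists r, s; split=> // j; rewrite -e.
Qed.

Lemma lift_fun d z Z Z' : lift d z Z -> lift d z Z' -> Z = Z'.
Proof.
move=> [r [s [hr hs s0 e E]]] [r' [s' [hr' hs' s0' e' E']]].
have eq_rs j : r j * s' j = r' j * s j.
  by apply: (@pr_frac_inj _ _ _ _ (A_ j)); rewrite !rmorphM -e -e'; ring.
have := theta_ext eq_rs; rewrite (theta_mul hr hs') (theta_mul hr' hs) -E -E'.
have t0 := theta_neq0 hs s0; have t0' := theta_neq0 hs' s0'.
by rewrite mulrAC => /(mulIf t0)/(mulIf t0').
Qed.

Lemma lift_exists d z : (forall j, homfrac d (z j)) -> exists Z, lift d z Z.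
Proof.
move=> h; pose r j := projT1 (cid (h j)); have hr j := projT2 (cid (h j)).
pose s j := projT1 (cid (hr j)).
have hs j : [/\ has_degree d (r j), has_degree 0 (s j), s j != 0
     & z j * pr_frac (A_ j) (s j) = pr_frac (A_ j) (r j)] := projT2 (cid (hr j)).
have s0 : theta s != 0 by apply: (@theta_neq0 0) => j; case: (hs j).
by exists (theta r / theta s), r, s; split; rewrite ?divfK // => j; case: (hs j).
Qed.

Lemma lift_homfrac d z Z j : lift d z Z -> homfrac d (z j).
Proof. by move=> [r [s [hr hs s0 e E]]]; exists (r j), (s j). Qed.

Lemma lift1 : lift 0 (fun=> 1) 1.
Proof.
exists (fun=> 1), (fun=> 1); split=> *; rewrite ?mulr1 ?mul1r ?rmorph1 ?theta1 ?oner_neq0 //.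
all: exact: degree1.
Qed.

Lemma lift_mul d d' z z' Z Z' : lift d z Z -> lift d' z' Z' ->
  lift (d + d') (fun j => z j * z' j) (Z * Z').
Proof.
move=> [r [s [hr hs s0 e E]]] [r' [s' [hr' hs' s0' e' E']]].
exists (fun j => r j * r' j), (fun j => s j * s' j); split=> [j|j|j|j|].
- exact: degree_mul.
- by rewrite -[0]addr0; exact: degree_mul.
- exact: pr_mulf_neq0.
- by rewrite !rmorphM mulrACA e e'.
- by rewrite (theta_mul hr hr') (theta_mul hs hs') mulrACA E E'.
Qed.

Lemma lift_inv d z Z : lift d z Z -> lift (- d) (fun j => (z j)^-1) Z^-1.
Proof.
move=> L; have [r [s [hr hs s0 e E]]] := L.
have [Z' L'] : exists Z', lift (- d) (fun j => (z j)^-1) Z'.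
  by apply: lift_exists => j; apply: homfrac_inv (lift_homfrac j L); exact: block_neq0.
suff -> : Z^-1 = Z' by [].
have st0 := theta_neq0 hs s0.
(* If some component is 0, both lifts vanish, in accordance with the convention that the inverse of
   0 is 0. *)
case: (pselect (exists j, z j = 0)) => [[j zj]|nz].
  have -> : Z = 0.
    apply: (mulIf st0); rewrite mul0r E; apply: (@theta_eq0 _ j).
    by apply: (@pr_frac_inj _ _ _ _ (A_ j)); rewrite rmorph0 -e zj mul0r.
  have [r' [s' [hr' hs' s0' e' E']]] := L'.
  rewrite invr0; apply: (mulIf (theta_neq0 hs' s0')).
  rewrite mul0r E'; apply/esym/(@theta_eq0 _ j).
  by apply: (@pr_frac_inj _ _ _ _ (A_ j)); rewrite rmorph0 -e' zj invr0 mul0r.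
have zz j : z j != 0 by apply/eqP => zj; apply: nz; exists j.
have := lift_mul L L'; rewrite addrN => L1.
have /(lift_fun lift1) h : lift 0 (fun=> 1) (Z * Z').
  by apply: lift_ext L1 => j; rewrite divff.
have Z0 : Z != 0 by apply: contra_eq_neq h => ->; rewrite mul0r oner_neq0.
by apply: (mulfI Z0); rewrite divff.
Qed.

Lemma lift_exp d z Z m : lift d z Z -> lift (d * m%:Z) (fun j => z j ^+ m) (Z ^+ m).
Proof.
move=> L; elim: m => [|m IH]; first by rewrite mulr0; exact: lift1.
rewrite exprS intS mulrDr mulr1; apply: lift_ext (lift_mul L IH) => j.
by rewrite exprS.
Qed.

Lemma lift_expz d z Z (m : int) : lift d z Z -> lift (d * m) (fun j => z j ^ m) (Z ^ m).
Proof.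
move=> L; case: m => m; first exact: lift_exp.
rewrite NegzE mulrN -invr_expz; apply: lift_ext (lift_inv (lift_exp m.+1 L)) => j.
by rewrite -invr_expz.
Qed.

Lemma lift_prod (I : finType) (p : pred I) (d : I -> int) (z : I -> forall j, pr_field (A_ j))
    (Z : I -> pr_field A) : (forall i, p i -> lift (d i) (z i) (Z i)) ->
  lift (\sum_(i | p i) d i) (fun j => \prod_(i | p i) z i j) (\prod_(i | p i) Z i).
Proof.
move=> L; rewrite -!(big_filter (index_enum I)).
have -> : (fun j => \prod_(i <- index_enum I | p i) z i j) =
          (fun j => \prod_(i <- [seq i <- index_enum I | p i]) z i j).
  by apply: functional_extensionality_dep => j; rewrite big_filter.
have : all p [seq i <- index_enum I | p i] by exact: filter_all.
elim: [seq i <- _ | _] => [|i s IH] /=.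
  rewrite !big_nil => _; apply: lift_ext lift1 => j.
  by rewrite big_nil.
case/andP=> pi ps; rewrite !big_cons; apply: lift_ext (lift_mul (L i pi) (IH ps)) => j.
by rewrite big_cons.
Qed.

(** Over the common denominator [s * s'] the two numerators agree off [i], so additivity of [theta]
    in the component [i] applies. *)
Lemma lift_dfwithD d w i (x y : pr_field (A_ i)) X Y :
  lift d (dfwith w x) X -> lift d (dfwith w y) Y -> lift d (dfwith w (x + y)) (X + Y).
Proof.
move=> [r [s [hr hs s0 e E]]] [r' [s' [hr' hs' s0' e' E']]].
pose u j := r j * s' j.
have hu j : has_degree d (u j) by rewrite -[d]addr0; exact: degree_mul.
have hu' j : has_degree d (r' j * s j) by rewrite -[d]addr0; exact: degree_mul.
have eu j : j != i -> u j = r' j * s j.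
  move=> ji; apply: (@pr_frac_inj _ _ _ _ (A_ j)); rewrite !rmorphM -e -e'.
  by rewrite !dfwith_out 1?eq_sym //; ring.
exists (dfwith u (u i + r' i * s i)), (fun j => s j * s' j); split=> [j|j|j|j|].
- by case: dfwithP => // ; exact: degree_add.
- by rewrite -[0]addr0; exact: degree_mul.
- exact: pr_mulf_neq0.
- case: (eqVneq i j) => [<-|ij].
    rewrite !dfwith_in rmorphD !rmorphM -e -e' !dfwith_in; ring.
  by rewrite !dfwith_out // !rmorphM -e !dfwith_out //; ring.
rewrite (theta_mul hs hs') (theta_dfwithD (d := d)) //.
rewrite (@theta_ext (dfwith u (u i)) u); last by move=> j; case: dfwithP.
rewrite (@theta_ext (dfwith u (r' i * s i)) (fun j => r' j * s j)); last first.
  by move=> j; case: dfwithP => // j' ij; apply: eu; rewrite eq_sym.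
rewrite (theta_mul hr hs') (theta_mul hr' hs) -E -E'; ring.
Qed.

Lemma lift_theta r : (forall j, has_degree 1 (r j)) ->
  lift 1 (fun j => pr_frac (A_ j) (r j)) (theta r).
Proof.
move=> hr; exists r, (fun=> 1); split=> *; rewrite ?theta1 ?mulr1 ?rmorph1 ?mulr1 ?oner_neq0 //.
exact: degree1.
Qed.

End Lift.

(** * Homogeneous seeds *)

Lemma pos_partB (z : int) : (pos_part z)%:Z - (pos_part (- z))%:Z = z.
Proof. by rewrite /pos_part; clear; case: ifP; case: ifP; lia. Qed.

Lemma pos_part0 : pos_part 0 = 0%N.
Proof. by rewrite /pos_part lexx. Qed.

Section Mutation.
Variable K : fieldType.
Implicit Types s : seed K.

Definition skew s : Prop := forall k l : mut s, xmat (inl k) l = - xmat (inl l) k.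

Lemma skew_diag s (k : mut s) : skew s -> xmat (inl k) k = 0.
Proof. by move=> /(_ k k); lia. Qed.

Lemma xmat_mutate s (k i : mut s) (v : mut s + froz s) :
  @xmat _ (mutate k) v i = if (v == inl k) || (i == k) then - xmat v i
      else xmat v i + (pos_part (xmat v k) * pos_part (xmat (inl k) i))%N%:Z
                    - (pos_part (- xmat v k) * pos_part (- xmat (inl k) i))%N%:Z.
Proof. by []. Qed.

Lemma skew_mutate s (k : mut s) : skew s -> skew (mutate k).
Proof.
move=> sk i l; rewrite !xmat_mutate.
have E (a b : mut s) : (inl a == inl b :> mut s + froz s) = (a == b) by [].
rewrite !E orbC; case: ifP => _; first by rewrite sk.
rewrite (sk i l) (sk l k) (sk i k) !opprK !PoszM; ring.
Qed.

(* Frozen variables stay Plücker coordinates, of degree 1, in every seed. *)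
Definition seed_degree s (d : mut s -> int) (v : mut s + froz s) : int :=
  if v is inl k then d k else 1.

(** Homogeneity of the exchange relations, equivalently degree 0 for every [yhat k]. *)
Definition balanced s (d : mut s -> int) : Prop :=
  forall k : mut s, \sum_(v : mut s + froz s) seed_degree d v * xmat v k = 0.

Definition pos_degree s (d : mut s -> int) (k : mut s) : int :=
  \sum_(v : mut s + froz s) seed_degree d v * (pos_part (xmat v k))%:Z.

Definition mutate_degree s (d : mut s -> int) (k i : mut s) : int :=
  if i == k then pos_degree d k - d k else d i.

Lemma neg_degree s (d : mut s -> int) (k : mut s) : balanced d ->
  \sum_(v : mut s + froz s) seed_degree d v * (pos_part (- xmat v k))%:Z = pos_degree d k.
Proof.
move=> /(_ k) h; apply/eqP; rewrite eq_sym -subr_eq0 /pos_degree -sumrB -[X in _ == X]h.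
by apply/eqP; apply: eq_bigr => v _; rewrite -mulrBr pos_partB.
Qed.

(** With p the exchange degree and u the entry [xmat (inl k) i], the column sum at [i] changes by 2
    (d k) u - p u from the vertex [k] and by p u - 2 (d k) u + (d i) 0 in total from the rest, after
    the old contribution of [k] is removed; the case [i = k] only changes signs. *)
Lemma balanced_mutate s (d : mut s -> int) (k : mut s) : skew s -> balanced d ->
  @balanced (mutate k) (mutate_degree d k).
Proof.
move=> sk bal i; pose G v := @seed_degree (mutate k) (mutate_degree d k) v.
have Gk : G (inl k) = pos_degree d k - d k by rewrite /G /= /mutate_degree eqxx.
have Go v : v != inl k -> G v = seed_degree d v.
  case: v => [l|//] h; rewrite /G /= /mutate_degree.
  by have /negbTE -> : l != k by apply: contra h => /eqP ->.
have diag : xmat (inl k) k = 0 := skew_diag k sk.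
rewrite -[LHS]/(\sum_(v : mut s + froz s) G v * @xmat _ (mutate k) v i).
rewrite (bigD1 (inl k : mut s + froz s)) // Gk xmat_mutate eqxx /=.
rewrite (eq_bigr (fun v => seed_degree d v * (@xmat _ (mutate k) v i))); last first.
  by move=> v vk; rewrite Go.
case: (eqVneq i k) => [->|ik].
  rewrite diag mulrN mulr0 oppr0 add0r.
  rewrite (eq_bigr (fun v => - (seed_degree d v * xmat v k))); last first.
    by move=> v vk; rewrite xmat_mutate eqxx orbT mulrN.
  rewrite sumrN; apply/eqP; rewrite oppr_eq0; apply/eqP; rewrite -[RHS](bal k).
  by rewrite [RHS](bigD1 (inl k : mut s + froz s)) //= diag mulr0 add0r.
rewrite (eq_bigr (fun v => seed_degree d v * xmat v i
   + (seed_degree d v * (pos_part (xmat v k))%:Z * (pos_part (xmat (inl k) i))%:Z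
   - seed_degree d v * (pos_part (- xmat v k))%:Z * (pos_part (- xmat (inl k) i))%:Z))); last first.
  by move=> v vk; rewrite xmat_mutate (negbTE vk) (negbTE ik) /= !PoszM; ring.
rewrite big_split sumrB /= -!mulr_suml.
have h1 : \sum_(v | v != inl k :> mut s + froz s) seed_degree d v * xmat v i
    = - (d k * xmat (inl k) i).
  by have := bal i; rewrite (bigD1 (inl k : mut s + froz s)) //= => /eqP; rewrite addrC addr_eq0 => /eqP.
have h2 : \sum_(v | v != inl k :> mut s + froz s) seed_degree d v * (pos_part (xmat v k))%:Z
    = pos_degree d k.
  by rewrite /pos_degree [RHS](bigD1 (inl k : mut s + froz s)) //= diag pos_part0 mulr0 add0r.
have h3 : \sum_(v | v != inl k :> mut s + froz s) seed_degree d v * (pos_part (- xmat v k))%:Z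
    = pos_degree d k.
  rewrite -(neg_degree k bal) [RHS](bigD1 (inl k : mut s + froz s)) //= diag oppr0 pos_part0.
  by rewrite mulr0 add0r.
rewrite h1 h2 h3; have := pos_partB (xmat (inl k) i).
set u := xmat _ _; set p := pos_degree _ _; move: (pos_part u)%:Z (pos_part (- u))%:Z => x y <-.
by ring.
Qed.

Lemma reachable_froz s s' : reachable s s' -> forall z, coef_group s z <-> coef_group s' z.
Proof. by elim=> // s1 k _ IH z; rewrite IH. Qed.

Lemma reachable_trans s1 s2 s3 : reachable s1 s2 -> reachable s2 s3 -> reachable s1 s3.
Proof. by move=> h; elim=> // s4 k _ IH; exact: reachable_step. Qed.

End Mutation.

(** * Embedded seeds *)

Lemma prod_inj (K : fieldType) (I J : finType) (h : I -> J) (G : J -> K) :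
  injective h -> (forall j, (forall i, h i != j) -> G j = 1) ->
  \prod_j G j = \prod_i G (h i).
Proof.
move=> hI G1; rewrite (bigID (fun j => j \in h @: setT)) /= [X in _ * X]big1 ?mulr1.
  rewrite big_imset /=; last by move=> x y _ _; exact: hI.
  by apply: eq_bigl => i; rewrite inE.
move=> j hj; apply: G1 => i; apply: contra hj => /eqP <-; exact: imset_f.
Qed.

Section Slot.
Variables (F : fieldType) (n : nat) (M : {set {set 'I_n}}) (P : component_partition M).
Variables (A : positroid_ring F M setT)
  (A_ : forall j, positroid_ring F (restriction M (P j)) (P j)) (dl : segre_iso A A_).
Variables (j : 'I_(blocks P)) (w : forall i, pr_field (A_ i)).
Hypothesis w_neq0 : forall i, w i != 0.
Implicit Types (x : pr_field (A_ j)) (X : pr_field A) (d : int).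

(* The image of a homogeneous fraction of degree d of R_j, padded by the
   d-th powers of the fixed elements w_i of the other rings. *)
Definition slot d x X : Prop := lift dl d (dfwith (fun i => w i ^ d) x) X.

Lemma dfwith_mul (u v : forall i, pr_field (A_ i)) x y i :
  dfwith u x i * dfwith v y i = dfwith (fun i => u i * v i) (x * y) i.
Proof.
by case: (eqVneq j i) => [<-|ji]; rewrite ?dfwith_in ?dfwith_out.
Qed.

Lemma slot_mul d d' x y X Y : slot d x X -> slot d' y Y -> slot (d + d') (x * y) (X * Y).
Proof.
move=> h h'; apply: lift_ext (lift_mul h h') => i; rewrite dfwith_mul.
by case: (eqVneq j i) => [<-|ji]; rewrite ?dfwith_in ?dfwith_out // expfzDr.
Qed.

Lemma slot1 : slot 0 1 1.
Proof.
apply: lift_ext (lift1 dl) => i.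
by case: (eqVneq j i) => [<-|ji]; rewrite ?dfwith_in ?dfwith_out // expr0z.
Qed.

Lemma slot_expz d x X (m : int) : slot d x X -> slot (d * m) (x ^ m) (X ^ m).
Proof.
move=> h; apply: lift_ext (lift_expz m h) => i.
by case: (eqVneq j i) => [<-|ji]; rewrite ?dfwith_in ?dfwith_out // exprz_exp.
Qed.

Lemma slot_inv d x X : slot d x X -> slot (- d) x^-1 X^-1.
Proof. by move/(slot_expz (- 1)); rewrite mulrN1 -!exprN1. Qed.

Lemma slot_add d x y X Y : slot d x X -> slot d y Y -> slot d (x + y) (X + Y).
Proof. exact: lift_dfwithD. Qed.

Lemma slot_prod (I : finType) (d : I -> int) (x : I -> pr_field (A_ j)) (X : I -> pr_field A) :
  (forall i, slot (d i) (x i) (X i)) -> slot (\sum_i d i) (\prod_i x i) (\prod_i X i).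
Proof.
move=> h; elim/big_rec3: _ => [|i a b c _ IH]; first exact: slot1.
exact: slot_mul.
Qed.

Definition emb (s : seed (pr_field (A_ j))) (t : seed (pr_field A))
    (phi : mut s -> mut t) (gam : froz s -> froz t) (v : mut s + froz s) : mut t + froz t :=
  match v with inl k => inl (phi k) | inr f => inr (gam f) end.

(** By [emb_xmat0], the columns of [t] at the image of [phi] are supported on the image of [emb]; so
    the exchange relations there involve only images of variables of [s]. *)
Record embedding (s : seed (pr_field (A_ j))) (t : seed (pr_field A))
    (phi : mut s -> mut t) (gam : froz s -> froz t) (d : mut s -> int) : Prop := Embedding {
  emb_phi : injective phi;
  emb_gam : injective gam;
  emb_skew : skew s;
  emb_bal : balanced d;
  emb_var : forall v, slot (seed_degree d v) (xvar v) (xvar (emb phi gam v));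
  emb_xmat : forall v k, xmat (emb phi gam v) (phi k) = xmat v k;
  emb_xmat0 : forall u k, (forall v, emb phi gam v != u) -> xmat u (phi k) = 0 }.

Variables (s : seed (pr_field (A_ j))) (t : seed (pr_field A)).
Variables (phi : mut s -> mut t) (gam : froz s -> froz t) (d : mut s -> int).
Hypothesis E : embedding phi gam d.

Lemma emb_inj : injective (emb phi gam).
Proof.
move=> [k|f] [k'|f'] //= [] h; first by rewrite (emb_phi E h).
by rewrite (emb_gam E h).
Qed.

(** The function [e] is the identity for [yhat], and a positive part for each of the two exchange
    monomials. *)
Lemma emb_prod k (e : int -> int) : e 0 = 0 ->
  slot (\sum_(v : mut s + froz s) seed_degree d v * e (xmat v k))
    (\prod_(v : mut s + froz s) xvar v ^ e (xmat v k))
    (\prod_(u : mut t + froz t) xvar u ^ e (xmat u (phi k))).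
Proof.
move=> e0; rewrite (prod_inj emb_inj); last first.
  by move=> u hu; rewrite (emb_xmat0 E) // e0 expr0z.
apply: slot_prod => v; rewrite (emb_xmat E); apply: slot_expz; exact: (emb_var E).
Qed.

Lemma embedding_yhat k : slot 0 (yhat k) (yhat (phi k)).
Proof.
rewrite -[X in slot X](emb_bal E k).
exact: (@emb_prod k id).
Qed.

Lemma embedding_mutate k :
  @embedding (mutate k) (mutate (phi k)) phi gam (mutate_degree d k).
Proof.
have [phiI gamI sk bal var xm xm0] := E.
have phiE a b : (phi a == phi b) = (a == b) by exact: inj_eq.
have EE (v : mut s + froz s) : (emb phi gam v == inl (phi k)) = (v == inl k).
  by case: v => [l|f] //=; exact: phiE.
split=> //.
- exact: skew_mutate.
- exact: balanced_mutate.
- case=> [l|f]; last exact: (var (inr f)).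
  rewrite /= /mutate_degree phiE; case: ifP => lk; last exact: (var (inl l)).
  apply: slot_mul; last exact: slot_inv (var (inl k)).
  apply: slot_add.
    exact: (@emb_prod k (fun z => (pos_part z)%:Z)).
  rewrite -(neg_degree k bal).
  by apply: (@emb_prod k (fun z => (pos_part (- z))%:Z)); rewrite oppr0 pos_part0.
- move=> v l; rewrite !xmat_mutate EE phiE.
  have xk : xmat (inl (phi k)) (phi l) = xmat (inl k) l := xm (inl k) l.
  by rewrite !xm xk.
- move=> u l hu; rewrite xmat_mutate; rewrite (xm0 u) // (xm0 u) //.
  by rewrite oppr0 pos_part0 !mul0n subr0 addr0; case: ifP.
Qed.

Lemma embedding_mutate_other kap : (forall k, phi k != kap) ->
  (forall k, xmat (inl kap) (phi k) = 0) ->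
  @embedding s (mutate kap) phi gam d.
Proof.
have [phiI gamI sk bal var xm xm0] := E.
move=> nk x0; split=> //.
- case=> [l|f]; last exact: (var (inr f)).
  by rewrite /= (negbTE (nk l)); exact: (var (inl l)).
- move=> v k; rewrite xmat_mutate (negbTE (nk k)) orbF.
  case: eqP => [e|_].
    by case: v e => [l|f] //= [e]; move: (nk l); rewrite e eqxx.
  by rewrite x0 oppr0 pos_part0 !muln0 subr0 addr0 xm.
- move=> u k hu; rewrite xmat_mutate x0 oppr0 pos_part0 !muln0 subr0 addr0 (xm0 u) //.
  by rewrite oppr0; case: ifP.
Qed.

End Slot.

Lemma necklace_groupM (F : fieldType) n N (S : {set 'I_n}) (A : positroid_ring F N S)
    (x y : pr_field A) : necklace_group x -> necklace_group y -> necklace_group (x * y).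
Proof.
move=> [e ->] [e' ->]; exists (fun a => e a + e' a); rewrite -big_split /=.
apply: eq_bigr => a aS; rewrite expfzDr //.
by have [] := Delta_neck_unit A aS.
Qed.

Lemma necklace_group_expz (F : fieldType) n N (S : {set 'I_n}) (A : positroid_ring F N S)
    (x : pr_field A) (m : int) : necklace_group x -> necklace_group (x ^ m).
Proof.
move=> [e ->]; exists (fun a => e a * m).
rewrite (big_morph (fun x => x ^ m) (fun x y => expfzMl x y _) (exp1rz _ _)).
by apply: eq_bigr => a aS; rewrite exprz_exp.
Qed.

Lemma necklace_group_neq0 (F : fieldType) n N (S : {set 'I_n}) (A : positroid_ring F N S)
    (x : pr_field A) : necklace_group x -> x != 0.
Proof.
move=> [e ->]; apply/prodf_neq0 => a aS; apply: expfz_neq0.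
by have [] := Delta_neck_unit A aS.
Qed.

Definition block_diagonal (K : fieldType) c (t : seed K) (col : mut t -> 'I_c) : Prop :=
  forall k l, col k != col l -> xmat (inl k) l = 0.

Lemma block_diagonal_mutate (K : fieldType) c (t : seed K) (col : mut t -> 'I_c) (k : mut t) :
  block_diagonal col -> @block_diagonal K c (mutate k) col.
Proof.
move=> bd l i li; rewrite xmat_mutate (bd l i li) oppr0.
case: ifP => // _; rewrite add0r.
have [lk|lk] := eqVneq (col l) (col k); last first.
  by rewrite (bd l k lk) oppr0 pos_part0 !mul0n subrr.
have ki : col k != col i by rewrite -lk.
by rewrite (bd k i ki) oppr0 pos_part0 !muln0 subrr.
Qed.

(** * Assembling the blocks *)

Section Patterns.
Variables (F : fieldType) (n : nat) (M : {set {set 'I_n}}) (P : component_partition M).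
Variables (A : positroid_ring F M setT)
  (A_ : forall j, positroid_ring F (restriction M (P j)) (P j)) (dl : segre_iso A A_).

Section OnePattern.
Variable w : forall j i : 'I_(blocks P), pr_field (A_ i).
Hypothesis w0 : forall j i, w j i != 0.

Definition embeds_at (t : seed (pr_field A)) (col : mut t -> 'I_(blocks P)) j
    (s : seed (pr_field (A_ j))) : Prop :=
  exists (phi : mut s -> mut t) (gam : froz s -> froz t) (d : mut s -> int),
    embedding dl (w j) phi gam d /\ forall kap, col kap = j <-> exists k, phi k = kap.

Lemma embeds_reach t (col : mut t -> 'I_(blocks P)) j (s s' : seed (pr_field (A_ j))) :
  block_diagonal col -> embeds_at col s -> reachable s s' ->
  exists t' (col' : mut t' -> 'I_(blocks P)),
    [/\ reachable t t', block_diagonal col', embeds_at col' s'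
      & forall i (u : seed (pr_field (A_ i))), i != j -> embeds_at col u -> embeds_at col' u].
Proof.
move=> bd es; elim=> [|s1 k _ [t1 [col1 [tr bd1 [phi [gam [d [E colE]]]] oth]]]].
  by exists t, col; split=> //; exact: reachable_refl.
exists (mutate (phi k)), col1; split.
- exact: reachable_step.
- exact: block_diagonal_mutate.
- exists phi, gam, (mutate_degree d k); split=> //.
  exact: embedding_mutate.
- move=> i u ij /(oth i u ij)[phi' [gam' [d' [E' colE']]]].
  have ck : col1 (phi k) = j by apply/colE; exists k.
  have cl l : col1 (phi' l) = i by apply/colE'; exists l.
  exists phi', gam', d'; split=> //; apply: embedding_mutate_other => // l.
    by apply/eqP => e; move: ij; rewrite -(cl l) e ck eqxx.
  by apply: bd1; rewrite ck cl eq_sym.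
Qed.

Lemma embeds_reach_all t (col : mut t -> 'I_(blocks P))
    (s s' : forall j, seed (pr_field (A_ j))) :
  block_diagonal col -> (forall j, embeds_at col (s j)) ->
  (forall j, reachable (s j) (s' j)) ->
  exists t' (col' : mut t' -> 'I_(blocks P)),
    reachable t t' /\ forall j, embeds_at col' (s' j).
Proof.
move=> bd es rs.
have [L [uL Lall]] : exists L : seq 'I_(blocks P), uniq L /\ forall j, j \in L.
  by exists (enum 'I_(blocks P)); split=> [|j]; rewrite ?enum_uniq ?mem_enum.
suff [t' [col' [tr _ eL _]]] : exists t' (col' : mut t' -> 'I_(blocks P)),
    [/\ reachable t t', block_diagonal col', forall j, j \in L -> embeds_at col' (s' j)
      & forall j, j \notin L -> embeds_at col' (s j)].
  by exists t', col'; split=> // j; exact: eL.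
elim: L uL {Lall} => [_|j L IH /= /andP[jL /IH]].
  by exists t, col; split=> //; exact: reachable_refl.
move=> [t1 [col1 [tr bd1 e1 e2]]].
have [t2 [col2 [tr2 bd2 e3 oth]]] := embeds_reach bd1 (e2 j jL) (rs j).
exists t2, col2; split=> //; first exact: reachable_trans tr2.
  move=> i; rewrite inE; case: (eqVneq i j) => [->//|ij /= iL]; exact: oth (e1 i iL).
by move=> i; rewrite inE negb_or => /andP[ij iL]; exact: oth (e2 i iL).
Qed.

End OnePattern.

Variables w w' : forall j i : 'I_(blocks P), pr_field (A_ i).
Hypothesis wN : forall j i, necklace_group (w j i).
Hypothesis wN' : forall j i, necklace_group (w' j i).

(** This describes coefficients without mentioning the diagrams, so it can be the common value for
    both amalgamations. *)
Definition balanced_group (Z : pr_field A) : Prop :=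
  exists d (m : forall j, pr_field (A_ j)), (forall j, necklace_group (m j)) /\ lift dl d m Z.

Lemma embeds_quasi_equivalent (t t' : seed (pr_field A)) (col : mut t -> 'I_(blocks P))
    (col' : mut t' -> 'I_(blocks P)) (s s' : forall j, seed (pr_field (A_ j))) :
  (forall Z, coef_group t Z <-> balanced_group Z) ->
  (forall Z, coef_group t' Z <-> balanced_group Z) ->
  (forall j z, coef_group (s j) z -> necklace_group z) ->
  (forall j, embeds_at w col (s j)) -> (forall j, embeds_at w' col' (s' j)) ->
  (forall j, quasi_equivalent (s j) (s' j)) -> quasi_equivalent t t'.
Proof.
move=> ct ct' cs es es' qe; split=> [Z|]; first by rewrite ct ct'.
pose phi j := projT1 (cid (es j)).
have phiP j : exists gam d, embedding dl (w j) (phi j) gam d /\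
  forall kap, col kap = j <-> exists k, phi j k = kap := projT2 (cid (es j)).
have colE j kap : col kap = j <-> exists k, phi j k = kap.
  by have [gam [d [_ h]]] := phiP j; exact: h.
pose phi' j := projT1 (cid (es' j)).
have phiP' j : exists gam d, embedding dl (w' j) (phi' j) gam d /\
  forall kap, col' kap = j <-> exists k, phi' j k = kap := projT2 (cid (es' j)).
have colE' j kap : col' kap = j <-> exists k, phi' j k = kap.
  by have [gam [d [_ h]]] := phiP' j; exact: h.
have phiI j : injective (phi j) by have [gam [d [[] ]]] := phiP j.
have phiI' j : injective (phi' j) by have [gam [d [[] ]]] := phiP' j.
have qs j : exists sg : mut (s j) -> mut (s' j), bijective sg /\ forall k,
    coef_group (s j) (mvar k / mvar (sg k)) /\ yhat k = yhat (sg k) := (qe j).2.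
pose sg j := projT1 (cid (qs j)).
have sgP j : bijective (sg j) /\ forall k,
    coef_group (s j) (mvar k / mvar (sg j k)) /\ yhat k = yhat (sg j k) := projT2 (cid (qs j)).
(* The mutable vertices of [t] are reached only through the images of the maps [phi j], so the
   matching is first a relation; [fn] and [inj] make it a bijection. *)
pose rl kap kap' := exists j k, phi j k = kap /\ phi' j (sg j k) = kap'.
have ex kap : exists kap', rl kap kap'.
  have [k hk] := (colE (col kap) kap).1 erefl.
  by exists (phi' _ (sg _ k)), (col kap), k.
have ex' kap' : exists kap, rl kap kap'.
  have [k hk] := (colE' (col' kap') kap').1 erefl.
  have [[g _ gK] _] := sgP (col' kap').
  by exists (phi _ (g k)), (col' kap'), (g k); rewrite gK.
have fn kap k1 k2 : rl kap k1 -> rl kap k2 -> k1 = k2.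
  move=> [j [k [h1 <-]]] [j' [k' [h2 <-]]].
  have e : j' = j.
    by rewrite -((colE j kap).2 (ex_intro _ k h1)) ((colE j' kap).2 (ex_intro _ k' h2)).
  subst j'; congr (phi' j (sg j _)); apply: (@phiI j); by rewrite h1 h2.
have inj kap' k1 k2 : rl k1 kap' -> rl k2 kap' -> k1 = k2.
  move=> [j [k [<- h1]]] [j' [k' [<- h2]]].
  have e : j' = j.
    by rewrite -((colE' j kap').2 (ex_intro _ _ h1)) ((colE' j' kap').2 (ex_intro _ _ h2)).
  subst j'; congr (phi j _); apply: (bij_inj (sgP j).1); apply: (@phiI' j); by rewrite h1 h2.
pose f kap := projT1 (cid (ex kap)); have fP kap : rl kap (f kap) := projT2 (cid (ex kap)).
pose g kap := projT1 (cid (ex' kap)); have gP kap : rl (g kap) kap := projT2 (cid (ex' kap)).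
exists f; split.
  exists g => kap; first exact: inj (gP _) (fP _).
  exact: fn (fP _) (gP _).
move=> kap; have [j [k [<- <-]]] := fP kap.
have [gam [d [E _]]] := phiP j; have [gam' [d' [E' _]]] := phiP' j.
have [cg yh] := (sgP j).2 k.
have wj0 i : w j i != 0 := necklace_group_neq0 (wN j i).
have wj0' i : w' j i != 0 := necklace_group_neq0 (wN' j i).
split; last first.
  (* In degree 0 both paddings are trivial, so the two lifts have the same components. *)
  have Y := embedding_yhat wj0 E k; have Y' := embedding_yhat wj0' E' (sg j k).
  rewrite yh in Y; apply: (lift_fun Y); apply: lift_ext Y' => i.
  by case: (eqVneq j i) => [<-|ji]; rewrite ?dfwith_in ?dfwith_out // !expr0z.
apply/ct.
(* The degrees of matched variables and the paddings may differ; off block [j] the quotient is a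
   product of powers of paddings, hence a necklace monomial. *)
have X := emb_var E (inl k); have X' := emb_var E' (inl (sg j k)).
have L := lift_mul X (lift_inv X').
eexists _, _; split; last exact: L.
move=> i /=; case: (eqVneq j i) => [<-|ji].
  by rewrite !dfwith_in; exact: cs cg.
rewrite !dfwith_out // -[X in _ * X]exprN1; apply: necklace_groupM.
  exact: necklace_group_expz.
by apply: necklace_group_expz; exact: necklace_group_expz.
Qed.

End Patterns.

(** * Boundary regions *)

Section CycFloor.
Variable n : nat.
Implicit Types (S : {set 'I_n}) (a x : 'I_n).

Lemma val_ord_pred a : ord_pred a = (if a == 0%N :> nat then n.-1 else a.-1) :> nat.
Proof.
have an := ltn_ord a; rewrite /= ; case: eqP => [->|a0].
  by rewrite add0n modn_small //; move: an; clear; lia.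
have -> : ((a + n).-1 = a.-1 + n)%N by move: a0; clear; lia.
by rewrite modnDr modn_small //; move: an; clear; lia.
Qed.

Lemma cyc_pos_pred a x : x != a -> cyc_pos x (ord_pred a) = (cyc_pos x a).-1.
Proof.
move=> xa; rewrite !cyc_posE val_ord_pred.
have xa' : (x : nat) != a by [].
have := ltn_ord a; have := ltn_ord x; move: xa'; clear.
by do ?case: ifP; lia.
Qed.

Lemma cyc_pos_ord_pred a x : ((cyc_pos x a).+1 < n)%N ->
  cyc_pos (ord_pred x) a = (cyc_pos x a).+1.
Proof.
rewrite !cyc_posE val_ord_pred; have an := ltn_ord a; have xn := ltn_ord x.
case: (posnP x) => [x0|x0].
  rewrite x0 leq0n subn0 => h.
  have -> : (n.-1 <= a)%N = false by move: h an; clear; lia.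
  by move: h an; clear; lia.
case: (leqP x a) => xa h.
  have -> : (x.-1 <= a)%N by move: x0 xa; clear; lia.
  by move: x0 xa; clear; lia.
have -> : (x.-1 <= a)%N = false by move: h x0 xa xn an; clear; lia.
by move: h x0 xa xn an; clear; lia.
Qed.

Lemma cyc_pos_iter_pred i a : (i < n)%N -> cyc_pos (iter i (@ord_pred n) a) a = i.
Proof.
elim: i => [|i IH] i_n; first exact: cyc_pos_xx.
by rewrite iterS cyc_pos_ord_pred IH //; exact: ltnW.
Qed.

Lemma cyc_pos_injl a x y : cyc_pos x a = cyc_pos y a -> x = y.
Proof.
rewrite !cyc_posE => e; apply: val_inj => /=; move: e.
have := ltn_ord a; have := ltn_ord x; have := ltn_ord y; clear.
by do ?case: ifP; lia.
Qed.

Lemma head_filter_traject (T : Type) (p : pred T) f (d x : T) k m : (k < m)%N ->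
  p (iter k f x) -> (forall i, (i < k)%N -> ~~ p (iter i f x)) ->
  head d (filter p (traject f x m)) = iter k f x.
Proof.
elim: k x m => [|k IH] x [|m] //= km pk np; first by rewrite pk.
rewrite (negbTE (np 0%N isT)) IH -?iterSr // => i ik.
by rewrite -iterSr; exact: np.
Qed.

Lemma cyc_floorP S a : S != set0 -> cyc_floor S a \in S /\
  forall q, q \in S -> (cyc_pos (cyc_floor S a) a <= cyc_pos q a)%N.
Proof.
case/set0Pn => q1 q1S.
have [q qS qmin] := @arg_minnP _ q1 (fun q => q \in S) (fun q => cyc_pos q a) q1S.
suff -> : cyc_floor S a = q by [].
have it : iter (cyc_pos q a) (@ord_pred n) a = q.
  by apply: (@cyc_pos_injl a); rewrite cyc_pos_iter_pred ?cyc_pos_lt.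
rewrite /cyc_floor (@head_filter_traject _ _ _ _ _ (cyc_pos q a)) ?it ?cyc_pos_lt //.
move=> i iq; apply/negP => /qmin; rewrite (cyc_pos_iter_pred _ (ltn_trans iq (cyc_pos_lt q a))).
by rewrite leqNgt iq.
Qed.

Lemma cyc_floor_uniq S a q : q \in S ->
  (forall x, x \in S -> (cyc_pos q a <= cyc_pos x a)%N) -> cyc_floor S a = q.
Proof.
move=> qS qmin; have S0 : S != set0 by apply/set0Pn; exists q.
have [fS fmin] := cyc_floorP a S0.
by apply: (@cyc_pos_injl a); apply/eqP; rewrite eqn_leq fmin // qmin.
Qed.

Lemma cyc_floor_in S a : a \in S -> cyc_floor S a = a.
Proof. by move=> aS; apply: cyc_floor_uniq => // x _; rewrite cyc_pos_xx. Qed.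

Lemma cyc_floor_pred S a : S != set0 -> a \notin S -> cyc_floor S (ord_pred a) = cyc_floor S a.
Proof.
move=> S0 aS; have [fS fmin] := cyc_floorP a S0.
have na x : x \in S -> x != a by apply: contraTneq => ->.
apply: cyc_floor_uniq => // x xS.
by rewrite !cyc_pos_pred ?na // -!subn1 leq_sub2r ?fmin.
Qed.

(** A noncrossing block [P j] lies in a single gap of [P i]: distinct floors would alternate with
    [s] and [s']. *)
Lemma cyc_floor_block (M : {set {set 'I_n}}) (P : component_partition M) i j (s s' : 'I_n) : i != j ->
  s \in P j -> s' \in P j -> cyc_floor (P i) s = cyc_floor (P i) s'.
Proof.
move=> ij sj sj'; have [pi pmin] := cyc_floorP s (block_neq0 i).
have [pi' pmin'] := cyc_floorP s' (block_neq0 i).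
move: pmin (pmin' _ pi); move: (cyc_floor _ s) (cyc_floor _ s') pi pi' {pmin'} => p p' pi pi'.
move=> /(_ _ pi'); have ji : j != i by rewrite eq_sym.
have ne x y : x \in P i -> y \in P j -> x <> y :> nat.
  move=> xi yj /val_inj e; move/eqP: ij; apply; apply: (block_disj (c := P) (a := x)) => //.
  by rewrite e.
(* The condition is stated for the linear order; these instances cover all rotations of the cyclic
   one. *)
have := @block_noncrossing _ _ P i j p s p' s' ij pi sj pi' sj'.
have := @block_noncrossing _ _ P i j p s' p' s ij pi sj' pi' sj.
have := @block_noncrossing _ _ P i j p' s p s' ij pi' sj pi sj'.
have := @block_noncrossing _ _ P i j p' s' p s ij pi' sj' pi sj.
have := @block_noncrossing _ _ P j i s p s' p' ji sj pi sj' pi'.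
have := @block_noncrossing _ _ P j i s p' s' p ji sj pi' sj' pi.
have := @block_noncrossing _ _ P j i s' p s p' ji sj' pi sj pi'.
have := @block_noncrossing _ _ P j i s' p' s p ji sj' pi' sj pi.
have := ne _ _ pi sj; have := ne _ _ pi sj'; have := ne _ _ pi' sj; have := ne _ _ pi' sj'.
rewrite !cyc_posE => a1 a2 a3 a4 b1 b2 b3 b4 b5 b6 b7 b8 c1 c2; apply: val_inj => /=.
have := ltn_ord p; have := ltn_ord p'; have := ltn_ord s; have := ltn_ord s'.
move: a1 a2 a3 a4 b1 b2 b3 b4 b5 b6 b7 b8 c1 c2.
move: (nat_of_ord p) (nat_of_ord p') (nat_of_ord s) (nat_of_ord s') => x x' y y'; clear.
case: (ltngtP x x') => //; case: (ltngtP x y) => //; case: (ltngtP x y') => //;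
  case: (ltngtP x' y) => //; case: (ltngtP x' y') => //=; lia.
Qed.

End CycFloor.

Lemma gap_face_floor n (S : {set 'I_n}) (D : plabic S) a : S != set0 ->
  gap_face D a = gap_face D (cyc_floor S a).
Proof.
by move=> S0; have [fS _] := cyc_floorP a S0; rewrite /gap_face (cyc_floor_in fS).
Qed.

Lemma gap_face_bdry_any n (S : {set 'I_n}) (D : plabic S) a : S != set0 ->
  bdry_face (gap_face D a).
Proof.
move=> S0; have [fS _] := cyc_floorP a S0.
by rewrite gap_face_floor //; exact: gap_face_bdry.
Qed.

Lemma coef_groupM (K : fieldType) (s : seed K) (x y : K) : (forall f : froz s, fvar f != 0) ->
  coef_group s x -> coef_group s y -> coef_group s (x * y).
Proof.
move=> f0 [e ->] [e' ->]; exists (fun a => e a + e' a); rewrite -big_split /=.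
by apply: eq_bigr => a _; rewrite expfzDr.
Qed.

Lemma coef_group1 (K : fieldType) (s : seed K) : coef_group s 1.
Proof. by exists (fun=> 0); rewrite big1. Qed.

Lemma coef_group_expz (K : fieldType) (s : seed K) (x : K) (m : int) :
  coef_group s x -> coef_group s (x ^ m).
Proof.
move=> [e ->]; exists (fun a => e a * m).
rewrite (big_morph (fun x => x ^ m) (fun x y => expfzMl x y _) (exp1rz _ _)).
by apply: eq_bigr => a _; rewrite exprz_exp.
Qed.

Lemma coef_group_fvar (K : fieldType) (s : seed K) (f : froz s) : coef_group s (fvar f).
Proof.
exists (fun f' => (f' == f)%:Z); rewrite (bigD1 f) //= eqxx expr1z big1 ?mulr1 // => f' /negbTE ->.
by rewrite expr0z.
Qed.

(** * The coefficient group of the amalgamation *)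

Section Amalgam.
Variables (F : numFieldType) (n : nat) (M : {set {set 'I_n}}) (P : component_partition M).
Variables (A : positroid_ring F M setT)
  (A_ : forall j, positroid_ring F (restriction M (P j)) (P j)) (dl : segre_iso A A_).
Variable s_ : forall j, hpos_seed (A_ j).
Hypothesis rank_gt0 : forall j, (0 < mrank (restriction M (P j)))%N.
Notation D_ j := (hp_diag (s_ j)).
Notation t0 := (amalgamation dl s_).

Definition gap_var (i : 'I_(blocks P)) (a : 'I_n) : pr_field (A_ i) :=
  pr_frac (A_ i) (Delta (A_ i) (hp_lab (gap_face (D_ i) a))).

Lemma gap_bdry i a : bdry_face (gap_face (D_ i) a).
Proof. by apply: gap_face_bdry_any; exact: block_neq0. Qed.

Definition gap_froz i a : froz (hp_seed (s_ i)) :=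
  exist (fun f => bdry_face f) (gap_face (D_ i) a) (gap_bdry i a).

Lemma gap_var_group i a : necklace_group (gap_var i a).
Proof.
have : coef_group (hp_seed (s_ i)) (fvar (gap_froz i a)) by exact: coef_group_fvar.
by move/(hp_coef (s_ i)).
Qed.

Lemma gap_var_neq0 i a : gap_var i a != 0.
Proof. exact: necklace_group_neq0 (gap_var_group i a). Qed.

Lemma arc_subproof a :
  [exists b, arc_region (fun j => D_ j) a == arc_region (fun j => D_ j) b].
Proof. by apply/existsP; exists a. Qed.

Definition arc (a : 'I_n) : froz t0 :=
  exist (fun t : {dffun forall j, face (D_ j)} => [exists b, t == arc_region (fun j => D_ j) b])
    (arc_region (fun j => D_ j) a) (arc_subproof a).

Lemma arc_ex (t : froz t0) : exists a, t = arc a.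
Proof.
case: t => t ht; case/existsP: (ht) => a /eqP e; exists a.
by apply: val_inj.
Qed.

Lemma lift_arc a : lift dl 1 (fun i => gap_var i a) (fvar (arc a)).
Proof.
have h := @lift_theta _ _ _ _ _ _ dl (fun i => Delta (A_ i) (hp_lab (gap_face (D_ i) a)))
  (fun i => degree_Delta (A_ i) _).
have -> : fvar (arc a) = theta dl (fun i => Delta (A_ i) (hp_lab (gap_face (D_ i) a))).
  by apply: theta_ext => i /=; rewrite ffunE.
exact: h.
Qed.

Lemma arc_neq0 t : @fvar _ t0 t != 0.
Proof.
have [a ->] := arc_ex t; apply/eqP => h.
have := lift_mul (lift_arc a) (lift_inv (lift_arc a)).
rewrite h mul0r addrN => L.
have /(lift_fun (lift1 dl)) /eqP : lift dl 0 (fun=> 1) 0.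
  by apply: lift_ext L => k; rewrite divff ?gap_var_neq0.
by rewrite oner_eq0.
Qed.

Lemma necklace_group_prod i (I : finType) (x : I -> pr_field (A_ i)) :
  (forall k, necklace_group (x k)) -> necklace_group (\prod_k x k).
Proof.
move=> h; elim/big_rec: _ => [|k y _ hy]; last exact: necklace_groupM.
by exists (fun=> 0); rewrite big1.
Qed.

Lemma coef_balanced Z : coef_group t0 Z -> balanced_group dl Z.
Proof.
case=> e ->; pose v (t : froz t0) i := pr_frac (A_ i) (Delta (A_ i) (hp_lab (val t i))).
have vE t : exists a, forall i, v t i = gap_var i a.
  have [a ->] := arc_ex t; exists a => i; by rewrite /v /= ffunE.
have L t : lift dl (1 * e t) (fun i => v t i ^ e t) (fvar t ^ e t).
  apply: lift_expz; have [a ->] := arc_ex t.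
  by apply: lift_ext (lift_arc a) => i; rewrite /v /= ffunE.
eexists _, _; split; last exact: (lift_prod (p := predT) (fun t _ => L t)).
move=> i /=; apply: necklace_group_prod => t; apply: necklace_group_expz.
by have [a ->] := vE t; exact: gap_var_group.
Qed.

Definition one_fam (i : 'I_(blocks P)) : pr_field (A_ i) := 1.

(** Moving an arc across the point [c] changes the face only in the block of [c], so the quotient of
    the two frozen variables is a ratio in that block and 1 elsewhere. Such steps are chained
    through the point 0. *)
Lemma slot_one_ratio i a b : exists2 X, coef_group t0 X &
  slot dl one_fam 0 (gap_var i a / gap_var i b) X.
Proof.
have one0 k : one_fam k != 0 by exact: oner_neq0.
pose Q a b := exists2 X, coef_group t0 X & slot dl one_fam 0 (gap_var i a / gap_var i b) X.
have Qrefl c : Q c c.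
  by exists 1; [exact: coef_group1|rewrite divff ?gap_var_neq0 //; exact: slot1].
have Qtrans x y z : Q x y -> Q y z -> Q x z.
  move=> [X cX sX] [Y cY sY]; exists (X * Y); first exact: (coef_groupM arc_neq0).
  have := slot_mul one0 sX sY; rewrite addr0 mulrA divfK //; exact: gap_var_neq0.
have Qsym x y : Q x y -> Q y x.
  move=> [X cX sX]; exists X^-1; first by rewrite -exprN1; exact: coef_group_expz.
  by have := slot_inv sX; rewrite oppr0 invf_div.
have Qstep c : Q c (ord_pred c).
  have gE k : c \notin P k -> gap_var k (ord_pred c) = gap_var k c.
    move=> ck; rewrite /gap_var (gap_face_floor _ (ord_pred c) (block_neq0 k)).
    by rewrite cyc_floor_pred ?block_neq0 // -gap_face_floor ?block_neq0.
  case: (boolP (c \in P i)) => ci; last first.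
    exists 1; [exact: coef_group1|rewrite gE // divff ?gap_var_neq0 //; exact: slot1].
  exists (fvar (arc c) / fvar (arc (ord_pred c))).
    apply: (coef_groupM arc_neq0); first exact: coef_group_fvar.
    by rewrite -exprN1; apply: coef_group_expz; exact: coef_group_fvar.
  have := lift_mul (lift_arc c) (lift_inv (lift_arc (ord_pred c))); rewrite addrN.
  apply: lift_ext => k; case: (eqVneq i k) => [<-|ik]; first by rewrite dfwith_in.
  rewrite dfwith_out // expr0z gE ?divff ?gap_var_neq0 //.
  by apply: contra ik => ck; apply/eqP; exact: (block_disj (c := P) ci ck).
have Q0 m (c d : 'I_n) : (c : nat) = m -> (d : nat) = 0%N -> Q c d.
  elim: m c => [|m IH] c cm d0.
    by have -> : c = d; [apply: val_inj; rewrite /= cm d0|exact: Qrefl].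
  apply: Qtrans (Qstep c) (IH _ _ d0).
  by rewrite val_ord_pred cm.
have n0 : (0 < n)%N := leq_ltn_trans (leq0n _) (ltn_ord a).
pose o := Ordinal n0.
by apply: Qtrans (Q0 a a o erefl erefl) _; apply: Qsym; exact: (Q0 b b o erefl erefl).
Qed.

Lemma balanced_coef Z : balanced_group dl Z -> coef_group t0 Z.
Proof.
case=> d [m [hm L]].
have one0 k : one_fam k != 0 by exact: oner_neq0.
(* Without marked points there are no blocks, and the empty family lifts only to 1. *)
case: (pselect (exists a : 'I_n, True)) => [[a0 _]|no]; last first.
  have noP (j : 'I_(blocks P)) : False by apply: no; exists (block_elt j).
  have -> : Z = 1.
    apply: (lift_fun L); exists (fun=> 1), (fun=> 1).
    by split; rewrite ?mul1r // => j; case: (noP j).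
  exact: coef_group1.
have he j : exists e : froz (hp_seed (s_ j)) -> int, m j = \prod_f fvar f ^ e f.
  by have /(hp_coef (s_ j)) := hm j.
pose e j := projT1 (cid (he j)); have eE j : m j = \prod_f fvar f ^ e j f := projT2 (cid (he j)).
(* Frozen variables have degree 1, so the exponents in each block sum to the common degree. Then
   [gap_var j a0] to the power [d] can be split off in all blocks at once, leaving ratios of degree
   0. *)
have sE j : \sum_f e j f = d.
  apply: (@homfrac_uniq _ _ _ _ (A_ j) _ _ (m j) (rank_gt0 j)); last exact: necklace_group_neq0.
  - rewrite eE; apply: homfrac_prod => f.
    have := homfrac_expz (e j f) (block_neq0 j)
      (homfrac_deg (degree_Delta (A_ j) (hp_lab (val f)))).
    by rewrite mul1r.
  - exact: lift_homfrac L.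
have hX j (f : froz (hp_seed (s_ j))) : exists X, coef_group t0 X /\
    slot dl one_fam 0 (fvar f / gap_var j a0) X.
  case: f => f hf; case/exists_inP: (hf) => s sP /eqP sf.
  have [X cX sX] := slot_one_ratio j s a0; exists X; split=> //.
  by move: sX; rewrite /gap_var sf.
pose X j f := projT1 (cid (hX j f)).
have XP j f : coef_group t0 (X j f) /\ slot dl one_fam 0 (fvar f / gap_var j a0) (X j f)
  := projT2 (cid (hX j f)).
pose u j := \prod_f (fvar f / gap_var j a0) ^ e j f.
pose Y j := \prod_f X j f ^ e j f.
have sY j : slot dl one_fam 0 (u j) (Y j).
  have h f : slot dl one_fam 0 ((fvar f / gap_var j a0) ^ e j f) (X j f ^ e j f).
    by rewrite -[0](mul0r (e j f)); apply: slot_expz => //; exact: (XP j f).2.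
  by have := slot_prod one0 h; rewrite big1.
have cY j : coef_group t0 (Y j).
  rewrite /Y; elim/big_rec: _ => [|f x _ hx]; first exact: coef_group1.
  by apply: (coef_groupM arc_neq0) => //; apply: coef_group_expz; exact: (XP j f).1.
have L1 : lift dl d m ((\prod_j Y j) * fvar (arc a0) ^ d).
  have := lift_mul (lift_prod (p := predT) (fun j _ => sY j)) (lift_expz d (lift_arc a0)).
  rewrite big1 // mul1r add0r; apply: lift_ext => k.
  rewrite (bigD1 k) //= dfwith_in big1 ?mulr1 => [|j jk]; last by rewrite dfwith_out // expr0z.
  rewrite eE -(sE k) -prodr_exprz_sum ?gap_var_neq0 // -big_split /=.
  by apply: eq_bigr => f _; rewrite -expfzMl divfK ?gap_var_neq0.
rewrite (lift_fun L L1); apply: (coef_groupM arc_neq0).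
  elim/big_rec: _ => [|j x _ hx]; first exact: coef_group1.
  exact: (coef_groupM arc_neq0).
by apply: coef_group_expz; exact: coef_group_fvar.
Qed.

End Amalgam.

(** * The initial seed of the amalgamation *)

Lemma block_eltP n (M : {set {set 'I_n}}) (P : component_partition M) j :
  block_elt j \in P j.
Proof. exact: (xchooseP (elimT (set0Pn _) (block_neq0 j))). Qed.

Lemma free_xvar_neq0 (K F : fieldType) (kappa : F -> K) (s : seed K) :
  kappa 1 = 1 -> freely_generating kappa s -> forall v : mut s + froz s, xvar v != 0.
Proof.
move=> k1 [free _] v; apply/eqP => xv.
have := free 'X_(enum_rank v); rewrite /mmap msuppX big_seq1 mcoeffX eqxx k1 mul1r.
rewrite mmap1U enum_rankK xv => /(_ erefl) /(congr1 (mcoeff U_(enum_rank v)%MM)).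
by rewrite mcoeffX eqxx mcoeff0 => /eqP; rewrite oner_eq0.
Qed.

Lemma posz_sumB (I : finType) (p : pred I) (f g : I -> nat) :
  (\sum_(i | p i) f i)%N%:Z - (\sum_(i | p i) g i)%N%:Z = \sum_(i | p i) ((f i)%:Z - (g i)%:Z).
Proof.
by rewrite sumrB; congr (_ - _); rewrite (big_morph Posz PoszD (erefl (Posz 0))).
Qed.

Section SumSingle.
Variables (I : finType) (T : I -> finType) (p q : forall i, pred (T i)).
Variables (a : forall i, T i -> T i -> nat) (j : I) (x : T j).
Hypothesis q0 : forall i, i != j -> q (i := i) =1 pred0.
Hypothesis qj : q (i := j) =1 pred1 x.

Lemma sum_single_r :
  (\sum_i \sum_(v : T i | p v) \sum_(v' : T i | q v') a v v' = \sum_(v : T j | p v) a v x)%N.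
Proof.
rewrite (bigD1 j) //= [X in (_ + X)%N]big1 ?addn0 => [|i ij].
  by apply: eq_bigr => v _; rewrite (big_pred1 x).
by rewrite big1 // => v _; rewrite (big_pred0 _ _ _ _ (q0 ij)).
Qed.

Lemma sum_single_l :
  (\sum_i \sum_(v : T i | q v) \sum_(v' : T i | p v') a v v' = \sum_(v : T j | p v) a x v)%N.
Proof.
rewrite (bigD1 j) //= [X in (_ + X)%N]big1 ?addn0 => [|i ij].
  by rewrite (big_pred1 x).
by rewrite (big_pred0 _ _ _ _ (q0 ij)).
Qed.

End SumSingle.

Section InitialSeed.
Variables (F : numFieldType) (n : nat) (N : {set {set 'I_n}}) (S : {set 'I_n}).
Variables (A : positroid_ring F N S) (s : hpos_seed A).

Lemma skew_diagram : skew (hp_seed s).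
Proof. by move=> k l; rewrite /= /diagram_xmat opprB. Qed.

(** All initial coordinates have degree 1, so uniqueness of degrees turns [hp_homog] into equality
    of the two exponent sums. *)
Lemma balanced_diagram : (0 < mrank N)%N -> @balanced _ (hp_seed s) (fun=> 1).
Proof.
move=> rk k; have [d [h1 h2]] := hp_homog k.
have x0 (v : mut (hp_seed s) + froz (hp_seed s)) : Delta A (hp_lab (fsum v)) != 0.
  have := free_xvar_neq0 _ (hp_free s) v; rewrite scale1r rmorph1 => /(_ erefl).
  by case: v => f /=; rewrite pr_frac_neq0.
have degE (e : iface (hp_diag s) + bface (hp_diag s) -> nat) :
    has_degree d (\prod_v Delta A (hp_lab (fsum v)) ^+ e v) -> d = \sum_v (e v)%:Z.
  move=> hd; apply: (homfrac_uniq rk (homfrac_deg hd)).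
    rewrite rmorph_prod; apply: homfrac_prod => v; rewrite rmorphXn.
    have := homfrac_exp (e v) (homfrac_deg (degree_Delta A (hp_lab (fsum v)))).
    by rewrite mul1r.
  rewrite rmorph_prod; apply/prodf_neq0 => v _.
  by rewrite rmorphXn expf_neq0 // pr_frac_neq0 x0.
rewrite -[RHS](subrr d) {1}(degE _ h1) (degE _ h2) -sumrB; apply: eq_bigr => v _.
by rewrite pos_partB; case: v => ?; rewrite mul1r.
Qed.

End InitialSeed.

Section InitialEmbedding.
Variables (F : numFieldType) (n : nat) (M : {set {set 'I_n}}) (P : component_partition M).
Variables (A : positroid_ring F M setT)
  (A_ : forall j, positroid_ring F (restriction M (P j)) (P j)) (dl : segre_iso A A_).
Variable s_ : forall j, hpos_seed (A_ j).
Hypothesis rank_gt0 : forall j, (0 < mrank (restriction M (P j)))%N.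
Hypothesis gapI : forall j, {in P j &, injective (gap_face (hp_diag (s_ j)))}.
Notation D := (fun j => hp_diag (s_ j)).
Notation t0 := (amalgamation dl s_).

(** The element w_i of the overview for block [j]; the entry at [i = j] is overwritten in [slot]. *)
Definition pad (j i : 'I_(blocks P)) : pr_field (A_ i) := gap_var s_ i (block_elt j).

Lemma gap_face_block i j s : i != j -> s \in P j ->
  gap_face (D i) s = gap_face (D i) (block_elt j).
Proof.
move=> ij sj; rewrite gap_face_floor ?block_neq0 // [RHS]gap_face_floor ?block_neq0 //.
by rewrite (cyc_floor_block ij sj (block_eltP j)).
Qed.

Lemma bface_elt j (f : bface (D j)) : exists s, s \in P j /\ gap_face (D j) s = val f.
Proof. by case: f => f hf; case/exists_inP: (hf) => s sP /eqP sf; exists s. Qed.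

Definition bface_gap j (f : bface (D j)) : 'I_n := projT1 (cid (bface_elt f)).

Lemma bface_gapP j (f : bface (D j)) :
  bface_gap f \in P j /\ gap_face (D j) (bface_gap f) = val f.
Proof. exact: projT2 (cid (bface_elt f)). Qed.

Definition am_phi j (k : mut (hp_seed (s_ j))) : mut t0 := Tagged (fun j => iface (D j)) k.

Definition am_gam j (f : froz (hp_seed (s_ j))) : froz t0 := arc dl s_ (bface_gap f).

Lemma am_phi_inj j : injective (@am_phi j).
Proof. by move=> k l /eqP; rewrite eq_Tagged => /eqP. Qed.

Lemma glued_emb j (v v' : iface (D j) + bface (D j)) :
  glued (j := j) v (emb (@am_phi j) (@am_gam j) v') = (v == v').
Proof.
case: v v' => [f|f] [f'|f'] //=.
  by apply/eqP/eqP => [/(@am_phi_inj j) ->//|[->]].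
have [gP gf] := bface_gapP f; have [gP' gf'] := bface_gapP f'.
apply/exists_inP/eqP => [[s sP /andP[/eqP sf /eqP e]]|[<-]].
  congr inr; apply: val_inj; apply: (etrans (esym sf)); apply: (etrans _ gf').
  by have := congr1 (fun t : {dffun forall j, face (D j)} => t j) e; rewrite !ffunE.
by exists (bface_gap f) => //; rewrite gf !eqxx.
Qed.

(** Here [gapI] is needed: a boundary face could otherwise be glued to the arc regions of several
    points of [P j], not only to that of the chosen [bface_gap]. *)
Lemma glued_notin j (v : iface (D j) + bface (D j)) u :
  (forall v', emb (@am_phi j) (@am_gam j) v' != u) -> glued (j := j) v u = false.
Proof.
move=> nu; apply/negP => g; move: g (nu v); case: v u {nu} => [f|f] [w|t] //=.
  by move=> /eqP ->; rewrite eqxx.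
case/exists_inP => s sP /andP[/eqP sf /eqP st] /eqP []; congr inr; apply: val_inj => /=.
have [gP gf] := bface_gapP f; rewrite -st; congr arc_region.
by apply: (gapI gP sP); exact: (etrans gf (esym sf)).
Qed.

Lemma glued_mut_other j i (v : iface (D i) + bface (D i)) (k : iface (D j)) :
  i != j -> glued (j := i) v (inl (Tagged (fun j => iface (D j)) k)) = false.
Proof.
case: v => //= f ij; apply/eqP => /(congr1 (@tag _ _)) /= e.
by rewrite e eqxx in ij.
Qed.

Lemma am_xmat_sum j (k : iface (D j)) u :
  am_xmat u (Tagged (fun j => iface (D j)) k) =
  \sum_(v | glued (j := j) v u) diagram_xmat v k.
Proof.
pose w := Tagged (fun j => iface (D j)) k.
have g0 i : i != j -> (fun v => glued (j := i) v (inl w)) =1 pred0.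
  by move=> ij v; exact: glued_mut_other.
have gj : (fun v => glued (j := j) v (inl w)) =1 pred1 (inl k).
  by move=> v; exact: (glued_emb v (inl k)).
have h1 := sum_single_l (fun i v => glued (j := i) v u) (fun i => @arrows _ _ (D i)) g0 gj.
have h2 := sum_single_r (fun i v => glued (j := i) v u) (fun i => @arrows _ _ (D i)) g0 gj.
apply: (etrans (f_equal2 (fun x y : nat => x%:Z - y%:Z) h1 h2)).
exact: posz_sumB.
Qed.

Lemma initial_embedding j : embedding dl (pad j) (@am_phi j) (@am_gam j) (fun=> 1).
Proof.
split.
- exact: am_phi_inj.
- move=> f f' /(congr1 val) /= e.
  have := congr1 (fun t : {dffun forall j, face (D j)} => t j) e; rewrite !ffunE.
  by rewrite (bface_gapP f).2 (bface_gapP f').2 => /val_inj.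
- exact: skew_diagram.
- exact: balanced_diagram.
- have theta_lift g : lift dl 1 (fun i => pr_frac (A_ i) (Delta (A_ i) (hp_lab (g i))))
      (theta dl (fun i => Delta (A_ i) (hp_lab (g i : face (D i))))).
    by apply: lift_theta => i; exact: degree_Delta.
  case=> [k|f].
    apply: lift_ext (theta_lift (am_faces (D_ := D) (inl (am_phi k)))) => i /=.
    case: (eqVneq j i) => [<-|ji]; first by rewrite !dfwith_in.
    by rewrite !dfwith_out // expr1z.
  apply: lift_ext (theta_lift (am_faces (D_ := D) (inr (am_gam f)))) => i /=; rewrite ffunE.
  have [gP gf] := bface_gapP f.
  case: (eqVneq j i) => [<-|ji]; first by rewrite dfwith_in gf.
  (* Along [P j] the face of another block is constant, so the other components of a boundary region
     are the padding. *)
  by rewrite dfwith_out // expr1z /pad /gap_var (gap_face_block _ gP) // eq_sym.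
- move=> v k; rewrite [LHS]am_xmat_sum (big_pred1 v) // => v'.
  exact: glued_emb.
- move=> u k hu; rewrite [LHS]am_xmat_sum big_pred0 // => v.
  exact: glued_notin.
Qed.

Lemma initial_block_diagonal : @block_diagonal _ _ t0 (fun k => tag k).
Proof.
move=> [i f] [j k] /= ij; rewrite [LHS]am_xmat_sum big_pred0 // => v.
by apply: glued_mut_other; rewrite eq_sym.
Qed.

Lemma initial_embeds j : embeds_at dl pad (t := t0) (fun k => tag k) (hp_seed (s_ j)).
Proof.
exists (@am_phi j), (@am_gam j), (fun=> 1); split; first exact: initial_embedding.
move=> [i f]; split=> [/= ij|[k <-]//].
by subst i; exists f.
Qed.

End InitialEmbedding.

Theorem lemma4p35 (R : realType) (n : nat) (M : {set {set 'I_n}})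
    (HM : positroid R M) (HL : loopless M) (P : component_partition M)
    (A : positroid_ring R[i] M setT)
    (A_ : forall j : 'I_(blocks P),
            positroid_ring R[i] (restriction M (P j)) (P j))
    (dl : segre_iso A A_)
    (s_ s'_ : forall j : 'I_(blocks P), hpos_seed (A_ j)) :
  (forall j : 'I_(blocks P), quasi_coincident (hp_seed (s_ j)) (hp_seed (s'_ j))) ->
  quasi_coincident (amalgamation dl s_) (amalgamation dl s'_).
Proof.
move=> qc.
have rk j : (0 < mrank (restriction M (P j)))%N by exact: (block_mrank_gt0 HM HL).
have gI (u_ : forall j, hpos_seed (A_ j)) j : {in P j &, injective (gap_face (hp_diag (u_ j)))}.
  exact: (gap_face_inj HM HL).
pose s j := projT1 (cid (qc j)); have hs j := projT2 (cid (qc j)).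
pose s' j := projT1 (cid (hs j)).
have ss j : [/\ reachable (hp_seed (s_ j)) (s j), reachable (hp_seed (s'_ j)) (s' j)
   & quasi_equivalent (s j) (s' j)] := projT2 (cid (hs j)).
have pad0 u_ j i : pad (A_ := A_) u_ j i != 0 by exact: gap_var_neq0.
have [t [col [tr et]]] := embeds_reach_all (pad0 s_)
  (initial_block_diagonal (dl := dl) (s_ := s_))
  (initial_embeds dl rk (gI s_)) (fun j => let: And3 h _ _ := ss j in h).
have [t' [col' [tr' et']]] := embeds_reach_all (pad0 s'_)
  (initial_block_diagonal (dl := dl) (s_ := s'_))
  (initial_embeds dl rk (gI s'_)) (fun j => let: And3 _ h _ := ss j in h).
exists t, t'; split=> //.
have cg u_ Z : coef_group (amalgamation dl u_) Z <-> balanced_group dl Z.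
  by split; [exact: coef_balanced|exact: balanced_coef].
apply: (embeds_quasi_equivalent _ _ _ _ _ et et').
- by move=> j i; exact: gap_var_group.
- by move=> j i; exact: gap_var_group.
- by move=> Z; rewrite -(reachable_froz tr).
- by move=> Z; rewrite -(reachable_froz tr').
- move=> j z; case: (ss j) => h _ _.
  by rewrite -(reachable_froz h) => /(hp_coef (s_ j)).
- by move=> j; case: (ss j).
Qed.
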